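(* Let $(M,F)$ be a Finsler structure with indicatrix bundle $\pi:I\to M$, and let $\nabla$ be any linear connection on the pull-back bundle $\pi^*TM\to I$. Then there exists a homotopy between $\nabla$ and the pull-back $\pi^*\langle\nabla\rangle$ of its averaged connection $\langle\nabla\rangle$, i.e. a continuous family $\{\nabla_t\}_{t\in[0,1]}$ of linear connections on $\pi^*TM\to I$ with $\nabla_0=\nabla$ and $\nabla_1=\pi^*\langle\nabla\rangle$.
   Context: $M$ is a smooth $n$-dimensional manifold. A Finsler structure $(M,F)$ is a function $F:TM\to[0,\infty)$, smooth on $TM\setminus\{0\}$, positively homogeneous of degree one in $y\in T_xM$, whose fundamental tensor $g_{ij}(x,y)=\frac12\frac{\partial^2F^2(x,y)}{\partial y^i\partial y^j}$ is positive definite for $y\neq0$. The indicatrix at $x$ is $I_x=\{y\in T_xM: F(x,y)=1\}$, and $I=\bigcup_x I_x$ with projection $\pi:I\to M$. On $T_xM\setminus\{0\}$ one has the Riemannian metric $g_x=g_{ij}(x,y)\,dy^i\otimes dy^j$; $d\mu(x,y)$ denotes the measure on $I_x$ given by the volume form induced from that of $g_x$, and $\mathrm{vol}(I_x)=\int_{I_x}d\mu(x,y)$. The pull-back bundle $\pi^*TM\to I$ has fiber over $u\in I_x$ canonically identified with $T_xM$; $\pi_2:\pi^*TM\to TM$ denotes this identification, and for a section $Y$ of $TM$, $\pi^*Y$ denotes the pulled-back section of $\pi^*TM$. Fix a non-linear connection on $I$, i.e. a smooth distribution $\mathcal H\subset TI$ complementary to $\ker d\pi$; for $X\in T_xM$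 and $u\in I_x$ let $H_u(X)\in\mathcal H_u$ be its horizontal lift. For a linear connection $\nabla$ on $\pi^*TM\to I$, its averaged connection $\langle\nabla\rangle$ is the affine connection on $M$ given by $$\langle\nabla\rangle_XY(x)=\frac1{\mathrm{vol}(I_x)}\int_{I_x}\pi_2\big(\nabla_{H_u(X)}\pi^*Y\big)\,d\mu(u),\quad u=(x,y),$$ for $X\in T_xM$ and $Y$ a smooth section of $TM$. Its pull-back $\pi^*\langle\nabla\rangle$ is the linear connection on $\pi^*TM$ whose connection $1$-forms in a pulled-back frame $\{\pi^*e_j\}$ are the pull-backs by $\pi$ of the connection $1$-forms of $\langle\nabla\rangle$ in the frame $\{e_j\}$. A family $\nabla_t$ of linear connections is continuous if, for all smooth vector fields $V$ on $I$ and smooth sections $S$ of $\pi^*TM$, the map $(t,u)\mapsto((\nabla_t)_VS)(u)$ is continuous. *)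

(* Defs.v *)
From HB Require Import structures.
From mathcomp Require Import all_boot all_order all_algebra.
From mathcomp Require Import all_classical all_reals all_analysis.

Set Implicit Arguments.
Unset Strict Implicit.
Unset Printing Implicit Defensive.

Import Order.TTheory GRing.Theory Num.Theory.
Import numFieldNormedType.Exports.

Local Open Scope classical_set_scope.
Local Open Scope ring_scope.

Section Smooth.
Context {R : realType} {V W : normedModType R}.

(* C^k on a set [A], meant for [A] open and [V] finite-dimensional; then
   quantifying over all directional derivatives is the same as quantifying over
   the partial derivatives. *)
Fixpoint Ck (k : nat) (A : set V) (f : V -> W) : Prop :=
  match k with
  | 0%N => forall x, A x -> {for x, continuous f}
  | k'.+1 => (forall x, A x -> differentiable f x) /\
             forall v, Ck k' A ('D_v f)
  end.

Definition smooth (A : set V) (f : V -> W) : Prop := forall k, Ck k A f.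

End Smooth.

(* [chart_map] and [chart_inv] are total functions; only their values on
   [chart_dom] and on its image are meaningful. *)
Record chart (R : realType) (n : nat) (M : topologicalType) := Chart {
  chart_dom : set M;
  chart_map :> M -> 'rV[R]_n;
  chart_inv : 'rV[R]_n -> M;
  chart_dom_open : open chart_dom;
  chart_img_open : open (chart_map @` chart_dom);
  chart_mapK : forall x, chart_dom x -> chart_inv (chart_map x) = x;
  chart_map_cont : forall x, chart_dom x -> {for x, continuous chart_map};
  chart_inv_cont : forall x, chart_dom x ->
    {for chart_map x, continuous chart_inv} }.

Definition chart_img (R : realType) n (M : topologicalType) (c : chart R n M) :
  set 'rV[R]_n := c @` chart_dom c.

Record manifold (R : realType) (n : nat) := Manifold {
  carrier :> topologicalType;
  manifold_hausdorff : hausdorff_space carrier;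
  manifold_second_countable : @second_countable carrier;
  atlas : set (chart R n carrier);
  (* a chosen chart around each point, used to represent tangent vectors *)
  chart_at : carrier -> chart R n carrier;
  chart_at_atlas : forall x, atlas (chart_at x);
  chart_at_dom : forall x, chart_dom (chart_at x) x;
  atlas_smooth : forall c c', atlas c -> atlas c' ->
    smooth (c @` (chart_dom c `&` chart_dom c')) (c' \o chart_inv c) }.

(* A tangent vector at [x] is represented by its components with respect to the
   coordinate basis of the chosen chart [chart_at M x]. Accordingly, a point of
   TM is a pair (x, y), and a chart [c] of M induces the chart [tm_coord c] of
   TM, with values in R^n * R^n and inverse [tm_inv c]. The type [Tan M x] does
   not depend on [x], but M * R^n with its product topology or product smooth
   structure is NOT TM. *)
Definition Tan (R : realType) n (M : manifold R n) (x : M) := 'rV[R]_n.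

Section Tangent.
Context {R : realType} {n : nat} {M : manifold R n}.
Local Notation E := 'rV[R]_n.
Local Notation E2 := ('rV[R]_n * 'rV[R]_n)%type.

(* components of [X : Tan M x] in the coordinate basis of [c] *)
Definition tcoord (c : chart R n M) (x : M) (X : Tan x) : E :=
  'D_X (c \o chart_inv (chart_at x)) (chart_at x x).

(* the vector at [chart_inv c a] with components [b] in the basis of [c] *)
Definition tvec (c : chart R n M) (a b : E) : Tan (chart_inv c a) :=
  'D_b (chart_at (chart_inv c a) \o chart_inv c) a.

Definition tm_coord (c : chart R n M) (x : M) (y : Tan x) : E2 :=
  (c x, tcoord c y).

Definition smooth_vfield (Y : forall x : M, Tan x) : Prop :=
  forall c, atlas c ->
  smooth (chart_img c) (fun a => tcoord c (Y (chart_inv c a))).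

End Tangent.

Section Finsler.
Context {R : realType} {n : nat}.
Local Notation E := 'rV[R]_n.
Local Notation E2 := ('rV[R]_n * 'rV[R]_n)%type.

(* [F : TM -> R] read in the chart of TM induced by [c] *)
Definition tm_read (M : manifold R n) (F : forall x : M, Tan x -> R)
    (c : chart R n M) (z : E2) : R :=
  F (chart_inv c z.1) (tvec c z.1 z.2).

(* g_(x,y)(v, w) = 1/2 d^2(F^2)/dy^2 (v, w) *)
Definition fund_tensor (M : manifold R n) (F : forall x : M, Tan x -> R)
    (x : M) (y v w : Tan x) : R :=
  2^-1 * 'D_v ('D_w (fun z : E => F x z ^+ 2)) (y : E).

Record finsler (M : manifold R n) := Finsler {
  finsler_fun :> forall x : M, Tan x -> R;
  finsler_ge0 : forall x (y : Tan x), 0 <= finsler_fun y;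
  finsler_smooth : forall c, atlas c ->
    smooth [set z : E2 | chart_img c z.1 /\ z.2 != 0] (tm_read finsler_fun c);
  finsler_hom : forall x (y : Tan x) (l : R), 0 < l ->
    finsler_fun (l *: (y : E) : Tan x) = l * finsler_fun y;
  finsler_posdef : forall x (y v : Tan x), (y : E) != 0 -> (v : E) != 0 ->
    0 < fund_tensor finsler_fun y v v }.

Definition indicatrix (M : manifold R n) (F : finsler M) (x : M) : set E :=
  [set y | F x y = 1].

(* the total space I *)
Record indicatrix_bundle (M : manifold R n) (F : finsler M) := Ind {
  ibase : M;
  idir : Tan ibase;
  idir_unit : F ibase idir = 1 }.

End Finsler.

Section IndicatrixCalculus.
Context {R : realType} {n : nat} {M : manifold R n} {F : finsler M}.
Local Notation E := 'rV[R]_n.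
Local Notation E2 := ('rV[R]_n * 'rV[R]_n)%type.
Local Notation I := (indicatrix_bundle F).

Definition icoord (c : chart R n M) (u : I) : E2 := tm_coord c (idir u).

(* A tangent vector to TM at [u] is represented by its components in the chart
   of TM induced by [chart_at M (ibase u)]. The components [v.1] along the base
   are those of the projection of [v] to the tangent space of M at [ibase u]. *)
Definition tm_deriv (u : I) (v : E2) (G : E2 -> R) : R :=
  'D_v G (icoord (chart_at (ibase u)) u).

(* T_u I, the kernel of dF at [u] (I is a regular level set of F) *)
Definition tangentI (u : I) : set E2 :=
  [set v | tm_deriv u v (tm_read F (chart_at (ibase u))) = 0].

Definition dpi (u : I) (v : E2) : Tan (ibase u) := v.1.

(* components of the tangent vector [v] in the chart of TM induced by [c] *)
Definition ttcoord (c : chart R n M) (u : I) (v : E2) : E2 :=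
  let c0 := chart_at (ibase u) in
  'D_v (fun z : E2 => tm_coord c (tvec c0 z.1 z.2)) (icoord c0 u).

(* [g], read in the chart of TM around [u], is a smooth extension of [f] from a
   neighbourhood of [u] in I to an open subset of TM *)
Definition local_ext (W : normedModType R) (f : I -> W) (u : I)
    (g : E2 -> W) : Prop :=
  let c := chart_at (ibase u) in
  exists A : set E2, [/\ open A, A (icoord c u), smooth A g &
    forall u', chart_dom c (ibase u') -> A (icoord c u') ->
      g (icoord c u') = f u'].

Definition smooth_at (W : normedModType R) (f : I -> W) (u : I) : Prop :=
  exists g, local_ext f u g.

Definition smooth_fun (f : I -> R) : Prop := forall u, smooth_at f u.

(* A section of the pull-back bundle: its fibre at [u] is [Tan (ibase u)]. *)
Definition psection := forall u : I, Tan (ibase u).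

Definition smooth_section (S : psection) : Prop :=
  forall u0, smooth_at (fun u => tcoord (chart_at (ibase u0)) (S u)) u0.

Definition smooth_ivfield_at (V : I -> E2) (u0 : I) : Prop :=
  smooth_at (fun u => ttcoord (chart_at (ibase u0)) u (V u)) u0.

Definition smooth_ivfield (V : I -> E2) : Prop :=
  forall u, tangentI u (V u) /\ smooth_ivfield_at V u.

Definition pullback_section (Y : forall x : M, Tan x) : psection :=
  fun u => Y (ibase u).

End IndicatrixCalculus.

Arguments psection {R n M} F.

Section Connections.
Context {R : realType} {n : nat} {M : manifold R n}.
Local Notation E := 'rV[R]_n.
Local Notation E2 := ('rV[R]_n * 'rV[R]_n)%type.

(* A smooth distribution of horizontal spaces, complementary to ker d(pi). Its
   rank is n, so that smoothness means being locally spanned by n smooth vector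
   fields of I. *)
Record nonlinear_connection (F : finsler M) := NonlinearConnection {
  hor :> indicatrix_bundle F -> set E2;
  hor_tangent : forall u, hor u `<=` tangentI u;
  hor0 : forall u, hor u 0;
  hor_lin : forall u (a : R) v w, hor u v -> hor u w -> hor u (a *: v + w);
  hor_cap : forall u v, hor u v -> dpi u v = 0 :> E -> v = 0;
  hor_sum : forall u v, tangentI u v ->
    exists h k, [/\ hor u h, tangentI u k, dpi u k = 0 :> E & v = h + k];
  hor_smooth : forall u0 : indicatrix_bundle F,
    let c := chart_at (ibase u0) in
    exists e : 'I_n -> indicatrix_bundle F -> E2,
      (forall i, smooth_ivfield_at (e i) u0) /\
      exists A : set E2, [/\ open A, A (icoord c u0) &
        forall u, chart_dom c (ibase u) -> A (icoord c u) ->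
          hor u = [set v | exists a : 'I_n -> R, v = \sum_i a i *: e i u]] }.

Definition hlift (F : finsler M) (H : nonlinear_connection F)
    (u : indicatrix_bundle F) (X : Tan (ibase u)) : E2 :=
  xget 0 [set w | H u w /\ dpi u w = X].

(* [nabla S u v] is the covariant derivative of the section [S] at [u] in the
   direction [v]. It is a total function, whose values are meaningful only for
   [S] smooth and [v] tangent to I at [u]. In the Leibniz rule, the derivative
   of [f] along [v] is that of any local smooth extension [g] of [f]. *)
Record linear_connection (F : finsler M) := LinearConnection {
  nabla :> psection F -> forall u : indicatrix_bundle F, E2 -> Tan (ibase u);
  nabla_lin : forall S, smooth_section S -> forall u (a : R) v w,
    tangentI u v -> tangentI u w ->
    nabla S u (a *: v + w) = a *: (nabla S u v : E) + (nabla S u w : E);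
  nabla_add : forall S S', smooth_section S -> smooth_section S' ->
    forall u v, tangentI u v ->
    nabla (fun u' => (S u' : E) + (S' u' : E)) u v
    = (nabla S u v : E) + (nabla S' u v : E);
  nabla_leibniz : forall f S, smooth_fun f -> smooth_section S ->
    forall u v g, tangentI u v -> local_ext f u g ->
    nabla (fun u' => f u' *: (S u' : E)) u v
    = tm_deriv u v g *: (S u : E) + f u *: (nabla S u v : E);
  nabla_smooth : forall S V, smooth_section S -> smooth_ivfield V ->
    smooth_section (fun u => nabla S u (V u)) }.

Definition connection_eq (F : finsler M) (D D' : linear_connection F) : Prop :=
  forall S, smooth_section S -> forall u v, tangentI u v -> D S u v = D' S u v.

End Connections.

Definition borel_rV (R : realType) n := g_sigma_algebraType (@open 'rV[R]_n).

(* Integral over R^k, with respect to Lebesgue measure, of a nonnegative Borel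
   function, as an iterated integral (Tonelli). *)
Fixpoint integral_rV (R : realType) (k : nat) : ('rV[R]_k -> \bar R) -> \bar R :=
  match k with
  | 0%N => fun f => f 0
  | k'.+1 => fun f => (\int[@lebesgue_measure R]_t
      integral_rV (fun s : 'rV[R]_k' => f (row_mx (t%:M : 'rV[R]_1) s)))%E
  end.

Section Average.
Context {R : realType} {n : nat} {M : manifold R n}.
Local Notation E := 'rV[R]_n.
Local Notation P := 'rV[R]_n.-1.

(* square root of the determinant of the pull-back by [phi] of the metric g_x *)
Definition vol_density (F : finsler M) (x : M) (phi : P -> E) (s : P) : R :=
  Num.sqrt (\det (\matrix_(a < n.-1, b < n.-1)
    fund_tensor F (phi s : Tan x) ('D_(delta_mx 0 a) phi s)
                                  ('D_(delta_mx 0 b) phi s))).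

Definition indicatrix_param (F : finsler M) (x : M) (U : set P) (phi : P -> E) :
    Prop :=
  [/\ open U, smooth U phi, {in U &, injective phi},
      forall s, U s -> forall w, 'D_w phi s = 0 -> w = 0 &
      phi @` U `<=` indicatrix F x].

(* [mu] is the measure of the volume form induced on the indicatrix at [x] by
   g_x: in every local parametrization it has density sqrt(det(phi^* g_x)). This
   determines [mu] on the Borel subsets of the indicatrix. *)
Definition induced_volume (F : finsler M) (x : M)
    (mu : {measure set (borel_rV R n) -> \bar R}) : Prop :=
  forall U phi, indicatrix_param F x U phi ->
  forall A : set (borel_rV R n), measurable A ->
    mu (A `&` phi @` U)
    = integral_rV (fun s => (\1_(U `&` phi @^-1` A) s * vol_density F x phi s)%:E).

(* [f] is integrated over the fibre I_x; the default value 0 is never reached. *)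
Definition indicatrix_integral (F : finsler M)
    (mu : M -> {measure set (borel_rV R n) -> \bar R}) (x : M)
    (f : indicatrix_bundle F -> R) : R :=
  \int[mu x]_(y in (indicatrix F x : set (borel_rV R n)))
    match pselect (F x (y : E) = 1) with
    | left e => f (Ind e)
    | right _ => 0
    end.

(* [averaged mu H D Y X] is <D>_X Y (x) for [X : Tan x]; the vector-valued
   integral is taken componentwise. The integrand is only evaluated at the [u]
   with [ibase u = x]. *)
Definition averaged (F : finsler M)
    (mu : M -> {measure set (borel_rV R n) -> \bar R})
    (H : nonlinear_connection F) (D : linear_connection F)
    (Y : forall x : M, Tan x) (x : M) (X : Tan x) : Tan x :=
  (fine (mu x (indicatrix F x)))^-1 *:
  \row_j indicatrix_integral mu x
    (fun u => (D (pullback_section Y) u (hlift H (u := u) X) : E) 0 j).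

(* the matrix omega of connection forms: [w j] = \sum_k omega j k *: [e k] *)
Definition conn_matrix (e w : 'I_n -> E) : 'M[R]_n :=
  (\matrix_j w j) *m invmx (\matrix_j e j).

(* [N] is the pull-back of the affine connection [D] on M: in every pulled-back
   frame its connection forms are the pull-backs of those of [D]. *)
Definition is_pullback (F : finsler M)
    (D : (forall x : M, Tan x) -> forall x : M, Tan x -> Tan x)
    (N : linear_connection F) : Prop :=
  forall (U : set M) (e : 'I_n -> forall x : M, Tan x),
  open U -> (forall j, smooth_vfield (e j)) ->
  (forall x, U x -> (\matrix_j (e j x : E)) \in unitmx) ->
  forall (u : indicatrix_bundle F) v, U (ibase u) -> tangentI u v ->
    conn_matrix (fun j => e j (ibase u))
                (fun j => N (pullback_section (e j)) u v)
    = conn_matrix (fun j => e j (ibase u))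
                  (fun j => D (e j) (ibase u) (dpi u v)).

(* Joint continuity of (t, u) |-> ((N t)_V S)(u) on [0, 1] x I, in the charts of
   TM and the local trivializations induced by charts of M. *)
Definition continuous_family (F : finsler M) (N : R -> linear_connection F) :
    Prop :=
  forall S V, smooth_section S -> smooth_ivfield V ->
  forall (t0 : R) (u0 : indicatrix_bundle F), 0 <= t0 <= 1 ->
  let c := chart_at (ibase u0) in
  forall eps : R, 0 < eps -> exists2 delta : R, 0 < delta &
  forall t u, 0 <= t <= 1 -> chart_dom c (ibase u) ->
    `|t - t0| < delta -> `|icoord c u - icoord c u0| < delta ->
    `|tcoord c (N t S u (V u)) - tcoord c (N t0 S u0 (V u0))| < eps.

End Average.

(* Main.v *)
(* The homotopy is the segment N_t = D + t A, where A(u, v) Z is the difference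
   between <D>_(dpi v) Y and D_v (pi^* Y) at u, for any field Y on M with value
   Z at pi(u). Both terms obey the same Leibniz rule along M, so their
   difference is linear over the functions on M and, by a cutoff argument,
   depends on Y through Y(pi(u)) only. The analytic content is the smoothness of
   <D>: radial projection from the faces of a cube in a chart parametrizes all
   nearby indicatrices over the same compact sets, so the average becomes an
   integral over a fixed compact set of a function depending smoothly on the
   base point. *)
Require Import Defs.
From HB Require Import structures.
From mathcomp Require Import all_boot all_order all_algebra.
From mathcomp Require Import all_classical all_reals all_analysis.
From mathcomp Require Import measurable_realfun ring lra.
Set Implicit Arguments.
Unset Strict Implicit.
Unset Printing Implicit Defensive.
Import Order.TTheory GRing.Theory Num.Theory.
Import numFieldNormedType.Exports.
Local Open Scope classical_set_scope.
Local Open Scope ring_scope.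

(** * Smooth functions *)

(** The formula for [A] is available only on pulled-back fields, whereas each connection of the
    family must act on all sections of the pull-back bundle; this is why the pointwise dependence on
    [Y] is indispensable. The normalization by the volume of the fibre is what gives the average its
    Leibniz rule: horizontal lifts project to the given vector, so the term containing the
    derivative of a function is constant along a fibre, and a normalized mean fixes constants. Two
    features of the setting shape the rest. Tangent vectors are stored in a chart chosen separately
    at each point, with no continuity in the point, so smoothness can be asserted only after
    everything is read in one fixed chart. The measures [mu x] are described one base point at a
    time, so their smooth dependence on [x] has to be extracted from the density formula in the
    radial parametrizations. The faces are taken half-open, so that the sectors partition each
    indicatrix exactly and no null sets have to be discarded. *)

Section CkCalculus.
Context {R : realType}.
Implicit Types V W U : normedModType R.

Lemma near_eq_differentiable V W (f g : V -> W) x :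
  (\near x, f x = g x) -> differentiable f x -> differentiable g x.
Proof.
move=> fg df.
have fgx := nbhs_singleton fg.
suff E : g \o shift x = cst (g x) + 'd f x +o_ 0 id.
  apply/diff_locallyP; have dfc := diff_continuous df.
  by rewrite (diff_unique dfc E); split.
have /diff_locally /eqaddoP dfx := df.
apply/eqaddoP => e e0; have := dfx e e0; apply: filter_app.
have : \forall y \near 0, f (y + x) = g (y + x).
  by have := fg; rewrite (near_shift 0) subr0.
apply: filter_app; apply: nearW => y fgy.
by rewrite /= !fctE /= -fgy -fgx.
Qed.

Lemma Ck_sub k V W (A B : set V) (f : V -> W) :
  A `<=` B -> Ck k B f -> Ck k A f.
Proof.
move=> AB; elim: k f => [|k IH] f /=; first by move=> H x /AB/H.
by move=> [df H]; split; [move=> x /AB/df|move=> v; apply/IH/H].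
Qed.

Lemma Ck_ext k V W (A : set V) (f g : V -> W) :
  open A -> (forall x, A x -> f x = g x) -> Ck k A f -> Ck k A g.
Proof.
move=> oA; elim: k f g => [|k IH] f g fg /=.
  move=> H x Ax; have fgn : \near x, f x = g x.
    by apply: filterS (open_nbhs_nbhs (conj oA Ax)) => y /fg.
  rewrite /prop_for /continuous_at -(nbhs_singleton fgn).
  by apply: cvg_trans (H x Ax); exact: near_eq_cvg.
move=> [df H]; have fgn x : A x -> \near x, f x = g x.
  by move=> Ax; apply: filterS (open_nbhs_nbhs (conj oA Ax)) => y /fg.
split=> [x Ax|v]; first exact: near_eq_differentiable (fgn x Ax) (df x Ax).
apply: (IH ('D_v f)) (H v) => x Ax; exact/near_eq_derive/fgn.
Qed.

Lemma CkS k V W (A : set V) (f : V -> W) : Ck k.+1 A f -> Ck k A f.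
Proof.
elim: k f => [|k IH] f.
  by move=> [df _] x Ax; exact/differentiable_continuous/df.
by move=> [df H]; split=> // v; exact/IH/H.
Qed.

Lemma Ck_cst k V W (A : set V) (w : W) : Ck k A (cst w : V -> W).
Proof.
elim: k w => [|k IH] w /=; first by move=> x _; exact: cst_continuous.
split=> [x _|v]; first exact: differentiable_cst.
suff -> : 'D_v (cst w : V -> W) = cst 0 by [].
by apply/funext => x; rewrite derive_cst.
Qed.

Lemma CkD k V W (A : set V) (f g : V -> W) : open A ->
  Ck k A f -> Ck k A g -> Ck k A (f \+ g).
Proof.
move=> oA; elim: k f g => [|k IH] f g /=.
  by move=> fc gc x Ax; exact: continuousD (fc x Ax) (gc x Ax).
move=> [df Hf] [dg Hg]; split=> [x Ax|v].
  exact: differentiableD (df x Ax) (dg x Ax).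
apply: Ck_ext oA _ (IH _ _ (Hf v) (Hg v)) => x Ax /=.
by rewrite deriveD//; [exact/diff_derivable/df|exact/diff_derivable/dg].
Qed.

Lemma linear_cont_diff V W (L : {linear V -> W}) x v : continuous L ->
  differentiable L x /\ 'D_v L x = L v.
Proof.
move=> cL; have dL : differentiable L x by exact: linear_differentiable.
by split=> //; rewrite deriveE// diff_lin.
Qed.

Lemma Ck_linear k V W U (A : set V) (f : V -> W) (L : {linear W -> U}) :
  open A -> continuous L -> Ck k A f -> Ck k A (L \o f).
Proof.
move=> oA cL; elim: k f => [|k IH] f /=.
  by move=> fc x Ax; apply: continuous_comp; [exact: fc|exact: cL].
move=> [df Hf]; split=> [x Ax|v].
  by apply: differentiable_comp; [exact: df|exact: (linear_cont_diff _ 0 cL).1].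
apply: Ck_ext oA _ (IH _ (Hf v)) => x Ax /=.
have dL := (linear_cont_diff (f x) 0 cL).1.
have dc : differentiable (L \o f) x by apply: differentiable_comp => //; exact: df.
rewrite [RHS]deriveE// diff_comp//; last exact: df.
by rewrite /= diff_lin// deriveE//; exact: df.
Qed.

Lemma scale_is_bilinear W :
  bilinear_for
    (GRing.Scale.Law.clone _ _ *:%R _) (GRing.Scale.Law.clone _ _ *:%R _)
    (fun (a : R) (w : W) => a *: w).
Proof.
split=> [u'|u] a x y /=; first by rewrite scalerDl scalerA.
by rewrite scalerDr !scalerA mulrC.
Qed.

(** The product rule is read off the differential of the continuous bilinear map
    [(a, w) |-> a *: w], which covers vector-valued [g]. *)
Lemma diff_scale V W (f : V -> R) (g : V -> W) x v :
  differentiable f x -> differentiable g x ->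
  differentiable (fun y => f y *: g y) x /\
  'D_v (fun y => f y *: g y) x = 'D_v f x *: g x + f x *: 'D_v g x.
Proof.
move=> df dg.
pose B0 (a : R) (w : W) := a *: w.
pose BL : {bilinear R -> W -> W} :=
  HB.pack B0 (bilinear_isBilinear.Build R R W W _ _ B0 (scale_is_bilinear W)).
have cB : continuous (fun p : R * W => BL p.1 p.2).
  by move=> p; exact: scale_continuous.
have dp : differentiable (fun y => (f y, g y)) x by exact: differentiable_pair.
have dB := differentiable_bilin (f x, g x) cB.
have E : (fun y => f y *: g y) = (fun p => BL p.1 p.2) \o (fun y => (f y, g y)).
  by [].
have dc : differentiable (fun y => f y *: g y) x.
  by rewrite E; exact: differentiable_comp.
split=> //; rewrite deriveE// E diff_comp// /comp diff_bilin// diff_pair//=.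
by rewrite !deriveE// addrC.
Qed.

Lemma CkZ k V W (A : set V) (f : V -> R) (g : V -> W) : open A ->
  Ck k A f -> Ck k A g -> Ck k A (fun x => f x *: g x).
Proof.
move=> oA; elim: k f g => [|k IH] f g.
  by move=> fc gc x Ax; exact: continuousZ (fc x Ax) (gc x Ax).
move=> Hf Hg; have [fk gk] := (CkS Hf, CkS Hg).
case: Hf Hg => df Hf [dg Hg]; split=> [x Ax|v].
  exact: (diff_scale 0 (df x Ax) (dg x Ax)).1.
apply: (Ck_ext oA) (CkD oA (IH _ _ (Hf v) gk) (IH _ _ fk (Hg v))) => x Ax /=.
by rewrite (diff_scale v (df x Ax) (dg x Ax)).2.
Qed.

Lemma Ck_sum k V W (A : set V) (I : Type) (r : seq I) (P : pred I)
    (f : I -> V -> W) : open A -> (forall i, P i -> Ck k A (f i)) ->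
  Ck k A (fun x => \sum_(i <- r | P i) f i x).
Proof.
move=> oA H; elim: r => [|i r IH].
  by apply: Ck_ext oA _ (Ck_cst k A (0 : W)) => x _ /=; rewrite big_nil.
case Pi : (P i); last first.
  by apply: Ck_ext oA _ IH => x _; rewrite big_cons Pi.
by apply: Ck_ext oA _ (CkD oA (H i Pi) IH) => x _ /=; rewrite big_cons Pi.
Qed.

End CkCalculus.

(** [Ck] controls derivatives in fixed directions only. A basis with continuous coordinates turns a
    derivative in a moving direction into a finite sum of derivatives in fixed directions. *)
Class findim {R : realType} (W : normedModType R) := Findim {
  fdim : nat;
  fbasis : 'I_fdim -> W;
  fcoord : 'I_fdim -> {linear W -> R};
  fcoord_cont : forall i, continuous (fcoord i);
  fcoordK : forall w, w = \sum_i fcoord i w *: fbasis i }.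
Arguments fdim {R} W {_}.
Arguments fbasis {R W _} _.
Arguments fcoord {R W _} _.
Arguments fcoord_cont {R W _} _.
Arguments fcoordK {R W _} _.

Section FindimInstances.
Context {R : realType}.

Fact findim_RK (w : R) :
  w = \sum_(i < 1) (idfun : {linear R -> R}) w *: (1 : R).
Proof. by rewrite big_ord1 /= [RHS]mulr1. Qed.
#[global] Instance findim_R : findim (R : normedModType R) :=
  @Findim R R 1 (fun=> 1) (fun=> (idfun : {linear R -> R}))
    (fun _ x => cvg_id) findim_RK.

Fact rV_coord_linear n (i : 'I_n) : linear (fun w : 'rV[R]_n => w 0 i : R).
Proof. by move=> a u v; rewrite !mxE. Qed.
Definition rV_coord n (i : 'I_n) : {linear 'rV[R]_n -> R} :=
  HB.pack (fun w : 'rV[R]_n => w 0 i : R)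
    (GRing.isLinear.Build _ _ _ _ _ (rV_coord_linear i)).
Fact findim_rVK n (w : 'rV[R]_n) : w = \sum_i rV_coord i w *: delta_mx 0 i.
Proof. by rewrite {1}[w]row_sum_delta. Qed.
#[global] Instance findim_rV n : findim ('rV[R]_n : normedModType R) :=
  @Findim R 'rV[R]_n n (fun i => delta_mx 0 i) (@rV_coord n)
   (fun i => @coord_continuous R 1 n 0 i) (@findim_rVK n).

Section Prod.
Variables V W : normedModType R.
Fact comp_fst_linear (L : {linear V -> R}) : linear (fun z : V * W => L z.1).
Proof. by move=> a u v /=; rewrite linearP. Qed.
Fact comp_snd_linear (L : {linear W -> R}) : linear (fun z : V * W => L z.2).
Proof. by move=> a u v /=; rewrite linearP. Qed.
Definition comp_fst (L : {linear V -> R}) : {linear (V * W)%type -> R} :=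
  HB.pack (fun z : V * W => L z.1) (GRing.isLinear.Build _ _ _ _ _ (comp_fst_linear L)).
Definition comp_snd (L : {linear W -> R}) : {linear (V * W)%type -> R} :=
  HB.pack (fun z : V * W => L z.2) (GRing.isLinear.Build _ _ _ _ _ (comp_snd_linear L)).

Context {fV : findim V} {fW : findim W}.
Definition prod_basis (i : 'I_(fdim V + fdim W)) : V * W :=
  match fintype.split i with inl j => (fbasis j, 0) | inr j => (0, fbasis j) end.
Definition prod_coord (i : 'I_(fdim V + fdim W)) : {linear (V * W)%type -> R} :=
  match fintype.split i with
  | inl j => comp_fst (fcoord j) | inr j => comp_snd (fcoord j) end.
Fact prod_coord_cont i : continuous (prod_coord i).
Proof.
rewrite /prod_coord; case: (fintype.split i) => j /= z.
  by apply: (@continuous_comp _ _ _ fst); [exact: cvg_fst|exact: fcoord_cont].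
by apply: (@continuous_comp _ _ _ snd); [exact: cvg_snd|exact: fcoord_cont].
Qed.
Fact prod_coordK w : w = \sum_i prod_coord i w *: prod_basis i.
Proof.
case: w => v w; rewrite big_split_ord /= /prod_coord /prod_basis.
under eq_bigr => i _ do rewrite (unsplitK (inl i)) /=.
under [X in _ + X]eq_bigr => i _ do rewrite (unsplitK (inr i)) /=.
have fst_sum n (F : 'I_n -> V * W) : (\sum_i F i).1 = \sum_i (F i).1.
  by apply: (big_morph (fun z : V * W => z.1)).
have snd_sum n (F : 'I_n -> V * W) : (\sum_i F i).2 = \sum_i (F i).2.
  by apply: (big_morph (fun z : V * W => z.2)).
apply/pair_equal_spec; split.
  rewrite [RHS]/= fst_sum (fst_sum _) /= [X in _ + X]big1 ?addr0.
    exact: fcoordK.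
  by move=> i _; rewrite scaler0.
rewrite [RHS]/= snd_sum (snd_sum _) /= [X in X + _]big1 ?add0r.
  exact: fcoordK.
by move=> i _; rewrite scaler0.
Qed.
#[global] Instance findim_prod : findim ((V * W)%type : normedModType R) :=
  @Findim R (V * W)%type _ prod_basis prod_coord prod_coord_cont prod_coordK.
End Prod.

Lemma findim_linear_cont (V W : normedModType R) (fV : findim V)
  (L : {linear V -> W}) : continuous L.
Proof.
have -> : (L : V -> W) = \sum_(i < fdim V) (fun v => fcoord i v *: L (fbasis i)).
  apply/funext => v; rewrite fct_sumE {1}[v]fcoordK linear_sum.
  by apply: eq_bigr => i _; rewrite linearZ.
move=> x; apply: (big_rec (fun f : V -> W => {for x, continuous f})).
  exact: cst_continuous.
move=> i f _ cf; apply: continuousD => //.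
by apply: continuousZ; [exact: fcoord_cont|exact: cst_continuous].
Qed.
End FindimInstances.

Section CkComp.
Context {R : realType}.
Implicit Types V W U : normedModType R.

Lemma derive_comp_sum V W U (fW : findim W) (f : V -> W) (g : W -> U) x v :
  differentiable f x -> differentiable g (f x) ->
  'D_v (g \o f) x = \sum_(i < fdim W) fcoord i ('D_v f x) *: 'D_(fbasis i) g (f x).
Proof.
move=> df dg.
have dc : differentiable (g \o f) x by exact: differentiable_comp.
rewrite (deriveE _ dc) diff_comp//=.
transitivity ('d g (f x) (\sum_i fcoord i ('D_v f x) *: fbasis i)).
  by rewrite -fcoordK (deriveE _ df).
rewrite linear_sum.
by apply: eq_bigr => i _; rewrite linearZ/= (deriveE _ dg).
Qed.

(** The chain rule produces a derivative of [g] in the direction ['D_v f x], which moves with [x];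
    [derive_comp_sum] expands it over the basis, and the induction hypothesis applies to each
    ['D_(fbasis i) g]. *)
Lemma Ck_comp k V W U (fW : findim W) (A : set V) (B : set W)
    (f : V -> W) (g : W -> U) :
  open A -> open B -> A `<=` f @^-1` B -> Ck k A f -> Ck k B g ->
  Ck k A (g \o f).
Proof.
move=> oA oB AB; elim: k g => [|k IH] g.
  move=> fc gc x Ax; apply: continuous_comp; [exact: fc|exact/gc/AB].
move=> Hf Hg; have fk := CkS Hf.
case: Hf Hg => df Hf [dg Hg]; split=> [x Ax|v].
  by apply: differentiable_comp; [exact: df|exact/dg/AB].
apply: (@Ck_ext _ k V U A (fun x => \sum_(i < fdim W)
    (fcoord i \o 'D_v f) x *: ('D_(fbasis i) g \o f) x)) => //; last first.
  apply: Ck_sum => // i _.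
  exact: (CkZ oA (Ck_linear oA (fcoord_cont i) (Hf v)) (IH _ fk (Hg (fbasis i)))).
by move=> x Ax; rewrite /= derive_comp_sum//; [exact: df|exact/dg/AB].
Qed.

End CkComp.

(** * Germs of smooth maps *)

Section SmoothAt.
Context {R : realType}.
Implicit Types V W U : normedModType R.

(** Smoothness of a germ: domains no longer appear in statements, and [smooth_sm] recovers [smooth]
    on an open set. *)
Definition sm V W (f : V -> W) (x : V) : Prop :=
  exists A : set V, [/\ open A, A x & smooth A f].

Lemma smooth_sm V W (A : set V) (f : V -> W) :
  open A -> smooth A f <-> forall x, A x -> sm f x.
Proof.
move=> oA; split=> [H x Ax|H]; first by exists A.
move=> k; elim: k f H => [|k IH] f H /=.
  by move=> x /H[B [oB Bx /(_ 0%N)]]; exact.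
split=> [x /H[B [oB Bx /(_ 1%N)[+ _]]]|v]; first exact.
apply: IH => x /H[B [oB Bx HB]]; exists B; split=> // j.
by have [_] := HB j.+1; exact.
Qed.

Lemma sm_near V W (f : V -> W) x : sm f x -> \near x, sm f x.
Proof.
move=> [A [oA Ax HA]]; apply: filterS (open_nbhs_nbhs (conj oA Ax)) => y Ay.
by exists A.
Qed.

Lemma sm_diff V W (f : V -> W) x : sm f x -> differentiable f x.
Proof. by move=> [A [oA Ax /(_ 1%N)[+ _]]]; exact. Qed.

Lemma sm_cont V W (f : V -> W) x : sm f x -> {for x, continuous f}.
Proof. by move=> /sm_diff/differentiable_continuous. Qed.

Lemma sm_derive V W (f : V -> W) v x : sm f x -> sm ('D_v f) x.
Proof.
by move=> [A [oA Ax HA]]; exists A; split=> // k; have [_] := HA k.+1; exact.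
Qed.

Lemma sm_ext V W (f g : V -> W) x : (\near x, f x = g x) -> sm f x -> sm g x.
Proof.
move=> fg; have : nbhs x [set y | f y = g y] by exact: fg.
rewrite nbhsE => -[B [oB Bx] BE] [A [oA Ax HA]].
exists (A `&` B); split=> //; first exact: openI.
move=> k; apply: Ck_ext (openI oA oB) _ (Ck_sub _ (HA k)) => [y [_ /BE]|y []]//.
Qed.

Lemma sm_eq V W (f g : V -> W) x : (forall y, f y = g y) -> sm f x -> sm g x.
Proof. by move=> /funext ->. Qed.

Lemma sm_cst V W (w : W) x : sm (fun _ : V => w) x.
Proof. by exists setT; split=> // [|k]; [exact: openT|exact: Ck_cst]. Qed.

Lemma sm2 V V' W W' U (f : V -> W) (g : V -> W') (h : V -> U) x :
  (forall A, open A -> smooth A f -> smooth A g -> smooth A h) ->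
  sm f x -> sm g x -> sm h x.
Proof.
move=> H [A [oA Ax HA]] [B [oB Bx HB]]; exists (A `&` B); split=> //.
  exact: openI.
apply: H; first exact: openI.
- by move=> k; apply: Ck_sub (HA k) => y [].
- by move=> k; apply: Ck_sub (HB k) => y [].
Qed.

Lemma smD V W (f g : V -> W) x : sm f x -> sm g x -> sm (fun y => f y + g y) x.
Proof. by apply: (sm2 V) => A oA Hf Hg k; exact: CkD. Qed.

Lemma smZ V W (f : V -> R) (g : V -> W) x :
  sm f x -> sm g x -> sm (fun y => f y *: g y) x.
Proof. by apply: (sm2 V) => A oA Hf Hg k; exact: CkZ. Qed.

Lemma smM V (f g : V -> R) x : sm f x -> sm g x -> sm (fun y => f y * g y) x.
Proof. exact: smZ. Qed.

Lemma smN V W (f : V -> W) x : sm f x -> sm (fun y => - f y) x.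
Proof.
move=> Hf; apply: sm_ext (smZ (sm_cst (-1 : R) x) Hf).
by apply: nearW => y; rewrite scaleN1r.
Qed.

Lemma smB V W (f g : V -> W) x : sm f x -> sm g x -> sm (fun y => f y - g y) x.
Proof. by move=> Hf Hg; apply: smD => //; exact: smN. Qed.

Lemma sm_sum V W (I : Type) (r : seq I) (P : pred I) (f : I -> V -> W) x :
  (forall i, P i -> sm (f i) x) -> sm (fun y => \sum_(i <- r | P i) f i y) x.
Proof.
move=> H; elim: r => [|i r IH].
  by apply: sm_ext (sm_cst 0 x); apply: nearW => y; rewrite big_nil.
case Pi : (P i); last first.
  by apply: sm_ext IH; apply: nearW => y; rewrite big_cons Pi.
by apply: sm_ext (smD (H i Pi) IH); apply: nearW => y; rewrite big_cons Pi.
Qed.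

Lemma sm_prod V (I : Type) (r : seq I) (P : pred I) (f : I -> V -> R) x :
  (forall i, P i -> sm (f i) x) -> sm (fun y => \prod_(i <- r | P i) f i y) x.
Proof.
move=> H; elim: r => [|i r IH].
  by apply: sm_eq (sm_cst (1 : R) x) => y; rewrite big_nil.
case Pi : (P i); last first.
  by apply: sm_ext IH; apply: nearW => y; rewrite big_cons Pi.
by apply: sm_ext (smM (H i Pi) IH); apply: nearW => y; rewrite big_cons Pi.
Qed.

Lemma sm_lin V W {fV : findim V} (L : V -> W) x : linear L -> sm L x.
Proof.
move=> linL.
pose L' : {linear V -> W} := HB.pack L (GRing.isLinear.Build _ _ _ _ _ linL).
have cL : continuous L' by exact: findim_linear_cont.
exists setT; split=> //; first exact: openT.
case=> [|k]; first by move=> y _; exact: cL.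
split=> [y _|v]; first exact: (linear_cont_diff y 0 cL).1.
apply: Ck_ext openT _ (Ck_cst k _ (L v)) => y _ /=.
by rewrite (linear_cont_diff y v cL).2.
Qed.

Lemma sm_id V {fV : findim V} x : sm (fun y : V => y) x.
Proof. exact: sm_lin. Qed.

Lemma sm_fst V W {fV : findim V} {fW : findim W} (z : V * W) : sm fst z.
Proof. by apply: sm_lin => a u v. Qed.

Lemma sm_snd V W {fV : findim V} {fW : findim W} (z : V * W) : sm snd z.
Proof. by apply: sm_lin => a u v. Qed.

Lemma sm_comp V W U {fW : findim W} (f : V -> W) (g : W -> U) x :
  sm f x -> sm g (f x) -> sm (fun y => g (f y)) x.
Proof.
move=> Hf [B [oB Bx HB]]; have [A [oA Ax HA]] := Hf.
have oAB : open (A `&` f @^-1` B).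
  rewrite openE => y [Ay By]; apply: filterI.
    exact: open_nbhs_nbhs (conj oA Ay).
  have : {for y, continuous f} by exact: (HA 0%N).
  by apply; exact: open_nbhs_nbhs (conj oB By).
exists (A `&` f @^-1` B); split=> // k.
apply: (Ck_comp fW oAB oB) (HB k); first by move=> y [].
by apply: Ck_sub (HA k) => y [].
Qed.

Lemma sm_pair V W W' {fW : findim W} {fW' : findim W'} (f : V -> W)
    (g : V -> W') x :
  sm f x -> sm g x -> sm (fun y => (f y, g y)) x.
Proof.
move=> Hf Hg.
have Hi : sm (fun w : W => (w, 0 : W')) (f x).
  apply: sm_lin => a u v; rewrite -[RHS]/((a *: u + v, a *: (0 : W') + 0)).
  by rewrite scaler0 addr0.
have Hj : sm (fun w : W' => (0 : W, w)) (g x).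
  apply: sm_lin => a u v; rewrite -[RHS]/((a *: (0 : W) + 0, a *: u + v)).
  by rewrite scaler0 addr0.
apply: sm_ext (smD (sm_comp Hf Hi) (sm_comp Hg Hj)).
apply: nearW => y /=; rewrite -[LHS]/((f y + 0, 0 + g y)).
by rewrite addr0 add0r.
Qed.

Lemma sm_row V n (f : 'I_n -> V -> R) x :
  (forall j, sm (f j) x) -> sm (fun y => \row_j f j y) x.
Proof.
move=> H; have Hs : sm (fun y => \sum_(j < n) f j y *: (delta_mx 0 j : 'rV[R]_n)) x.
  by apply: sm_sum => j _; apply: smZ => //; exact: sm_cst.
apply: sm_ext Hs; apply: nearW => y.
by rewrite [RHS]row_sum_delta; apply: eq_bigr => i _; rewrite mxE.
Qed.

Lemma sm_entry V n (f : V -> 'rV[R]_n) j x :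
  sm f x -> sm (fun y => f y 0 j : R) x.
Proof.
move=> Hf; apply: (sm_comp (g := fun w : 'rV[R]_n => w 0 j : R) Hf).
by apply: sm_lin => a u v; rewrite !mxE.
Qed.

Lemma derive_fcoord V W {fV : findim V} (f : V -> W) x v :
  differentiable f x ->
  'D_v f x = \sum_(i < fdim V) fcoord i v *: 'D_(fbasis i) f x.
Proof.
move=> df; rewrite deriveE// {1}[v]fcoordK linear_sum.
by apply: eq_bigr => i _; rewrite linearZ/= deriveE.
Qed.

(** Base point and direction both move, as they do in the tangent map of a change of charts;
    expanding [w y] in coordinates leaves derivatives in fixed directions. *)
Lemma sm_derive_var V W U {fW : findim W} (f : W -> U) (p w : V -> W) x :
  sm f (p x) -> sm p x -> sm w x -> sm (fun y => 'D_(w y) f (p y)) x.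
Proof.
move=> Hf Hp Hw.
have Hs : sm (fun y => \sum_(i < fdim W) fcoord i (w y) *: 'D_(fbasis i) f (p y)) x.
  apply: sm_sum => i _; apply: smZ.
    apply: (sm_comp (g := fcoord i) Hw).
    by apply: sm_lin => a u v; rewrite linearP.
  by apply: (sm_comp (g := 'D_(fbasis i) f) Hp); exact: sm_derive.
apply: sm_ext Hs.
have : \near x, sm f (p x) by apply: (sm_cont Hp); exact: sm_near.
by apply: filterS => y /sm_diff df; rewrite -derive_fcoord.
Qed.

Lemma sm_inv V (f : V -> R) x : sm f x -> f x != 0 -> sm (fun y => (f y)^-1) x.
Proof.
move=> Hf fx0; apply: (sm_comp (g := fun t : R => t^-1)) Hf _.
pose A := [set t : R | t != 0]; have oA : open A by exact: open_neq.
exists A; split=> //; elim=> [|k IH].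
  by move=> t t0; exact: inv_continuous.
split=> [t t0|v]; first exact: differentiable_Rinv.
have Hm : Ck k A (fun t : R => (- v) *: (t^-1 *: t^-1)).
  by apply: CkZ oA (Ck_cst _ _ _) (CkZ oA IH IH).
apply: Ck_ext oA _ Hm => t t0 /=.
rewrite deriveE; last exact: differentiable_Rinv.
rewrite diff_Rinv// -[LHS]/(- v * (t^-1 * t^-1)) -[RHS]/(- t ^- 2 * v).
by rewrite -expr2 exprVn mulrC mulrN mulNr.
Qed.

(** The derivative of the square root is a multiple of its inverse, so order [k] for the root,
    composed with the smooth inverse, gives order [k.+1]. *)
Lemma sm_sqrt V (f : V -> R) x :
  sm f x -> 0 < f x -> sm (fun y => Num.sqrt (f y)) x.
Proof.
move=> Hf fx0; apply: (sm_comp (g := fun t : R => Num.sqrt t)) Hf _.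
pose A := [set t : R | 0 < t]; have oA : open A by exact: open_gt.
have dsq (t : R) : 0 < t -> is_derive t 1 (Num.sqrt : R -> R) (2 * Num.sqrt t)^-1.
  by move=> t0; exact: is_derive1_sqrt.
exists A; split=> //; elim=> [|k IH].
  by move=> t _; exact: sqrt_continuous.
split=> [t t0|v]; first by apply/derivable1_diffP; have [] := dsq t t0.
have Hi : Ck k A (fun t : R => (Num.sqrt t)^-1).
  have H0 : Ck k A (GRing.inv \o Num.sqrt : R -> R).
    pose B := [set t : R | t != 0]; have oB : open B by exact: open_neq.
    apply: (Ck_comp _ oA oB) IH _ => [t t0|]; first by rewrite /preimage /B /= sqrtr_eq0 -ltNge.
    have : smooth B (GRing.inv : R -> R).
      by apply/(smooth_sm _ oB) => t t0; exact: (sm_inv (sm_id t)).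
    exact.
  exact: H0.
have Hm : Ck k A (fun t : R => (v / 2) *: (Num.sqrt t)^-1).
  exact: CkZ oA (Ck_cst _ _ _) Hi.
apply: Ck_ext oA _ Hm => t t0 /=.
have dt := dsq t t0.
have dd : differentiable (Num.sqrt : R -> R) t.
  by apply/derivable1_diffP; have [] := dt.
rewrite deriveE// diff1E//.
by have [_] := dt; rewrite derive1E => ->; rewrite invfM [RHS]mulrA.
Qed.

Lemma sm_det V n (f : V -> 'M[R]_n) x :
  (forall i j, sm (fun y => f y i j) x) -> sm (fun y => \det (f y)) x.
Proof.
move=> H; apply: sm_sum => s _; apply: smM; first exact: sm_cst.
by apply: sm_prod => i _.
Qed.

(** Cramer's formula, valid near [x] because the determinant stays nonzero there. *)
Lemma sm_invmx V n (f : V -> 'M[R]_n) x : f x \in unitmx ->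
  (forall i j, sm (fun y => f y i j) x) ->
  forall i j, sm (fun y => invmx (f y) i j) x.
Proof.
move=> ux H i j.
have Hd := sm_det H; have dx0 : \det (f x) != 0 by rewrite -unitfE -unitmxE.
have Hc : sm (fun y => (\det (f y))^-1 * \adj (f y) i j) x.
  apply: smM; first exact: sm_inv.
  apply: (@sm_ext _ _ (fun y => cofactor (f y) j i)).
    by apply: nearW => y; rewrite mxE.
  apply: smM; first exact: sm_cst.
  by apply: sm_det => a b; apply: sm_ext (H (lift j a) (lift i b));
    apply: nearW => y; rewrite !mxE.
apply: sm_ext Hc.
have : \forall y \near x, \det (f y) != 0.
  by apply: cvgr_neq0 (sm_cont Hd) dx0.
apply: filterS => y dy0.
by rewrite /invmx unitmxE unitfE dy0 [RHS]mxE.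
Qed.

Lemma sm_mulmx V m n p (f : V -> 'M[R]_(m, n)) (g : V -> 'M[R]_(n, p)) x :
  (forall i j, sm (fun y => f y i j) x) -> (forall i j, sm (fun y => g y i j) x) ->
  forall i j, sm (fun y => (f y *m g y) i j) x.
Proof.
move=> Hf Hg i j.
have Hs : sm (fun y => \sum_k f y i k * g y k j) x.
  by apply: sm_sum => k _; exact: smM.
by apply: sm_ext Hs; apply: nearW => y; rewrite mxE.
Qed.

End SmoothAt.

(** * Lebesgue measure on row vectors *)

Lemma sigma_finite_product_measure d1 d2 (X : measurableType d1)
    (Y : measurableType d2) (R : realType)
    (m1 : {sigma_finite_measure set X -> \bar R})
    (m2 : {sigma_finite_measure set Y -> \bar R}) :
  sigma_finite setT (m1 \x m2)%E.
Proof.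
have [F FT HF] := sigma_finiteT m1; have [G GT HG] := sigma_finiteT m2.
exists (fun k => if unpickle k is Some ij then F ij.1 `*` G ij.2 else set0).
  apply/seteqP; split=> // -[x y] _.
  have [i _ Fx] : (\bigcup_i F i) x by rewrite -FT.
  have [j _ Gy] : (\bigcup_i G i) y by rewrite -GT.
  by exists (pickle (i, j)) => //; rewrite pickleK.
move=> k; case: (unpickle k : option (nat * nat)) => [[i j]|]; last by rewrite measure0.
have [mF Fi] := HF i; have [mG Gj] := HG j; split; first exact: measurableX.
by rewrite /= product_measure1E// lte_mul_pinfty// ge0_fin_numE.
Qed.

(** The exhausting sets of [X] are carried to [Y] by preimage under the left inverse [psi'].
    Sigma-finiteness must survive so that the next product measure still satisfies Tonelli. *)
Lemma pushforward_sigma_finite d1 d2 (X : measurableType d1)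
    (Y : measurableType d2) (R : realType)
    (m : {measure set X -> \bar R}) (psi : X -> Y)
    (mpsi : measurable_fun setT psi) (psi' : Y -> X) :
  sigma_finite setT m -> measurable_fun setT psi' -> cancel psi psi' ->
  exists2 nu : {sigma_finite_measure set Y -> \bar R},
    (forall A, nu A = m (psi @^-1` A)) &
    forall f : Y -> \bar R, measurable_fun setT f -> (forall y, 0 <= f y)%E ->
      (\int[nu]_y f y = \int[m]_x f (psi x))%E.
Proof.
move=> sm mpsi' psiK.
pose nuM : {measure set Y -> \bar R} :=
  measure_function_pushforward__canonical__measure_function_Measure m mpsi.
have sf : sigma_finite setT nuM.
  have [F FT HF] := sm.
  exists (fun i => psi' @^-1` F i).
    by rewrite -preimage_bigcup -FT preimage_setT.
  move=> i; have [mF fF] := HF i; split.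
    by rewrite -[X in measurable X]setTI; exact: mpsi'.
  rewrite [X in (X < _)%E](_ : _ = m (F i))//.
  congr (m _); apply/seteqP; split=> x /=; by rewrite psiK.
pose nuS : {sigma_finite_measure set Y -> \bar R} :=
  HB.pack (Measure.sort nuM) nuM (Measure_isSigmaFinite.Build _ _ _ nuM sf).
exists nuS => // f mf f0.
transitivity (\int[nuM]_y f y)%E; first by apply: eq_measure_integral.
by rewrite [LHS](ge0_integral_pushforward mpsi)// preimage_setT.
Qed.

Section BorelRV.
Context {R : realType}.

Lemma borel_open n (A : set 'rV[R]_n) :
  open A -> measurable (A : set (borel_rV R n)).
Proof. by move=> oA; apply: sub_sigma_algebra. Qed.

Lemma borel_closed n (A : set 'rV[R]_n) :
  closed A -> measurable (A : set (borel_rV R n)).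
Proof.
move=> cA; rewrite -(setCK A); apply: measurableC.
by apply: (@borel_open n); exact: closed_openC.
Qed.

Lemma within_continuous_borel n (D : set 'rV[R]_n) (f : 'rV[R]_n -> R) :
  measurable (D : set (borel_rV R n)) -> {within D, continuous f} ->
  measurable_fun (D : set (borel_rV R n)) (f : borel_rV R n -> R).
Proof.
move=> mD /continuousP cf; apply: (measurability _ (RGenOpens.measurableE R)).
move=> _ [_ [a [b ->] <-]].
have /cf : open `]a, b[%classic by exact: interval_open.
move=> /open_subspaceP[V oV VD].
rewrite setIC -VD; apply: measurableI => //; exact: borel_open.
Qed.

Lemma continuous_borel_rV n m (f : 'rV[R]_n -> 'rV[R]_m) : continuous f ->
  measurable_fun setT (f : borel_rV R n -> borel_rV R m).
Proof.
move=> /continuousP cf.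
apply: (@measurability _ _ (borel_rV R n) (borel_rV R m) setT f open) => //.
by move=> _ [A oA <-]; rewrite setTI; apply: (@borel_open n); exact: cf.
Qed.

Lemma continuous_borel n (f : 'rV[R]_n -> R) : continuous f ->
  measurable_fun setT (f : borel_rV R n -> R).
Proof.
by move=> cf; apply: within_continuous_borel => //; exact: continuous_subspaceT.
Qed.

Definition cons_rV k (z : R * 'rV[R]_k) : 'rV[R]_k.+1 :=
  row_mx (z.1%:M : 'rV[R]_1) z.2.

Definition uncons_rV k (v : 'rV[R]_k.+1) : R * 'rV[R]_k :=
  (v 0 0, \row_j v 0 (lift 0 j)).

Lemma cons_rV0 k z : @cons_rV k z 0 0 = z.1.
Proof.
rewrite /cons_rV (_ : 0 = lshift k (0 : 'I_1)); last exact/val_inj.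
by apply: etrans (row_mxEl _ _ _ _) _; rewrite mxE.
Qed.

Lemma cons_rVS k z j : @cons_rV k z 0 (lift 0 j) = z.2 0 j.
Proof.
rewrite /cons_rV (_ : lift 0 j = rshift 1 j); last exact/val_inj.
exact: row_mxEr.
Qed.

Lemma cons_rVK k (z : R * 'rV[R]_k) : uncons_rV (cons_rV z) = z.
Proof.
case: z => t s; congr pair; first exact: cons_rV0.
by apply/rowP => j; rewrite mxE cons_rVS.
Qed.

(* Open sets are countable unions of boxes with rational centre and radius, and
   boxes are measurable for the product sigma-algebra. *)
Lemma cons_rV_borel k : measurable_fun setT
  (@cons_rV k : measurableTypeR R * borel_rV R k -> borel_rV R k.+1).
Proof.
apply: (@measurability _ _ _ (borel_rV R k.+1) setT _ open) => //.
move=> _ [A oA <-]; rewrite setTI.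
pose I := (rat * 'rV[rat]_k * rat)%type.
pose rq (w : 'rV[rat]_k) : 'rV[R]_k := map_mx ratr w.
pose box (i : I) : set (measurableTypeR R * borel_rV R k) :=
  [set t : R | ball (ratr i.1.1 : R) (ratr i.2) t] `*`
  [set s : 'rV[R]_k | ball (rq i.1.2) (ratr i.2) s].
have mbox i : measurable (box i).
  apply: measurableX; first exact: measurable_ball.
  apply: (@borel_open k); exact: ball_open.
pose good i := `[< box i `<=` @cons_rV k @^-1` A >].
suff -> : @cons_rV k @^-1` A = \bigcup_(i : I) (if good i then box i else set0).
  apply: countable_bigcupT_measurable; first exact: countableP.
  by move=> i; case: ifP.
apply/seteqP; split=> [[t s] /= Ats|z [i _]]; last first.
  by rewrite /good; case: asboolP => // H /H.
have : nbhs (cons_rV (t, s)) A by exact: open_nbhs_nbhs (conj oA Ats).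
move=> /nbhs_ballP[e /= e0 eA].
(* The given point and any other point of the box are both within [ratr r] of its centre, hence
   within [e] of each other. *)
have [r /[!in_itv]/= /andP[r0 re]] : exists r : rat, ratr r \in `]0, (e / 2)[%R.
  have /rat_in_itvoo[r Hr] : 0 < e / 2 by rewrite divr_gt0.
  by exists r.
have near_rat (x : R) : exists q : rat, ball (ratr q : R) (ratr r) x.
  have /rat_in_itvoo[q] : x - ratr r < x + ratr r.
    by rewrite ltrBlDr -addrA ltrDl addr_gt0.
  rewrite in_itv /= => /andP[q1 q2]; exists q.
  rewrite -ball_normE /= ltr_norml; apply/andP; split; lra.
have [q Hq] := near_rat t.
have /choice[w Hw] : forall j : 'I_k, exists q : rat, ball (ratr q : R) (ratr r) (s 0 j).
  by move=> j; exact: near_rat.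
exists (q, \row_j w j, r) => //; rewrite ifT.
  split=> //=; split=> // i j; rewrite ord1 !mxE; exact: Hw.
apply/asboolP => -[t' s'] /= [/= H1 H2].
apply: eA; split=> // i j; rewrite ord1 {i}.
have tri (x y z : R) : ball z (ratr r) x -> ball z (ratr r) y -> ball x e y.
  move=> zx zy; rewrite (splitr e).
  apply: (@ball_triangle _ _ z); first by apply/ball_sym/(le_ball (ltW re)).
  exact: (le_ball (ltW re)).
case: (unliftP 0 j) => [i|] ->; last by rewrite !cons_rV0; exact: tri Hq H1.
rewrite !cons_rVS /=; have := H2.2 0 i; rewrite !mxE; exact: tri (Hw i).
Qed.

Lemma uncons_rV_borel k : measurable_fun setT
  (@uncons_rV k : borel_rV R k.+1 -> measurableTypeR R * borel_rV R k).
Proof.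
apply: measurable_fun_pair.
  by apply: continuous_borel; exact: coord_continuous.
apply: (@continuous_borel_rV k.+1 k (fun v => \row_j v 0 (lift 0 j))) => v.
have : sm (fun v : 'rV[R]_k.+1 => \row_j v 0 (lift 0 j)) v.
  by apply: sm_row => j; apply: sm_entry; exact: sm_id.
exact: sm_cont.
Qed.

(** The faces used below lie between [ocube] and [cube]: the closed cube provides compactness and
    finite measure, the open one positive measure. *)
Definition cube k : set 'rV[R]_k := [set s | forall j, `|s 0 j| <= 1].
Definition ocube k : set 'rV[R]_k := [set s | forall j, `|s 0 j| < 1].

Lemma cube_rV_compact k : compact (@cube k).
Proof.
have := @rV_compact R k (fun=> `[(-1), 1]%classic) (fun=> @segment_compact R _ _).
congr (compact _); apply/seteqP; split=> s /= H j; have := H j;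
  by rewrite in_itv /= ler_norml.
Qed.

Lemma ocube_open k : open (@ocube k).
Proof.
rewrite openE => s Hs.
suff : nbhs s (fun s' => forall j : 'I_k, `|s' 0 j| < 1) by [].
apply: (@filter_forall _ _ (fun (j : 'I_k) (s' : 'rV[R]_k) => `|s' 0 j| < 1) (nbhs s)) => j.
have : {for s, continuous (fun s' : 'rV[R]_k => `|s' 0 j|)}.
  apply: continuous_comp; first exact: coord_continuous.
  exact: norm_continuous.
by move=> /(_ [set x | x < 1]); apply; apply: open_nbhs_nbhs; split;
  [exact: open_lt|exact: Hs].
Qed.

Lemma cube_borel k : measurable (@cube k : set (borel_rV R k)).
Proof.
apply: borel_closed; apply: compact_closed; last exact: cube_rV_compact.
exact: norm_hausdorff.
Qed.

Lemma ocube_borel k : measurable (@ocube k : set (borel_rV R k)).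
Proof. by apply: (@borel_open k); exact: ocube_open. Qed.

(** [integral_rV] is an iterated integral. Realizing it as integration against a measure gives
    access to monotone convergence and to integrals of signed functions. The measure is the image
    under [cons_rV] of the product of Lebesgue measure with the one of the preceding dimension. *)
Lemma integral_rV_measure k :
  exists lam : {sigma_finite_measure set (borel_rV R k) -> \bar R},
  [/\ forall f : borel_rV R k -> \bar R, measurable_fun setT f ->
        (forall x, 0 <= f x)%E -> integral_rV f = (\int[lam]_x f x)%E,
      (lam (@cube k) < +oo)%E & (0 < lam (@ocube k))%E].
Proof.
elim: k => [|k [lam [IH lam1 lam2]]].
  (* In dimension 0 the iterated integral is evaluation at the only point. *)
  exists (dirac (0 : borel_rV R 0)); split.
  - by move=> f mf f0 /=; rewrite integral_dirac// diracT mul1e.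
  - by rewrite /= /dirac indicE ltry.
  - by rewrite /= /dirac indicE mem_set ?lte_fin// => j; case: j.
pose psi : measurableTypeR R * borel_rV R k -> borel_rV R k.+1 := @cons_rV k.
have mpsi : measurable_fun setT psi by exact: cons_rV_borel.
pose leb : {sigma_finite_measure set (measurableTypeR R) -> \bar R} :=
  @lebesgue_measure R.
pose m := (leb \x lam)%E.
have sfm : sigma_finite setT m by exact: sigma_finite_product_measure.
have lebc : leb `[(-1), 1]%classic = 2%:E.
  apply: etrans (lebesgue_measure_itv _) _ => /=.
  by rewrite lte_fin ifT -?EFinB; [congr EFin|]; lra.
have lebo : leb `](-1), 1[%classic = 2%:E.
  apply: etrans (lebesgue_measure_itv _) _ => /=.
  by rewrite lte_fin ifT -?EFinB; [congr EFin|]; lra.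
have prodc (B : set (borel_rV R k)) : measurable B ->
    m (`[(-1), 1]%classic `*` B) = (2%:E * lam B)%E.
  move=> mB; apply: etrans (product_measure1E _ _ _ mB) _ => //.
  exact: (congr1 (fun x => x * lam B)%E lebc).
have prodo (B : set (borel_rV R k)) : measurable B ->
    m (`](-1), 1[%classic `*` B) = (2%:E * lam B)%E.
  move=> mB; apply: etrans (product_measure1E _ _ _ mB) _ => //.
  exact: (congr1 (fun x => x * lam B)%E lebo).
have [nu nuE intE] := pushforward_sigma_finite mpsi sfm (@uncons_rV_borel k)
  (@cons_rVK k).
exists nu; split.
- move=> f mf f0 /=; rewrite intE// fubini_tonelli1//; last first.
    exact: measurableT_comp.
  apply: eq_integral => t _; rewrite /fubini_F IH//.
  exact: (measurable_fun_pair2 t (measurableT_comp mf mpsi)).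
- rewrite nuE [X in (X < _)%E](_ : _ = m (`[(-1), 1]%classic `*` @cube k)).
    rewrite prodc; first by rewrite lte_mul_pinfty.
    exact: cube_borel.
  congr (m _); apply/seteqP; split=> -[t s] /=.
    move=> H; split=> [|j] /=.
      by have := H 0; rewrite cons_rV0 /= in_itv /= ler_norml.
    by have := H (lift 0 j); rewrite cons_rVS.
  move=> [/= + H2] j; rewrite in_itv /= -ler_norml => H1.
  by case: (unliftP 0 j) => [i|] ->; rewrite ?cons_rV0 ?cons_rVS//; exact: H2.
- rewrite nuE [X in (_ < X)%E](_ : _ = m (`](-1), 1[%classic `*` @ocube k)).
    rewrite prodo; first by rewrite mule_gt0// lte_fin.
    exact: ocube_borel.
  congr (m _); apply/seteqP; split=> -[t s] /=.
    move=> H; split=> [|j] /=.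
      by have := H 0; rewrite cons_rV0 /= in_itv /= ltr_norml.
    by have := H (lift 0 j); rewrite cons_rVS.
  move=> [/= + H2] j; rewrite in_itv /= -ltr_norml => H1.
  by case: (unliftP 0 j) => [i|] ->; rewrite ?cons_rV0 ?cons_rVS//; exact: H2.
Qed.

End BorelRV.

(** * Change of variables through a density *)

Section Density.
Local Open Scope ereal_scope.
Context d1 d2 (X : measurableType d1) (Y : measurableType d2) (R : realType).
Variables (phi : X -> Y) (mphi : measurable_fun setT phi).
Variables (lam : {measure set X -> \bar R}) (mu : {measure set Y -> \bar R}).
Variables (D : set Y) (mD : measurable D) (dens : X -> R).
Hypothesis mdens : measurable_fun setT dens.
Hypothesis dens0 : forall x, (0 <= dens x)%R.
Hypothesis muE : forall A, measurable A -> A `<=` D ->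
  mu A = \int[lam]_x (\1_(phi @^-1` A) x * dens x)%:E.

Import HBNNSimple.

(** The hypothesis [muE] is the case of indicators; simple functions and monotone convergence on
    both sides give the rest. [muE] concerns subsets of [D] only, since the fibre measure will be
    described one sector at a time. *)
Lemma density_change_var (f : Y -> \bar R) :
  measurable_fun D f -> (forall y, D y -> 0 <= f y) ->
  \int[mu]_(y in D) f y = \int[lam]_(x in phi @^-1` D) (f (phi x) * (dens x)%:E).
Proof.
move=> mf f0.
have mpre A : measurable A -> measurable (phi @^-1` A).
  by move=> mA; rewrite -[X in measurable X]setTI; exact: mphi.
have mphiD := mpre _ mD.
pose f_ := nnsfun_approx mD mf.
have mfphi n : measurable_fun setT (f_ n \o phi) by exact: measurableT_comp.
transitivity (limn (fun n => \int[mu]_(x in D) (f_ n x)%:E)).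
  rewrite -monotone_convergence//.
  - apply: eq_integral => y /[!inE] yD; apply/esym/cvg_lim => //.
    by apply: cvg_nnsfun_approx.
  - by move=> n; exact/measurable_EFinP/measurable_funP.
  - by move=> n y _; rewrite lee_fin.
  - by move=> y _ m n mn; rewrite lee_fin; exact/lefP/nd_nnsfun_approx.
rewrite [X in limn X](_ : _ =
    (fun n => \int[lam]_(x in phi @^-1` D) (f_ n (phi x) * dens x)%:E)).
  rewrite -monotone_convergence//; last 3 first.
    - move=> n; apply/measurable_EFinP; apply: measurable_funM.
        by apply: measurable_funTS; exact: mfphi.
      exact: measurable_funTS.
    - by move=> n x _ /=; rewrite lee_fin mulr_ge0.
    - move=> x _ m n mn; rewrite lee_fin ler_wpM2r//.
      exact/lefP/nd_nnsfun_approx.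
  apply: eq_integral => x /[!inE] phiDx /=; apply/cvg_lim => //.
  under eq_fun do rewrite EFinM.
  apply: cvgeZr => //.
  by apply: cvg_nnsfun_approx.
apply/funext => n.
transitivity (\sum_(k \in range (f_ n)) (k%:E * mu (D `&` f_ n @^-1` [set k]))).
  under eq_integral do rewrite fimfunE -fsumEFin//.
  rewrite ge0_integral_fsum//; last 2 first.
  - by move=> y; exact/measurable_EFinP/measurable_funM.
  - by move=> y x _; rewrite nnfun_muleindic_ge0.
  apply: eq_fsbigr => r _; rewrite integralZl_indic_nnsfun// integral_indic//.
  by rewrite setIC.
transitivity (\sum_(k \in range (f_ n)) \int[lam]_(x in phi @^-1` D)
    (k * (\1_(phi @^-1` (f_ n @^-1` [set k])) x * dens x))%:E).
  apply: eq_fsbigr => r; rewrite inE => -[y _ yr].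
  have r0 : (0 <= r)%R by rewrite -yr.
  have mA : measurable (phi @^-1` (f_ n @^-1` [set r])) by exact: mpre.
  under [RHS]eq_integral do rewrite EFinM.
  rewrite [RHS]ge0_integralZl//; last 2 first.
  - apply/measurable_EFinP/measurable_funM; last exact: measurable_funTS.
    exact: measurable_funTS.
  - by move=> x _; rewrite lee_fin mulr_ge0.
  rewrite muE; [|exact: measurableI|by move=> ? []].
  congr (_ * _); rewrite [RHS]integral_mkcond.
  apply: eq_integral => x _; rewrite patchE preimage_setI indicI /=.
  rewrite [\1_(phi @^-1` D) x]indicE; case: (x \in _); last by rewrite !mul0r.
  by rewrite mul1r.
rewrite -ge0_integral_fsum//.
- apply: eq_integral => x _; rewrite fsumEFin//.
  rewrite [X in (X * _)%R]fimfunE; congr EFin.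
  rewrite [RHS]mulr_fsuml; apply: eq_fsbigr => r _.
  by rewrite mulrA.
- move=> r; apply/measurable_EFinP/measurable_funM => //.
  apply: measurable_funM; last exact: measurable_funTS.
  by apply: measurable_funTS; apply: measurable_indic; exact: mpre.
- move=> r x _; rewrite lee_fin mulrA mulr_ge0//.
  exact: (nnfun_muleindic_ge0 (f_ n) r (phi x)).
Qed.

End Density.

(** * Integrals depending on a parameter *)

Section DiffEstimate.
Context {R : realType} {V W : normedModType R}.

(** An explicit estimate in place of the little-o: it is what can be verified for a parameter
    integral and, at the origin, for [flat]. *)
Lemma differentiable_estimate (f : V -> W) (L : {linear V -> W}) x :
  continuous L ->
  (forall e, 0 < e -> \forall v \near 0, `|f (v + x) - f x - L v| <= e * `|v|) ->
  differentiable f x /\ forall v, 'D_v f x = L v.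
Proof.
move=> cL H.
have E : f \o shift x = cst (f x) + L +o_ 0 id.
  apply/eqaddoP => e e0; apply: filterS (H e e0) => v.
  by rewrite /= !fctE /= opprD addrA.
have D := diff_unique cL E.
have df : differentiable f x by apply/diff_locallyP; rewrite D.
by split=> // v; rewrite deriveE// D.
Qed.

Lemma is_derive_line (f : V -> W) (z w : V) (t : R) :
  derivable f (t *: w + z) w ->
  is_derive t 1 (fun t : R => f (t *: w + z)) ('D_w f (t *: w + z)).
Proof.
have E : (fun h : R => h^-1 *: (((fun t : R => f (t *: w + z)) \o shift t) (h *: 1)
      - f (t *: w + z))) =
    (fun h : R => h^-1 *: ((f \o shift (t *: w + z)) (h *: w) - f (t *: w + z))).
  apply/funext => h /=; congr (_ *: (f _ - _)).
  by rewrite -[h *: 1]/(h * 1) mulr1 scalerDl addrA.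
by split; rewrite /derivable /derive E.
Qed.

End DiffEstimate.

Section ParamIntegral.
Context {R : realType} {n m : nat}.
Local Notation V := 'rV[R]_n.
Local Notation S := 'rV[R]_m.
Variables (lam : {measure set (borel_rV R m) -> \bar R}).
Variables (B : set (borel_rV R m)) (K : set S).
Hypotheses (mB : measurable B) (BK : B `<=` K) (cK : compact K).
Hypothesis lamB : (lam B < +oo)%E.

(** The compact set [K] bounds [f], while [B], which need not be closed, is the domain of
    integration and has finite measure. *)
Lemma compact_continuous_integrable (f : S -> R) :
  (forall s, K s -> {for s, continuous f}) ->
  lam.-integrable B (EFin \o (f : borel_rV R m -> R)).
Proof.
move=> cf.
have wK : {within K, continuous f}.
  by apply: continuous_in_subspaceT => s /[!inE]; exact: cf.
have wB : {within (B : set S), continuous f}.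
  by apply: continuous_in_subspaceT => s /[!inE] /BK; exact: cf.
apply: measurable_bounded_integrable => //.
  exact: within_continuous_borel.
have /compact_bounded := continuous_compact wK cK.
move=> [M [Mr HM]]; exists M; split=> // x /HM bx s Bs.
by apply: bx; exists s => //; exact: BK.
Qed.

Lemma Rintegral_sum_seq (I : Type) (r : seq I) (f : I -> borel_rV R m -> R) :
  (forall i, lam.-integrable B (EFin \o f i)) ->
  lam.-integrable B (EFin \o (fun s => \sum_(i <- r) f i s)) /\
  \int[lam]_(s in B) (\sum_(i <- r) f i s) = \sum_(i <- r) \int[lam]_(s in B) f i s.
Proof.
move=> Hf; elim: r => [|i r [IH1 IH2]].
  rewrite big_nil; under eq_fun do rewrite big_nil; split.
    by apply: (compact_continuous_integrable (f := cst 0)) => s _; exact: cst_continuous.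
  by rewrite Rintegral_cst// mul0r.
split.
  rewrite (_ : _ \o _ = (EFin \o f i) \+ (EFin \o (fun s => (\sum_(i <- r) f i s)%R)))%E.
    exact: integrableD.
  by apply/funext => s /=; rewrite big_cons.
rewrite big_cons -IH2 -RintegralD//.
by apply: eq_Rintegral => s _; rewrite big_cons.
Qed.

Variables (h : V * S -> R).

(** The tube lemma: being smooth at a point is an open condition, and [K] is compact. *)
Lemma near_sm_compact a : (forall s, K s -> sm h (a, s)) ->
  \forall a' \near a, forall s, K s -> sm h (a', s).
Proof.
move=> H; have /compact_near_coveringP nc := cK.
apply: (nc V (nbhs a) (fun a' s => sm h (a', s))) => s /H /sm_near.
by move=> [[U1 U2] /= [H1 H2] HU]; exists (U2, U1) => //= -[s' a'] [/= ? ?]; exact: HU.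
Qed.

Lemma derive_pair_sum (f : V * S -> R) z v : differentiable f z ->
  'D_(v, 0) f z = \sum_i v 0 i * 'D_(delta_mx 0 i, 0) f z.
Proof.
move=> df.
have -> : (v, 0 : S) = \sum_i v 0 i *: (delta_mx 0 i : V, 0 : S).
  rewrite {1}[v]row_sum_delta.
  have fst_sum (F : 'I_n -> V * S) : (\sum_i F i).1 = \sum_i (F i).1.
    by apply: (big_morph (fun z : V * S => z.1)).
  have snd_sum (F : 'I_n -> V * S) : (\sum_i F i).2 = \sum_i (F i).2.
    by apply: (big_morph (fun z : V * S => z.2)).
  apply: injective_projections; first by rewrite [RHS]fst_sum.
  by rewrite [RHS]snd_sum [RHS]big1// => i _; rewrite /= scaler0.
rewrite deriveE// linear_sum; apply: eq_bigr => i _.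
by rewrite linearZ /= deriveE.
Qed.

(** The mean value theorem on the segment from [a] to [v + a] turns the increment into a derivative
    at an intermediate point. Compactness makes the partial derivatives there close to those at [a],
    uniformly in [s]. *)
Lemma uniform_increment a e : 0 < e -> (forall s, K s -> sm h (a, s)) ->
  \forall v \near (0 : V), forall s, K s ->
    `|h (v + a, s) - h (a, s) - 'D_(v, 0) h (a, s)| <= e * `|v|.
Proof.
move=> e0 H.
(* Each of the [n] partial derivatives contributes at most [e'] times the norm of [v]; [n.+1] also
   serves [n = 0]. *)
pose e' := e / n.+1%:R.
have e'0 : 0 < e' by rewrite divr_gt0.
pose d i (z : V * S) : R := 'D_(delta_mx 0 i, 0) h z.
have /compact_near_coveringP nc := cK.
have : \forall a' \near a, K `<=` (fun s => sm h (a', s) /\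
    forall i : 'I_n, `|d i (a', s) - d i (a, s)| <= e').
  apply: (nc V (nbhs a) (fun a' s => sm h (a', s) /\
    forall i : 'I_n, `|d i (a', s) - d i (a, s)| <= e')) => s0 Ks0.
  have Hs := sm_near (H s0 Ks0).
  have Hd i : \forall z \near (a, s0), `|d i z - d i (a, z.2)| <= e'.
    have cd : {for (a, s0), continuous (d i)}.
      by apply/sm_cont/sm_derive/H.
    have c2 : {for (a, s0), continuous (fun z : V * S => d i z - d i (a, z.2))}.
      apply: continuousB => //.
      apply: (@continuous_comp _ _ _ (fun z : V * S => (a, z.2)) (d i)).
        by apply: sm_cont; apply: sm_pair; [exact: sm_cst|exact: sm_snd].
      exact: cd.
    have /cvgrPdist_le /(_ e' e'0) := c2; apply: filterS => z.
    by rewrite subrr sub0r normrN.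
  have Ha : \forall z \near (a, s0), forall i : 'I_n, `|d i z - d i (a, z.2)| <= e'.
    apply: (@filter_forall _ _ (fun (i : 'I_n) z => `|d i z - d i (a, z.2)| <= e') (nbhs (a, s0))).
    exact: Hd.
  have [[U1 U2] /= [H1 H2] HU] := filterI Hs Ha.
  exists (U2, U1) => //= -[s' a'] [/= ? ?].
  by have [] := HU (a', s') (conj _ _).
move=> /nbhs_ballP[r /= r0 Hr].
apply/nbhs_ballP; exists r => //= v; rewrite -ball_normE /= sub0r normrN => vr s Ks.
have inball (t : R) : 0 <= t <= 1 -> ball a r (t *: v + a).
  move=> /andP[t0 t1]; rewrite -ball_normE /= opprD addrCA subrr addr0 normrN.
  rewrite normrZ ger0_norm//; apply: le_lt_trans vr.
  by rewrite ler_piMl.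
pose f (t : R) := h (t *: v + a, s).
have df (t : R) : 0 <= t <= 1 -> is_derive t 1 f ('D_(v, 0) h (t *: v + a, s)).
  move=> t01; have [/sm_diff dh _] := Hr _ (inball t t01) s Ks.
  have E x : (x *: v + a, s) = x *: (v, 0 : S) + (a, s) :> V * S.
    by apply: injective_projections => //=; rewrite scaler0 add0r.
  rewrite /f E; under eq_fun do rewrite E.
  by apply: is_derive_line; apply: diff_derivable; rewrite -E.
have [t /[!in_itv]/= t01] : exists2 t : R, t \in `]0, 1[%R &
    f 1 - f 0 = 'D_(v, 0) h (t *: v + a, s) * (1 - 0).
  apply: (MVT (f := f) (df := fun t => 'D_(v, 0) h (t *: v + a, s))) => //.
  - move=> x /[!in_itv]/= /andP[x0 x1]; apply: df.
    by rewrite !ltW.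
  - apply: continuous_in_subspaceT => x /[!inE]/= /[!in_itv]/= x01.
    have [dx _] := df x x01.
    by apply/differentiable_continuous/derivable1_diffP.
have {}t01 : 0 <= t <= 1 by case/andP: t01 => *; rewrite !ltW.
rewrite /f scale1r scale0r add0r subr0 mulr1 => ->.
have [/sm_diff dt Ht] := Hr _ (inball t t01) s Ks.
have da := sm_diff (H s Ks).
rewrite !derive_pair_sum// -sumrB.
apply: le_trans (ler_norm_sum _ _ _) _.
apply: (@le_trans _ _ (\sum_(i < n) `|v| * e')).
  apply: ler_sum => i _; rewrite -mulrBr normrM ler_pM//.
    by rewrite [leRHS]mx_normrE; apply: (le_bigmax _ (fun ij => `|v ij.1 ij.2|) (0, i)).
  exact: Ht.
rewrite sumr_const card_ord -mulr_natr mulrAC -mulrA mulrC ler_wpM2r//.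
by rewrite /e' mulrA ler_pdivrMr// mulrC ler_pM2l// ler_nat.
Qed.

(** Integrating the bound of [uniform_increment] over [B] gives the differentiability estimate, with
    the integral of the partial derivatives as differential. *)
Lemma Rintegral_param_diff a : (forall s, K s -> sm h (a, s)) ->
  differentiable (fun a => \int[lam]_(s in B) h (a, s)) a /\
  forall v, 'D_v (fun a => \int[lam]_(s in B) h (a, s)) a =
    \int[lam]_(s in B) 'D_(v, 0) h (a, s).
Proof.
move=> H.
have csec (f : V * S -> R) b : (forall s, K s -> sm f (b, s)) ->
    lam.-integrable B (EFin \o (fun s => f (b, s))).
  move=> Hf; apply: compact_continuous_integrable => s Ks.
  apply: (@continuous_comp _ _ _ (fun s => (b, s)) f).
    by apply: sm_cont; apply: sm_pair; [exact: sm_cst|exact: sm_id].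
  exact/sm_cont/Hf.
have intD v : lam.-integrable B (EFin \o (fun s => 'D_(v, 0) h (a, s))).
  by apply: (csec ('D_(v, 0) h)) => s Ks; exact/sm_derive/H.
pose L v := \int[lam]_(s in B) 'D_(v, 0) h (a, s).
have LE v : L v = \sum_i v 0 i * L (delta_mx 0 i).
  have iZ i : lam.-integrable B
      (EFin \o (fun s => v 0 i * 'D_(delta_mx 0 i, 0) h (a, s))).
    exact: (integrableZl mB (v 0 i) (intD _)).
  rewrite /L; under [RHS]eq_bigr => i _ do rewrite -(RintegralZl _ mB (intD _)).
  rewrite -(Rintegral_sum_seq _ iZ).2; apply: eq_Rintegral => s sB.
  by apply: derive_pair_sum; apply/sm_diff/H/BK; rewrite inE in sB.
have linL : linear L.
  move=> c u v; rewrite !LE scaler_sumr -big_split /=; apply: eq_bigr => i _.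
  by rewrite !mxE mulrDl -mulrA.
pose L' : {linear V -> R} := HB.pack L (GRing.isLinear.Build _ _ _ _ _ linL).
apply: (@differentiable_estimate _ _ _ _ L').
  exact: findim_linear_cont.
move=> e e0.
pose M := fine (lam B).
have M0 : 0 <= M by rewrite fine_ge0.
(* Integration over [B] multiplies the bound by [M], which may be 0; hence [M + 1]. *)
have e'0 : 0 < e / (M + 1) by rewrite divr_gt0// ltr_wpDl.
have H1 := uniform_increment e'0 H.
have H2 : \forall v \near (0 : V), forall s, K s -> sm h (v + a, s).
  have := near_sm_compact H; rewrite (near_shift 0) subr0.
  by apply: filterS => v; rewrite /= .
near=> v.
have Hv : forall s, K s -> sm h (v + a, s) by near: v.
have Hi : forall s, K s -> `|h (v + a, s) - h (a, s) - 'D_(v, 0) h (a, s)|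
  <= e / (M + 1) * `|v| by near: v.
have i1 := csec h (v + a) Hv.
have i2 := csec h a H.
have i12 : lam.-integrable B (EFin \o (fun s => h (v + a, s) - h (a, s))).
  exact: (integrableB mB i1 i2).
have i3 : lam.-integrable B
    (EFin \o (fun s => h (v + a, s) - h (a, s) - 'D_(v, 0) h (a, s))).
  exact: (integrableB mB i12 (intD v)).
rewrite /= /L -RintegralB// -RintegralB//.
apply: le_trans (le_normr_Rintegral mB i3) _.
apply: (@le_trans _ _ (\int[lam]_(s in B) (e / (M + 1) * `|v|))).
  apply: le_Rintegral => //.
  - exact: (integrable_norm i3).
  - by apply: compact_continuous_integrable => s _; exact: cst_continuous.
  - by move=> s Bs; apply: Hi; exact: BK.
rewrite Rintegral_cst// -/M mulrAC ler_wpM2r//.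
by rewrite mulrAC -mulrA ler_piMr ?(ltW e0)// ler_pdivrMr ?ltr_wpDl// mul1r lerDl.
Unshelve. all: by end_near. Qed.

End ParamIntegral.

Lemma Rintegral_param_sm (R : realType) n m
    (lam : {measure set (borel_rV R m) -> \bar R}) (B : set (borel_rV R m))
    (K : set 'rV[R]_m) (h : 'rV[R]_n * 'rV[R]_m -> R) a :
  measurable B -> B `<=` K -> compact K -> (lam B < +oo)%E ->
  (forall s, K s -> sm h (a, s)) ->
  sm (fun a => \int[lam]_(s in B) h (a, s)) a.
Proof.
move=> mB BK cK lamB H.
have := near_sm_compact cK H; rewrite /= => Hn.
have : nbhs a [set a' | forall s, K s -> sm h (a', s)] by exact: Hn.
rewrite nbhsE => -[A [oA Aa] HA]; exists A; split=> // k.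
have {HA} : forall a', A a' -> forall s, K s -> sm h (a', s) by exact: HA.
(* The integrand is generalized because a derivative of the integral is the integral of another
   integrand, ['D_(v, 0) h]. *)
move: h {H Hn}; elim: k => [|k IH] h HA.
  move=> a' Aa'; apply: differentiable_continuous.
  exact: (Rintegral_param_diff mB BK cK lamB (HA _ Aa')).1.
split=> [a' Aa'|v].
  exact: (Rintegral_param_diff mB BK cK lamB (HA _ Aa')).1.
apply: (Ck_ext oA) (IH ('D_(v, 0) h) _) => a' Aa'.
  by rewrite (Rintegral_param_diff mB BK cK lamB (HA _ Aa')).2.
by move=> s Ks; apply/sm_derive/HA.
Qed.

(** * Cutoff functions on the line *)

Section Bump.
Context {R : realType}.

(* The derivatives of [flat m] are combinations of [flat m.+1] and [flat m.+2],
   so that smoothness follows by induction for all [m] at once. *)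
Definition flat (m : nat) (t : R) : R :=
  if 0 < t then (t^-1) ^+ m * expR (- t^-1) else 0.

Lemma flat_ge0 m t : 0 <= flat m t.
Proof.
by rewrite /flat; case: ifP => // t0; rewrite mulr_ge0 ?expR_ge0// exprn_ge0// invr_ge0 ltW.
Qed.

(** With [x = t^-1], the exponential dominates the term of degree [m.+2] of its series. A quadratic
    bound is what makes the derivative at 0 vanish. *)
Lemma flat_le m t : flat m t <= (m.+2)`!%:R * t ^+ 2.
Proof.
rewrite /flat; case: ifPn => [t0|_]; last by rewrite mulr_ge0// sqr_ge0.
have [x x0 ->] : exists2 x : R, 0 < x & t = x^-1.
  by exists t^-1; rewrite ?invrK ?invr_gt0.
have f0 : 0 < (m.+2)`!%:R :> R by rewrite ltr0n fact_gt0.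
have H : x ^+ m.+2 / (m.+2)`!%:R <= expR x.
  by apply: le_trans (expR_ge1Dxn m.+1 (ltW x0)); rewrite lerDr.
rewrite invrK expRN exprVn.
rewrite ler_pdivrMr ?expR_gt0// mulrAC.
rewrite ler_pdivlMr ?exprn_gt0// -exprD addn2.
by rewrite mulrC -ler_pdivrMr.
Qed.

Lemma flat_derive m t :
  differentiable (flat m) t /\
  forall v, 'D_v (flat m) t = v * (- m%:R * flat m.+1 t + flat m.+2 t).
Proof.
have [t0|t0|->] := ltgtP t 0.
- have E : \near t, cst (0 : R) t = flat m t.
    have : nbhs t [set x | x < 0] by apply: open_nbhs_nbhs; split => //; exact: open_lt.
    by apply: filterS => x /= x0; rewrite /flat ifF//; apply/negbTE; rewrite -leNgt ltW.
  split; first exact: near_eq_differentiable E (differentiable_cst _ _).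
  move=> v; rewrite -(near_eq_derive _ E) derive_cst /flat ltNge (ltW t0) /=.
  by rewrite mulr0 addr0 mulr0.
- pose g : R -> R := fun x => (x^-1) ^+ m * expR (- x^-1).
  have E : \near t, g t = flat m t.
    have : nbhs t [set x | 0 < x] by apply: open_nbhs_nbhs; split => //; exact: open_gt.
    by apply: filterS => x /= x0; rewrite /flat x0.
  have tn0 : t != 0 by rewrite gt_eqF.
  have dV : is_derive t 1 (fun x : R => x^-1) (- (t^-1 ^+ 2)).
    have dd : differentiable (fun x : R => x^-1) t by exact: differentiable_Rinv.
    split; first exact: diff_derivable.
    rewrite deriveE// diff_Rinv// -[LHS]/(- t ^- 2 * 1) mulr1 exprVn.
    by [].
  have dX := @is_deriveX _ _ (fun x : R => x^-1) m t 1 _ dV.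
  have dE : is_derive t 1 (fun x : R => expR (- x^-1)) (t^-1 ^+ 2 * expR (- t^-1)).
    have dN : is_derive t 1 (fun x : R => - x^-1) (t^-1 ^+ 2).
      by rewrite -[X in is_derive _ _ _ X]opprK; apply: is_deriveN.
    have := @is_derive1_comp _ expR (fun x : R => - x^-1) t _ _ (is_derive_expR _) dN.
    by rewrite mulrC.
  have gE : g = (fun x : R => x^-1) ^+ m * (fun x : R => expR (- x^-1)).
    by apply/funext => x; rewrite /g fctE /= exprfctE.
  have := @is_deriveM _ _ _ _ t 1 _ _ dX dE; rewrite -gE => dg.
  have [dg1 dg2] := dg.
  have dgt : differentiable g t := (derivable1_diffP _ _).1 dg1.
  split; first exact: near_eq_differentiable E dgt.
  move=> v; rewrite -(near_eq_derive _ E) deriveE// diff1E// derive1E.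
  have -> : 'D_1 g t = - m%:R * flat m.+1 t + flat m.+2 t.
    rewrite dg2 exprfctE /flat t0.
    rewrite -![_ *: _]/(_ * _).
    (* The power rule lowers the exponent, so exponent 0 is treated apart. *)
    case: m {g E gE dg dgt dX dg1 dg2} => [|m] /=.
      by rewrite !expr0 !mulr0n !mul0r !mulr0 oppr0 mul0r add0r addr0 mul1r.
    rewrite -[LHS]/(_ * _ + _ * _).
    rewrite -mulr_natl !exprS; ring.
  by [].
- have : 0 < (m.+2)`!%:R :> R by rewrite ltr0n fact_gt0.
  set C := _%:R => C0.
  have [| |d D] := @differentiable_estimate R R R (flat m) (\0 : {linear R -> R}) 0.
  + by move=> x; exact: cst_continuous.
  + move=> e e0; have eC : 0 < e / C by rewrite divr_gt0.
    exists (e / C) => //= v; rewrite /= sub0r normrN => vr.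
    rewrite addr0 {2}/flat ltxx !subr0 ger0_norm ?flat_ge0//.
    apply: le_trans (flat_le m v) _; rewrite -/C.
    have -> : v ^+ 2 = `|v| * `|v| by rewrite -expr2 real_normK ?num_real.
    rewrite mulrA ler_wpM2r// mulrC -ler_pdivlMr//; exact: ltW.
  split=> // v; rewrite D /flat ltxx.
  by rewrite mulr0 addr0 mulr0.
Qed.

Lemma flat_sm m t : sm (flat m) t.
Proof.
exists setT; split=> //; first exact: openT.
move=> k; elim: k m => [|k IH] m.
  by move=> x _; apply: differentiable_continuous; exact: (flat_derive m x).1.
split=> [x _|v]; first exact: (flat_derive m x).1.
have H : Ck k setT (fun t : R => v *: ((- m%:R) *: flat m.+1 t + flat m.+2 t)).
  apply: CkZ; [exact: openT|exact: Ck_cst|].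
  apply: CkD; [exact: openT| |exact: IH].
  by apply: CkZ; [exact: openT|exact: Ck_cst|exact: IH].
by apply: Ck_ext openT _ H => x _ /=; rewrite (flat_derive m x).2.
Qed.

Lemma flat_gt0 t : (0 < flat 0 t) = (0 < t).
Proof.
by rewrite /flat; case: ifP => //; rewrite ?ltxx// expr0 mul1r expR_gt0.
Qed.

End Bump.

Lemma derive_comp {R : realType} {U V W : normedModType R} (f : U -> V)
    (g : V -> W) x v :
  differentiable f x -> differentiable g (f x) ->
  'D_v (fun y => g (f y)) x = 'D_('D_v f x) g (f x).
Proof.
move=> df dg; have dc : differentiable (g \o f) x by exact: differentiable_comp.
by rewrite [LHS](deriveE _ dc) diff_comp//= -deriveE// -deriveE.
Qed.

Lemma derive_linear_dir {R : realType} {V W : normedModType R} (f : V -> W) x :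
  differentiable f x -> linear (fun v => 'D_v f x).
Proof. by move=> df a u v; rewrite !deriveE// linearP. Qed.

(** * Charts, tangent vectors and smooth maps on the indicatrix bundle *)

Section Charts.
Context {R : realType} {n : nat} {M : manifold R n}.
Local Notation E := 'rV[R]_n.
Implicit Types (c : chart R n M) (x : M).

Lemma chart_invP c a : chart_img c a ->
  chart_dom c (chart_inv c a) /\ c (chart_inv c a) = a.
Proof. by move=> [x xc <-]; rewrite chart_mapK. Qed.

Lemma chart_img_map c x : chart_dom c x -> chart_img c (c x).
Proof. by move=> xc; exists x. Qed.

Lemma chart_img_near c a : chart_img c a -> \near a, chart_img c a.
Proof. by move=> ac; apply: open_nbhs_nbhs; split => //; exact: chart_img_open. Qed.

Lemma chart_dom_near c x : chart_dom c x -> \near x, chart_dom c x.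
Proof. by move=> xc; apply: open_nbhs_nbhs; split => //; exact: chart_dom_open. Qed.

Lemma chart_inv_near c x (P : M -> Prop) : chart_dom c x ->
  (\near x, P x) -> \forall a \near c x, P (chart_inv c a).
Proof.
move=> xc Px; apply: (chart_inv_cont xc).
by rewrite /= chart_mapK.
Qed.

Lemma chart_map_near c x (P : E -> Prop) : chart_dom c x ->
  (\forall a \near c x, P a) -> \forall x' \near x, P (c x').
Proof. by move=> xc Pa; apply: (chart_map_cont xc). Qed.

Lemma trans_sm c c' x : atlas c -> atlas c' -> chart_dom c x -> chart_dom c' x ->
  sm (c' \o chart_inv c) (c x).
Proof.
move=> Ac Ac' xc xc'.
pose B := c @` (chart_dom c `&` chart_dom c').
have oB : open B.
  rewrite openE => _ [y [yc yc'] <-].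
  have H1 := chart_img_near (chart_img_map yc).
  have H2 := chart_inv_near yc (chart_dom_near yc').
  apply: filterS2 H1 H2 => a [z zc za]; rewrite -za chart_mapK// => zc'.
  by exists z.
by exists B; split; [|exists x|exact: atlas_smooth].
Qed.

Lemma trans_near_comp c c' x (W : Type) (f : M -> W) : chart_dom c x ->
  chart_dom c' x ->
  \forall a \near c x, (f \o chart_inv c') ((c' \o chart_inv c) a) = (f \o chart_inv c) a.
Proof.
move=> xc xc'; have := chart_inv_near xc (chart_dom_near xc').
by apply: filterS => a ac' /=; rewrite chart_mapK.
Qed.

Lemma trans_near_id c c' x : chart_dom c x -> chart_dom c' x ->
  \forall a \near c x, (c \o chart_inv c') ((c' \o chart_inv c) a) = a.
Proof.
move=> xc xc'; have H1 := chart_img_near (chart_img_map xc).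
apply: filterS2 H1 (trans_near_comp c xc xc') => a [y yc <-].
by move=> /= ->; rewrite chart_mapK.
Qed.

Lemma trans_map c c' x : chart_dom c x -> (c' \o chart_inv c) (c x) = c' x.
Proof. by move=> xc; rewrite /= chart_mapK. Qed.

Lemma atA x : atlas (chart_at x). Proof. exact: chart_at_atlas. Qed.
Lemma atD x : chart_dom (chart_at x) x. Proof. exact: chart_at_dom. Qed.

Lemma tcoord_linear c x : atlas c -> chart_dom c x ->
  linear (fun X : E => tcoord c (X : Tan x)).
Proof.
by move=> Ac xc; apply/derive_linear_dir/sm_diff/trans_sm => //; [exact: atA|exact: atD].
Qed.

(** The chain rule for the passage from the chosen chart at [x] through [c] to [c']; the maps
    compose as expected only near the point, which suffices for a derivative. *)
Lemma tcoord_change c c' x (X : Tan x) : atlas c -> atlas c' ->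
  chart_dom c x -> chart_dom c' x ->
  tcoord c' X = 'D_(tcoord c X) (c' \o chart_inv c) (c x).
Proof.
move=> Ac Ac' xc xc'; rewrite /tcoord.
have E1 := trans_near_comp c' (atD x) xc.
rewrite -(near_eq_derive _ E1) derive_comp ?trans_map//; try exact: atD.
- by apply/sm_diff/trans_sm => //; [exact: atA|exact: atD].
- by apply/sm_diff/trans_sm.
Qed.

Lemma tcoord_at x (X : Tan x) : tcoord (chart_at x) X = X.
Proof.
rewrite /tcoord.
have H1 := chart_img_near (chart_img_map (atD x)).
have E1 : \forall a \near chart_at x x, a = (chart_at x \o chart_inv (chart_at x)) a.
  by apply: filterS H1 => a /chart_invP[_ /= ->].
by rewrite -(near_eq_derive X E1) derive_id.
Qed.

Lemma tvecE c x b : chart_dom c x ->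
  tvec c (c x) b = 'D_b (chart_at x \o chart_inv c) (c x) :> E.
Proof. by move=> xc; rewrite /tvec chart_mapK. Qed.

Lemma tvec_tcoord c x (X : Tan x) : atlas c -> chart_dom c x ->
  tvec c (c x) (tcoord c X) = X :> E.
Proof.
move=> Ac xc; rewrite tvecE// -tcoord_change//; first exact: tcoord_at.
  exact: atA.
exact: atD.
Qed.

Lemma tcoord_tvec c a b : atlas c -> chart_img c a -> tcoord c (tvec c a b) = b.
Proof.
move=> Ac [x xc <-]; rewrite /tvec chart_mapK//.
set X := 'D_b _ _.
rewrite /tcoord -(trans_map (chart_at x) xc) /X -derive_comp.
- have E1 := trans_near_id xc (atD x).
  by rewrite (near_eq_derive _ E1) derive_id.
- by apply/sm_diff/trans_sm => //; [exact: atA|exact: atD].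
- rewrite trans_map//; apply/sm_diff/trans_sm => //; [exact: atA|exact: atD].
Qed.

Lemma tvec_linear c a : atlas c -> chart_img c a -> linear (tvec c a : E -> E).
Proof.
move=> Ac [x xc <-] k u v; rewrite !tvecE//; apply/derive_linear_dir.
by apply/sm_diff/trans_sm => //; [exact: atA|exact: atD].
Qed.

Lemma tcoord_inj c x : atlas c -> chart_dom c x -> injective (fun X : E => tcoord c (X : Tan x)).
Proof.
by move=> Ac xc X Y /= XY; rewrite -(tvec_tcoord (X : Tan x) Ac xc) XY tvec_tcoord.
Qed.

Lemma tcoord_surj c x (b : E) : atlas c -> chart_dom c x ->
  exists X : Tan x, tcoord c X = b.
Proof.
move=> Ac xc; have := tcoord_tvec b Ac (chart_img_map xc).
rewrite /tvec chart_mapK//.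
by exists ('D_b (chart_at x \o chart_inv c) (c x)).
Qed.

End Charts.

(** * Germs of maps on the indicatrix bundle *)

Section IndNear.
Context {R : realType} {n : nat} {M : manifold R n} {F : finsler M}.
Local Notation E := 'rV[R]_n.
Local Notation E2 := ('rV[R]_n * 'rV[R]_n)%type.
Local Notation I := (indicatrix_bundle F).
Implicit Types (u : I) (W : normedModType R).

(* Neighbourhoods of [u] in I, where I carries the topology induced from TM. *)
Definition near_ind u (P : I -> Prop) : Prop :=
  let c := chart_at (ibase u) in
  \forall z \near icoord c u,
    forall u', chart_dom c (ibase u') -> icoord c u' = z -> P u'.

Lemma near_ind_self u P : near_ind u P -> P u.
Proof. by move=> /nbhs_singleton; apply => //; exact: atD. Qed.

Lemma near_ind_all u (P : I -> Prop) :
  (forall u', chart_dom (chart_at (ibase u)) (ibase u') -> P u') -> near_ind u P.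
Proof.
move=> H; rewrite /near_ind /=.
have : nbhs (icoord (chart_at (ibase u)) u) setT by exact: filterT.
by apply: filterS => z _ u' d _; exact: H.
Qed.

Lemma near_ind_coord u (Q : E2 -> Prop) :
  (\forall z \near icoord (chart_at (ibase u)) u, Q z) ->
  near_ind u (fun u' => Q (icoord (chart_at (ibase u)) u')).
Proof.
by move=> HQ; rewrite /near_ind /=; apply: filterS HQ => z Qz u' _ ->.
Qed.

Lemma near_indI u P Q : near_ind u P -> near_ind u Q ->
  near_ind u (fun u' => P u' /\ Q u').
Proof. rewrite /near_ind /=; apply: filterS2 => z HP HQ u' d e.
by split; [exact: HP|exact: HQ]. Qed.

Lemma near_indS u (P Q : I -> Prop) : (forall u', P u' -> Q u') ->
  near_ind u P -> near_ind u Q.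
Proof. by move=> PQ; rewrite /near_ind /=; apply: filterS => z HP u' d e; exact/PQ/HP. Qed.

Lemma near_ind_dom u : near_ind u (fun u' => chart_dom (chart_at (ibase u)) (ibase u')).
Proof. exact: near_ind_all. Qed.

Lemma near_ind_base u (P : M -> Prop) :
  (\forall x \near ibase u, P x) -> near_ind u (fun u' => P (ibase u')).
Proof.
move=> Px; pose c := chart_at (ibase u).
have H := chart_inv_near (atD (ibase u)) Px.
have H1 : \forall z \near icoord c u, P (chart_inv c z.1).
  have : {for icoord c u, continuous fst} by exact: cvg_fst.
  by move=> /(_ _ H).
apply: near_indS (near_indI (near_ind_dom u) (near_ind_coord H1)) => u' [d].
by rewrite /= chart_mapK.
Qed.

Lemma smooth_atP W (f : I -> W) u : smooth_at f u <->
  exists2 g : E2 -> W, sm g (icoord (chart_at (ibase u)) u) &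
    near_ind u (fun u' => g (icoord (chart_at (ibase u)) u') = f u').
Proof.
split=> [[g [A [oA Au sA HA]]]|[g [A [oA Au sA]] H]].
  exists g; first by exists A.
  apply: filterS (open_nbhs_nbhs (conj oA Au)) => z Az u' d e.
  by apply: HA; rewrite // e.
move: H; rewrite /near_ind /= => H.
have : nbhs (icoord (chart_at (ibase u)) u) [set z | forall u',
  chart_dom (chart_at (ibase u)) (ibase u') ->
  icoord (chart_at (ibase u)) u' = z ->
  g (icoord (chart_at (ibase u)) u') = f u'] by exact: H.
rewrite nbhsE => -[B [oB Bu] HB].
exists g, (A `&` B); split=> //; first exact: openI.
- by move=> k; apply: Ck_sub (sA k) => z [].
- by move=> u' d [_ Bz]; exact: (HB _ Bz).
Qed.

Lemma smooth_at_ext W (f f' : I -> W) u :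
  near_ind u (fun u' => f u' = f' u') -> smooth_at f u -> smooth_at f' u.
Proof.
move=> ff' /smooth_atP[g sg Hg]; apply/smooth_atP; exists g => //.
by apply: near_indS (near_indI ff' Hg) => u' [<-].
Qed.

Lemma smooth_at_eq W (f f' : I -> W) u :
  (forall u', f u' = f' u') -> smooth_at f u -> smooth_at f' u.
Proof. by move=> /funext ->. Qed.

Lemma smooth_at_comp W W' {fW : findim W} (f : I -> W) (g : W -> W') u :
  smooth_at f u -> sm g (f u) -> smooth_at (fun u => g (f u)) u.
Proof.
move=> /smooth_atP[h sh Hh] sg; apply/smooth_atP; exists (fun z => g (h z)).
  by apply: sm_comp; rewrite ?(near_ind_self Hh).
by apply: near_indS Hh => u' ->.
Qed.

Lemma smooth_at_pair W W' {fW : findim W} {fW' : findim W'} (f : I -> W)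
    (g : I -> W') u :
  smooth_at f u -> smooth_at g u -> smooth_at (fun u => (f u, g u)) u.
Proof.
move=> /smooth_atP[f' sf Hf] /smooth_atP[g' sg Hg]; apply/smooth_atP.
exists (fun z => (f' z, g' z)); first exact: sm_pair.
by apply: near_indS (near_indI Hf Hg) => u' [-> ->].
Qed.

Lemma smooth_at_cst W (w : W) u : smooth_at (fun _ : I => w) u.
Proof. by apply/smooth_atP; exists (fun=> w); [exact: sm_cst|exact: near_ind_all]. Qed.

Lemma smooth_atD W (f g : I -> W) u :
  smooth_at f u -> smooth_at g u -> smooth_at (fun u => f u + g u) u.
Proof.
move=> /smooth_atP[f' sf Hf] /smooth_atP[g' sg Hg]; apply/smooth_atP.
exists (fun z => f' z + g' z); first exact: smD.
by apply: near_indS (near_indI Hf Hg) => u' [-> ->].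
Qed.

Lemma smooth_atN W (f : I -> W) u :
  smooth_at f u -> smooth_at (fun u => - f u) u.
Proof.
move=> /smooth_atP[f' sf Hf]; apply/smooth_atP.
exists (fun z => - f' z); first exact: smN.
by apply: near_indS Hf => u' ->.
Qed.

Lemma smooth_atZ W (f : I -> R) (g : I -> W) u :
  smooth_at f u -> smooth_at g u -> smooth_at (fun u => f u *: g u) u.
Proof.
move=> /smooth_atP[f' sf Hf] /smooth_atP[g' sg Hg]; apply/smooth_atP.
exists (fun z => f' z *: g' z); first exact: smZ.
by apply: near_indS (near_indI Hf Hg) => u' [-> ->].
Qed.

Lemma smooth_atM (f g : I -> R) u :
  smooth_at f u -> smooth_at g u -> smooth_at (fun u => f u * g u) u.
Proof. exact: smooth_atZ. Qed.

Lemma smooth_at_sum W (J : Type) (r : seq J) (P : pred J) (f : J -> I -> W) u :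
  (forall j, P j -> smooth_at (f j) u) ->
  smooth_at (fun u => \sum_(j <- r | P j) f j u) u.
Proof.
move=> H; elim: r => [|j r IH].
  by apply: smooth_at_eq (smooth_at_cst 0 u) => u'; rewrite big_nil.
case Pj : (P j); last first.
  by apply: smooth_at_eq IH => u'; rewrite big_cons Pj.
by apply: smooth_at_eq (smooth_atD (H j Pj) IH) => u'; rewrite big_cons Pj.
Qed.

Lemma smooth_at_entry (f : I -> E) j u :
  smooth_at f u -> smooth_at (fun u => f u 0 j : R) u.
Proof.
move=> /smooth_atP[g sg Hg]; apply/smooth_atP.
exists (fun z => g z 0 j); first exact: sm_entry.
by apply: near_indS Hg => u' ->.
Qed.

(** A single neighbourhood serves all entries, so that the matrix of extensions can be inverted as a
    whole. *)
Lemma smooth_at_mx m p (f : 'I_m -> 'I_p -> I -> R) u :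
  (forall i j, smooth_at (f i j) u) -> exists g : 'I_m -> 'I_p -> E2 -> R,
  (forall i j, sm (g i j) (icoord (chart_at (ibase u)) u)) /\
  near_ind u (fun u' => forall i j, g i j (icoord (chart_at (ibase u)) u') = f i j u').
Proof.
move=> H.
have /choice[g Hg] : forall ij : 'I_m * 'I_p, exists g : E2 -> R,
    sm g (icoord (chart_at (ibase u)) u) /\
    near_ind u (fun u' => g (icoord (chart_at (ibase u)) u') = f ij.1 ij.2 u').
  by move=> [i j]; have /smooth_atP[g ? ?] := H i j; exists g.
exists (fun i j => g (i, j)); split=> [i j|]; first exact: (Hg (i, j)).1.
have : \forall z \near icoord (chart_at (ibase u)) u, forall ij : 'I_m * 'I_p,
    forall u', chart_dom (chart_at (ibase u)) (ibase u') ->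
    icoord (chart_at (ibase u)) u' = z ->
    g ij (icoord (chart_at (ibase u)) u') = f ij.1 ij.2 u'.
  apply: (@filter_forall _ _ (fun (ij : 'I_m * 'I_p) z => forall u',
    chart_dom (chart_at (ibase u)) (ibase u') ->
    icoord (chart_at (ibase u)) u' = z ->
    g ij (icoord (chart_at (ibase u)) u') = f ij.1 ij.2 u')
    (nbhs (icoord (chart_at (ibase u)) u))) => ij.
  exact: (Hg ij).2.
by rewrite /near_ind /=; apply: filterS => z Hz u' d e i j; exact: (Hz (i, j) u' d e).
Qed.

Lemma smooth_at_invmx m (f : 'I_m -> 'I_m -> I -> R) u :
  (forall i j, smooth_at (f i j) u) ->
  (\matrix_(i, j) f i j u) \in unitmx ->
  (forall i j, smooth_at (fun u => invmx (\matrix_(i, j) f i j u) i j) u) /\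
  near_ind u (fun u' => (\matrix_(i, j) f i j u') \in unitmx).
Proof.
move=> /smooth_at_mx[g [sg Hg]] fu.
have E0 u' : (forall i j, g i j (icoord (chart_at (ibase u)) u') = f i j u') ->
    \matrix_(i, j) g i j (icoord (chart_at (ibase u)) u') = \matrix_(i, j) f i j u'.
  by move=> H; apply/matrixP => i j; rewrite !mxE.
have gu : (\matrix_(i, j) g i j (icoord (chart_at (ibase u)) u)) \in unitmx.
  by rewrite E0//; exact: (near_ind_self Hg).
have sg' i j : sm (fun z => (\matrix_(i, j) g i j z) i j)
    (icoord (chart_at (ibase u)) u).
  by apply: sm_eq (sg i j) => z; rewrite mxE.
split=> [i j|].
  apply/smooth_atP; exists (fun z => invmx (\matrix_(i, j) g i j z) i j).
    exact: (sm_invmx gu sg').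
  by apply: near_indS Hg => u' /E0 ->.
have Hd := sm_det sg'.
have : \forall z \near icoord (chart_at (ibase u)) u,
    \det (\matrix_(i, j) g i j z) != 0.
  by apply: cvgr_neq0 (sm_cont Hd) _; rewrite -unitfE -unitmxE.
move=> Hn; have : near_ind u (fun u' =>
    \det (\matrix_(i, j) g i j (icoord (chart_at (ibase u)) u')) != 0).
  exact: (near_ind_coord Hn).
move=> /near_indI /(_ Hg); apply: near_indS => u' [H1 /E0 E1].
by rewrite -E1 unitmxE unitfE.
Qed.

Lemma smooth_at_icoord u : smooth_at (icoord (chart_at (ibase u))) u.
Proof.
apply/smooth_atP; exists id; first exact: sm_id.
exact: near_ind_all.
Qed.

Lemma smooth_at_base W (f : M -> W) u :
  sm (f \o chart_inv (chart_at (ibase u))) (chart_at (ibase u) (ibase u)) ->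
  smooth_at (fun u' => f (ibase u')) u.
Proof.
move=> Hf; apply/smooth_atP.
exists (fun z : E2 => (f \o chart_inv (chart_at (ibase u))) z.1).
  by apply: (sm_comp (g := f \o _)) => //; exact: sm_fst.
by apply: near_ind_all => u' d /=; rewrite chart_mapK.
Qed.

End IndNear.

(** A directional derivative sees only the restriction of [f] to a line; homogeneous functions are
    explicit along rays. *)
Lemma derive_line_cst {R : realType} {V W : normedModType R} (f : V -> W) a v :
  (\forall h \near (0 : R), f (h *: v + a) = f a) -> 'D_v f a = 0.
Proof.
move=> H; apply/lim_near_cst => //=.
apply: cvg_within; apply: filterS H => h /= ->.
by rewrite subrr scaler0.
Qed.

Lemma derive_line_linear {R : realType} {V W : normedModType R} (f : V -> W) a v w :
  (\forall h \near (0 : R), f (h *: v + a) = f a + h *: w) -> 'D_v f a = w.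
Proof.
move=> H; apply/lim_near_cst => //=.
rewrite near_withinE; apply: filterS H => h /= -> h0.
by rewrite addrC addKr scalerA mulVf// scale1r.
Qed.

Lemma derive_fst {R : realType} {U V W : normedModType R} {fV : findim V}
    {fW : findim W} (f : U -> V * W) x v :
  differentiable f x -> ('D_v f x).1 = 'D_v (fun y => (f y).1) x.
Proof.
move=> df; rewrite (derive_comp (g := fst) v df); last exact/sm_diff/sm_fst.
have lf : linear (fst : V * W -> V) by move=> a p q.
pose L : {linear (V * W)%type -> V} := HB.pack (fst : V * W -> V)
  (GRing.isLinear.Build _ _ _ _ _ lf).
have cL : continuous L by exact: findim_linear_cont.
by have [_ /= ->] := linear_cont_diff (f x) ('D_v f x) cL.
Qed.

(** * Finsler metrics and horizontal lifts *)

Section FinslerBasics.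
Context {R : realType} {n : nat} {M : manifold R n} (F : finsler M).
Local Notation E := 'rV[R]_n.
Local Notation E2 := ('rV[R]_n * 'rV[R]_n)%type.
Local Notation I := (indicatrix_bundle F).

Lemma finsler_eq (x1 x2 : M) (y1 y2 : E) : x1 = x2 -> y1 = y2 ->
  F x1 (y1 : Tan x1) = F x2 (y2 : Tan x2).
Proof. by move=> -> ->. Qed.

Lemma tm_read_tcoord c x (y : Tan x) : atlas c -> chart_dom c x ->
  tm_read F c (c x, tcoord c y) = F x y.
Proof.
by move=> Ac xc; apply: finsler_eq; [exact: chart_mapK|exact: tvec_tcoord].
Qed.

Lemma tm_read_at x (y : Tan x) :
  tm_read F (chart_at x) (chart_at x x, (y : E)) = F x y.
Proof.
by rewrite -(tm_read_tcoord y (atA x) (atD x)) tcoord_at.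
Qed.

Lemma tm_read_hom c a (b : E) l : atlas c -> chart_img c a -> 0 < l ->
  tm_read F c (a, l *: b) = l * tm_read F c (a, b).
Proof.
move=> Ac ac l0; rewrite /tm_read /=.
have := tvec_linear Ac ac l b 0; rewrite !addr0 => ->.
have -> : tvec c a 0 = 0 :> E.
  have := tvec_linear Ac ac 0 0 0; rewrite scale0r addr0 => {1}->.
  by rewrite scale0r add0r; have := tvec_linear Ac ac (-1) 0 0;
     rewrite scaler0 addr0 scaleN1r addNr.
by rewrite addr0 finsler_hom.
Qed.

Lemma finsler_sm c a (b : E) : atlas c -> chart_img c a -> b != 0 ->
  sm (tm_read F c) (a, b).
Proof.
move=> Ac ac b0; exists [set z : E2 | chart_img c z.1 /\ z.2 != 0]; split=> //.
  rewrite openE => -[a' b'] /= [a'c b'0].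
  have H1 : \forall z \near (a', b'), chart_img c z.1.
    have : {for (a', b'), continuous (@fst E E)} by exact: cvg_fst.
    by move=> /(_ _ (chart_img_near a'c)).
  have H2 : \forall z \near (a', b'), z.2 != 0.
    have c2 : {for (a', b'), continuous (@snd E E)} by exact: cvg_snd.
    exact: cvgr_neq0 c2 b'0.
  exact: filterI H1 H2.
exact: finsler_smooth.
Qed.

Lemma finsler_sm_fiber x (y : E) : y != 0 -> sm (fun b : E => F x (b : Tan x)) y.
Proof.
move=> y0; apply: (@sm_eq _ _ _ (fun b : E => tm_read F (chart_at x) (chart_at x x, b))).
  by move=> b; exact: tm_read_at.
apply: (sm_comp (f := fun b : E => (chart_at x x, b))).
  by apply: sm_pair; [exact: sm_cst|exact: sm_id].
by apply: finsler_sm => //; [exact: atA|exact/chart_img_map/atD].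
Qed.

Lemma finsler_at0 x : F x (0 : E) = 0.
Proof.
have := @finsler_hom _ _ _ F x (0 : E) 2 (ltr0Sn _ _); rewrite scaler0 => H.
by apply/eqP; move/eqP: H; rewrite -subr_eq0 => /eqP H; apply/eqP; lra.
Qed.

Lemma near0_pos1 : \forall h \near (0 : R), 0 < 1 + h.
Proof.
have : nbhs (0 : R) [set x | -1 < x].
  by apply: open_nbhs_nbhs; split; [exact: open_gt|rewrite /= ltrN10].
by apply: filterS => h /= h1; lra.
Qed.

(** If [F] vanished at [y], it would vanish on the whole open ray, and so would the first and second
    derivatives of its square along [y], against positive definiteness. *)
Lemma finsler_gt0 x (y : E) : y != 0 -> 0 < F x (y : Tan x).
Proof.
move=> y0; rewrite lt_neqAle finsler_ge0 andbT; apply/negP => /eqP Fy.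
have := finsler_posdef F (x := x) y0 y0; rewrite /fund_tensor.
suff -> : 'D_y ('D_y (fun z : E => F x z ^+ 2)) y = 0 by rewrite mulr0 ltxx.
have F0 (t : R) : 0 < t -> F x (t *: y : E) = 0.
  by move=> t0; rewrite finsler_hom// -Fy mulr0.
have D0 (t : R) : 0 < t -> 'D_y (fun z : E => F x z ^+ 2) (t *: y) = 0.
  move=> t0; apply: derive_line_cst.
  have : nbhs (0 : R) [set h | - t < h].
    by apply: open_nbhs_nbhs; split; [exact: open_gt|rewrite /= oppr_lt0].
  apply: filterS => h /= ht; rewrite -scalerDl !F0//.
  by rewrite -(opprK t) subr_gt0.
apply: derive_line_cst; apply: filterS near0_pos1 => h h0.
have := D0 1 ltr01; rewrite scale1r => ->.
rewrite (_ : h *: y + y = (1 + h) *: y); first exact: D0.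
by rewrite scalerDl scale1r addrC.
Qed.

Lemma tm_read_gt0 c a (b : E) : atlas c -> chart_img c a -> b != 0 ->
  0 < tm_read F c (a, b).
Proof.
move=> Ac ac b0; apply: finsler_gt0; apply/eqP => tb0.
move/eqP: b0; apply; rewrite -(tcoord_tvec b Ac ac).
rewrite /= in tb0; rewrite tb0.
have [xc _] := chart_invP ac.
have := tcoord_linear Ac xc (-1) 0 0; rewrite scaler0 addr0 scaleN1r addNr.
exact.
Qed.

(** Euler's identity for degree one: the radial direction is transverse to the indicatrix. *)
Lemma tm_read_euler c a (b : E) : atlas c -> chart_img c a ->
  'D_(0, b) (tm_read F c) (a, b) = tm_read F c (a, b).
Proof.
move=> Ac ac; apply: derive_line_linear; apply: filterS near0_pos1 => h h0.
have -> : h *: (0, b) + (a, b) = (a, (1 + h) *: b) :> E2.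
  apply: injective_projections => /=; first by rewrite scaler0 add0r.
  by rewrite scalerDl scale1r addrC.
by rewrite tm_read_hom// mulrDl mul1r.
Qed.

Lemma idir_neq0 (u : I) : (idir u : E) != 0.
Proof.
apply/eqP => u0; have := idir_unit u; rewrite u0 finsler_at0 => /eqP.
by rewrite eq_sym oner_eq0.
Qed.

Lemma ind_eq (u u' : I) : ibase u = ibase u' -> idir u = idir u' :> E -> u = u'.
Proof.
case: u u' => x y e [x' y' e'] /= xx'; move: y' e'; rewrite -xx' => y' e' /= yy'.
by move: e'; rewrite -yy' => e'; congr Ind; exact: Prop_irrelevance.
Qed.

Lemma icoord_at (u : I) :
  icoord (chart_at (ibase u)) u = (chart_at (ibase u) (ibase u), idir u : E).
Proof. by rewrite /icoord /tm_coord tcoord_at. Qed.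

Lemma tm_read_icoord c (u : I) : atlas c -> chart_dom c (ibase u) ->
  tm_read F c (icoord c u) = 1.
Proof. by move=> Ac uc; rewrite tm_read_tcoord// idir_unit. Qed.

Lemma tm_read_sm_ind (u : I) :
  sm (tm_read F (chart_at (ibase u))) (icoord (chart_at (ibase u)) u).
Proof.
rewrite icoord_at; apply: finsler_sm; [exact: atA|exact/chart_img_map/atD|].
exact: idir_neq0.
Qed.

Lemma tangentI_lift (u : I) (X : E) : exists v, tangentI u v /\ v.1 = X.
Proof.
pose c := chart_at (ibase u); pose z := icoord c u.
pose G := tm_read F c.
have dG : differentiable G z by exact/sm_diff/tm_read_sm_ind.
have G1 : 'D_(0, idir u : E) G z = 1.
  rewrite /z icoord_at tm_read_euler; [|exact: atA|exact/chart_img_map/atD].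
  by rewrite -icoord_at; apply: tm_read_icoord; [exact: atA|exact: atD].
(* The radial vector has derivative 1 on the indicatrix, so this multiple of it cancels the
   derivative along [(X, 0)]. *)
pose l := - 'D_(X, 0) G z.
exists (X, l *: (idir u : E)); split=> //.
rewrite /tangentI /= /tm_deriv -/c -/G -/z.
have -> : (X, l *: (idir u : E)) = l *: (0, idir u : E) + (X, 0) :> E2.
  by apply: injective_projections => /=; rewrite ?scaler0 ?add0r ?addr0.
have /derive_linear_dir -> := dG.
by rewrite G1 /l -[_ *: _]/(_ * 1) mulr1 addNr.
Qed.

Section Horizontal.
Variable H : nonlinear_connection F.

(** The default value of [xget] is never taken: some tangent vector projects to [X], and removing
    its vertical part leaves a horizontal one. *)
Lemma hliftP (u : I) (X : E) :
  H u (hlift H (u := u) X) /\ dpi u (hlift H (u := u) X) = X :> E.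
Proof.
have [v [tv vX]] := tangentI_lift u X.
have [h [k [Hh tk k0 vhk]]] := hor_sum H tv.
have : exists w, H u w /\ dpi u w = X.
  exists h; split=> //; move: vX; rewrite vhk /dpi /= /dpi /= in k0 *.
  by rewrite k0 addr0.
exact: (@xgetPex _ (0 : E2) [set w | H u w /\ dpi u w = X]).
Qed.

Lemma hlift_uniq (u : I) (v : E2) : H u v -> v = hlift H (u := u) (dpi u v).
Proof.
move=> Hv; have [Hl lX] := hliftP u (dpi u v).
apply/subr0_eq; apply: (@hor_cap _ _ _ _ H u).
  by rewrite addrC -scaleN1r; apply: hor_lin.
by rewrite /dpi /= in lX *; rewrite lX subrr.
Qed.

Lemma hlift_tangent (u : I) (X : E) : tangentI u (hlift H (u := u) X).
Proof. by apply: hor_tangent; exact: (hliftP u X).1. Qed.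

Lemma hlift_linear (u : I) : linear (fun X : E => hlift H (u := u) X).
Proof.
move=> a X Y; have [HX dX] := hliftP u X; have [HY dY] := hliftP u Y.
rewrite (hlift_uniq (hor_lin a HX HY)); congr (hlift H _).
by rewrite /dpi /= in dX dY *; rewrite dX dY.
Qed.

End Horizontal.

(** * Charts of the tangent bundle *)

Section TTcoord.
(** A change of charts of TM is the change of charts of M paired with its differential; the formula
    makes sense only over the overlap of the two domains. *)
Lemma tm_trans_near (c c' : chart R n M) (x : M) (y : E) : atlas c -> atlas c' -> chart_dom c x ->
  chart_dom c' x -> \forall z \near (c x, y),
    ((c' \o chart_inv c) z.1, 'D_(z.2) (c' \o chart_inv c) z.1)
    = tm_coord c' (tvec c z.1 z.2) :> E2.
Proof.
move=> Ac Ac' xc xc'.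
have H1 := chart_img_near (chart_img_map xc).
have H2 := chart_inv_near xc (chart_dom_near xc').
have c1 : {for (c x, y), continuous (@fst E E)} by exact: cvg_fst.
have H12 : \forall z \near (c x, y), chart_img c z.1 /\ chart_dom c' (chart_inv c z.1).
  exact: (c1 _ (filterI H1 H2)).
apply: filterS H12 => -[a b] [/= ac ac'].
rewrite /tm_coord; congr (_, _).
have [xac ca] := chart_invP ac.
by rewrite (tcoord_change _ Ac Ac' xac ac') (tcoord_tvec b Ac ac) ca.
Qed.

Lemma tm_trans_sm (c c' : chart R n M) (x : M) (y : E) : atlas c -> atlas c' -> chart_dom c x ->
  chart_dom c' x -> sm (fun z : E2 => tm_coord c' (tvec c z.1 z.2)) (c x, y).
Proof.
move=> Ac Ac' xc xc'; apply: sm_ext (tm_trans_near y Ac Ac' xc xc') _.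
apply: sm_pair.
  by apply: (sm_comp (f := fst) (g := c' \o chart_inv c)); [exact: sm_fst|exact: trans_sm].
apply: (sm_derive_var (f := c' \o chart_inv c) (p := fst) (w := snd)).
- exact: trans_sm.
- exact: sm_fst.
- exact: sm_snd.
Qed.

Lemma ttcoord_linear c (u : I) : atlas c -> chart_dom c (ibase u) ->
  linear (ttcoord c u).
Proof.
move=> Ac uc; apply/derive_linear_dir/sm_diff/tm_trans_sm => //.
  exact: atA.
exact: atD.
Qed.

Lemma ttcoord_fst c (u : I) v : atlas c -> chart_dom c (ibase u) ->
  (ttcoord c u v).1 = tcoord c (dpi u v).
Proof.
move=> Ac uc; rewrite /ttcoord derive_fst; last first.
  by apply/sm_diff/tm_trans_sm => //; [exact: atA|exact: atD].
rewrite /= /icoord /tm_coord (derive_comp (f := fst) (g := c \o chart_inv (chart_at (ibase u)))).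
- rewrite /tcoord /dpi; congr ('D_ _ _ _) => //.
  rewrite -(derive_fst (f := id)) ?derive_id//.
- exact/sm_diff/sm_fst.
- by apply/sm_diff/trans_sm => //; [exact: atA|exact: atD].
Qed.

End TTcoord.

Lemma smooth_vfieldP (Y : forall x : M, Tan x) : smooth_vfield Y <->
  forall c, atlas c -> forall x, chart_dom c x ->
    sm (fun a => tcoord c (Y (chart_inv c a))) (c x).
Proof.
split=> [H c Ac x xc|H c Ac].
  by exists (chart_img c); split; [exact: chart_img_open|exact: chart_img_map|exact: H].
by apply/smooth_sm; [exact: chart_img_open|move=> _ [x xc <-]; exact: H].
Qed.

Lemma smooth_vfield_ind (Y : forall x : M, Tan x) (u : I) : smooth_vfield Y ->
  smooth_at (fun u' : I => tcoord (chart_at (ibase u)) (Y (ibase u'))) u.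
Proof.
move=> /smooth_vfieldP HY.
apply: (smooth_at_base (f := fun x => tcoord (chart_at (ibase u)) (Y x))).
by apply: HY; [exact: atA|exact: atD].
Qed.

Lemma pullback_smooth (Y : forall x : M, Tan x) : smooth_vfield Y ->
  smooth_section (pullback_section Y : psection F).
Proof. by move=> HY u; exact: smooth_vfield_ind. Qed.

(* If [e] spans the distribution, the components of the projections of the [e i]
   form an invertible matrix, which gives the lift in terms of the [e i]. *)
Lemma hlift_smooth (H : nonlinear_connection F) (Y : forall x : M, Tan x) :
  smooth_vfield Y ->
  smooth_ivfield (fun u : I => hlift H (u := u) (Y (ibase u))).
Proof.
move=> HY u0; split; first exact: hlift_tangent.
pose c := chart_at (ibase u0).
have [e [se [A [oA Au0 HA]]]] := hor_smooth H u0.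
have nA : near_ind u0 (fun u => A (icoord c u)).
  by apply: near_ind_coord; exact: open_nbhs_nbhs.
pose m i j u : R := (ttcoord c u (e i u)).1 0 j.
have sm_m i j : smooth_at (m i j) u0.
  apply: (@smooth_at_entry _ _ _ _ (fun u => (ttcoord c u (e i u)).1)).
  by apply: (smooth_at_comp (g := fst) (se i)); exact: sm_fst.
pose N (u : I) := chart_dom c (ibase u) /\ A (icoord c u).
have nN : near_ind u0 N := near_indI (near_ind_dom u0) nA.
have mE u (a : 'I_n -> R) : N u ->
    tcoord c (dpi u (\sum_i a i *: e i u)) = (\row_i a i) *m (\matrix_(i, j) m i j u).
  move=> [uc _]; have Ac := atA (ibase u0).
  rewrite -(ttcoord_fst _ Ac uc).
  pose L : {linear E2 -> E2} := HB.pack (ttcoord c u)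
    (GRing.isLinear.Build _ _ _ _ _ (ttcoord_linear Ac uc)).
  rewrite -[ttcoord c u _]/(L _) linear_sum.
  have fst_sum (G : 'I_n -> E2) : (\sum_i G i).1 = \sum_i (G i).1.
    by apply: (big_morph (fun z : E2 => z.1)).
  rewrite fst_sum; apply/rowP => j; rewrite summxE mxE; apply: eq_bigr => i _.
  by rewrite linearZ /= !mxE.
have mU u : N u -> \matrix_(i, j) m i j u \in unitmx.
  move=> Nu; have [uc Au] := Nu; have Ac := atA (ibase u0).
  (* The horizontal lift of the [k]-th coordinate vector is a combination of the [e i]; projecting
     it exhibits row [k] of the identity as a combination of the rows. *)
  rewrite -row_full_unit -sub1mx; apply/row_subP => k.
  have [X Xk] := tcoord_surj (row k 1%:M) Ac uc.
  have [HX dX] := hliftP H u X.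
  move: (HX); rewrite HA// => -[a aE].
  rewrite -Xk -[X in tcoord c X]dX aE mE//.
  exact: submxMl.
have mU0 := mU u0 (near_ind_self nN).
have [si _] := smooth_at_invmx sm_m mU0.
pose w u j : R := \sum_k tcoord c (Y (ibase u)) 0 k * invmx (\matrix_(i, j) m i j u) k j.
have sw j : smooth_at (fun u => w u j) u0.
  apply: smooth_at_sum => k _; apply: smooth_atM; last exact: si.
  exact: smooth_at_entry (smooth_vfield_ind u0 HY).
have hE u : N u -> hlift H (u := u) (Y (ibase u)) = \sum_i w u i *: e i u.
  move=> Nu; have [uc Au] := Nu; have Ac := atA (ibase u0).
  have Hw : H u (\sum_i w u i *: e i u) by rewrite HA//; exists (w u).
  rewrite (hlift_uniq Hw); congr (hlift H _).
  apply: (tcoord_inj Ac uc); rewrite mE//.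
  have -> : \row_i w u i = tcoord c (Y (ibase u)) *m invmx (\matrix_(i, j) m i j u).
    by apply/rowP => j; rewrite !mxE.
  by rewrite mulmxKV ?mU.
apply: (@smooth_at_ext _ _ _ _ _ (fun u => \sum_i w u i *: ttcoord c u (e i u))).
  apply: near_indS nN => u Nu; rewrite hE//.
  have [uc Au] := Nu; have Ac := atA (ibase u0).
  pose L : {linear E2 -> E2} := HB.pack (ttcoord c u)
    (GRing.isLinear.Build _ _ _ _ _ (ttcoord_linear Ac uc)).
  rewrite -[RHS]/(L _) linear_sum; apply: eq_bigr => i _.
  by rewrite linearZ.
by apply: smooth_at_sum => i _; apply: smooth_atZ => //; exact: se.
Qed.

End FinslerBasics.

(** * Cutoff functions and global frames *)

Section Cutoff.
Context {R : realType} {n : nat} {M : manifold R n}.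
Local Notation E := 'rV[R]_n.

Definition smoothM (f : M -> R) : Prop :=
  forall c, atlas c -> forall x, chart_dom c x -> sm (f \o chart_inv c) (c x).

(** The alternative is what makes products globally smooth: a function that is smooth only on [U]
    can be multiplied by [rho] and extended by zero. *)
Lemma cutoff (x0 : M) (U : set E) : open U -> U (chart_at x0 x0) ->
  U `<=` chart_img (chart_at x0) ->
  exists rho : M -> R, 0 < rho x0 /\ forall x,
    [/\ chart_dom (chart_at x0) x, U (chart_at x0 x) &
      sm (rho \o chart_inv (chart_at x0)) (chart_at x0 x)] \/
    (\near x, rho x = 0).
Proof.
set c := chart_at x0 => oU Ux0 Uc.
have xc0 : chart_dom c x0 := atD x0.
have := open_nbhs_nbhs (conj oU Ux0).
move=> /nbhs_ballP[r0 /= r00 ball_U].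
(* Half the radius, so that the closed box [K] still lies in the open ball inside [U]. *)
pose r := r0 / 2; have r_gt0 : 0 < r by rewrite divr_gt0.
pose q (a : E) : R := r ^+ 2 - \sum_j (a 0 j - c x0 0 j) ^+ 2.
have sq a : sm q a.
  apply: smB; first exact: sm_cst.
  apply: sm_sum => j _.
  have H1 : sm (fun a : E => a 0 j - c x0 0 j) a.
    by apply: smB; [apply: sm_entry; exact: sm_id|exact: sm_cst].
  by apply: sm_eq (smM H1 H1) => a'; rewrite expr2.
pose K : set E := [set a | forall j, `|c x0 0 j - a 0 j| <= r].
have KU : K `<=` U.
  move=> a Ka; apply: ball_U; split=> // i j; rewrite ord1.
  rewrite -ball_normE /=; apply: le_lt_trans (Ka j) _.
  by rewrite /r ltr_pdivrMr// ltr_pMr// ltr1n.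
have cK : compact K.
  have := @rV_compact R n (fun j => `[c x0 0 j - r, c x0 0 j + r]%classic)
    (fun=> @segment_compact R _ _).
  congr (compact _); apply/seteqP; split=> s /= H j; have := H j;
    by rewrite in_itv /= ler_distlC.
have qK a : 0 < q a -> K a.
  move=> qa j; rewrite distrC -(ler_pXn2r (_ : (0 < 2)%N)) ?nnegrE// ?(ltW r_gt0)//.
  rewrite real_normK ?num_real//.
  apply: le_trans (_ : \sum_j (a 0 j - c x0 0 j) ^+ 2 <= _).
    rewrite (bigD1 j)//= lerDl; apply: sumr_ge0 => k _; exact: sqr_ge0.
  by rewrite ltW// -subr_gt0.
pose rho x := if `[< chart_dom c x >] then flat 0 (q (c x)) else 0.
exists rho; split.
  rewrite /rho ifT; last exact/asboolP.
  rewrite flat_gt0 /q big1 ?subr0 ?exprn_gt0// => j _.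
  by rewrite subrr expr0n.
move=> x; case: (pselect (chart_dom c x /\ K (c x))) => [[xc Kx]|nK].
  left; split=> //; first exact: KU.
  apply: (@sm_ext _ _ _ (fun a => flat 0 (q a))).
    apply: filterS (chart_img_near (chart_img_map xc)) => a /chart_invP[d ca].
    by rewrite /rho /= ifT ?ca//; exact/asboolP.
  by apply: (sm_comp (g := flat 0)); [exact: sq|exact: flat_sm].
right.
(* The image of the box is compact, hence closed as M is Hausdorff. Its complement is a
   neighbourhood of [x] on which [rho] vanishes. *)
pose K' := chart_inv c @` K.
have clK' : closed K'.
  apply: compact_closed; first exact: manifold_hausdorff.
  apply: continuous_compact cK.
  apply: continuous_in_subspaceT => a /[!inE] /KU /Uc [y yc <-].
  exact: chart_inv_cont.
have nK'x : (~` K') x.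
  move=> [a Ka ax]; apply: nK.
  have ac : chart_img c a by exact/Uc/KU.
  by have [xc ca] := chart_invP ac; rewrite -ax ca.
have := open_nbhs_nbhs (conj (closed_openC clK') nK'x).
apply: filterS => y nK'y; rewrite /rho; case: asboolP => // yc.
apply/eqP/negPn/negP => f0.
have : 0 < flat 0 (q (c y)) by rewrite lt_neqAle eq_sym f0 flat_ge0.
rewrite flat_gt0 => /qK Ky; apply: nK'y; exists (c y) => //.
exact: chart_mapK.
Qed.

Lemma cutoff_smoothM (x0 : M) (rho : M -> R) (f : E -> R) :
  (forall x, (chart_dom (chart_at x0) x /\
      sm (rho \o chart_inv (chart_at x0)) (chart_at x0 x) /\ sm f (chart_at x0 x)) \/
    (\near x, rho x = 0)) ->
  smoothM (fun x => rho x * f (chart_at x0 x)).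
Proof.
set c := chart_at x0 => H c' Ac' x xc'; have Ac := atA x0.
case: (H x) => [[xc [sr sf]]|r0]; last first.
  apply: sm_ext (sm_cst 0 _).
  by apply: filterS (chart_inv_near xc' r0) => a /= ->; rewrite mul0r.
have st := trans_sm Ac' Ac xc' xc.
apply: (@sm_ext _ _ _ (fun a => (rho \o chart_inv c) ((c \o chart_inv c') a)
   * f ((c \o chart_inv c') a))).
  apply: filterS (trans_near_comp rho xc' xc) => a /= E1.
  by rewrite E1.
apply: smM.
  by apply: (sm_comp (g := rho \o chart_inv c) st); rewrite trans_map.
by apply: (sm_comp (g := f) st); rewrite trans_map.
Qed.

Lemma smooth_vfieldZ (f : M -> R) (Y : forall x : M, Tan x) : smoothM f ->
  smooth_vfield Y -> smooth_vfield (fun x => f x *: (Y x : E) : Tan x).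
Proof.
move=> sf /smooth_vfieldP sY; apply/smooth_vfieldP => c Ac x xc.
apply: (@sm_ext _ _ _ (fun a => (f \o chart_inv c) a *: tcoord c (Y (chart_inv c a)))).
  apply: filterS (chart_img_near (chart_img_map xc)) => a /chart_invP[d _].
  have := tcoord_linear Ac d (f (chart_inv c a)) (Y (chart_inv c a)) 0.
  rewrite !addr0 => ->; rewrite [X in _ + X](_ : _ = 0) ?addr0//.
  have := tcoord_linear Ac d (-1) 0 0; rewrite scaler0 addr0 scaleN1r addNr.
  exact.
by apply: smZ; [exact: sf|exact: sY].
Qed.

Lemma tcoord0 c (x : M) : atlas c -> chart_dom c x -> tcoord c (0 : Tan x) = 0.
Proof.
move=> Ac xc; have := tcoord_linear Ac xc (-1) 0 0.
by rewrite scaler0 addr0 scaleN1r addNr.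
Qed.

Lemma tcoordZ c (x : M) (k : R) (X : Tan x) : atlas c -> chart_dom c x ->
  tcoord c (k *: (X : E) : Tan x) = k *: tcoord c X.
Proof.
move=> Ac xc; have := tcoord_linear Ac xc k X 0.
by rewrite !addr0 tcoord0// addr0.
Qed.

Lemma tcoord_frame c (x : M) (b : E) : atlas c -> chart_dom c x ->
  tcoord c (tvec c (c x) b : Tan x) = b.
Proof.
move=> Ac xc; have := tcoord_tvec b Ac (chart_img_map xc).
by rewrite /tvec (chart_mapK xc).
Qed.

(** Covariant derivatives act on global sections, so the coordinate fields are multiplied by a
    cutoff. Their matrix in the chart is [rho x] times the identity, invertible where [rho] does not
    vanish. *)
Lemma global_frame (x0 : M) : exists e : 'I_n -> forall x : M, Tan x,
  (forall j, smooth_vfield (e j)) /\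
  \forall x \near x0, chart_dom (chart_at x0) x /\
    \matrix_(i, j) tcoord (chart_at x0) (e i x) 0 j \in unitmx.
Proof.
set c := chart_at x0; have Ac := atA x0; have xc0 := atD x0.
have oc : open (chart_img c) by exact: chart_img_open.
have [rho [r0 Hr]] := cutoff oc (chart_img_map xc0) (fun _ => id).
exists (fun j x => rho x *: (tvec c (c x) (delta_mx 0 j) : E)); split.
  move=> j; apply/smooth_vfieldP => c' Ac' x xc'.
  case: (Hr x) => [[xc _ sr]|rx]; last first.
    apply: sm_ext (sm_cst 0 _).
    have H1 := chart_inv_near xc' rx; have H2 := chart_inv_near xc' (chart_dom_near xc').
    by apply: filterS2 H1 H2 => a -> d; rewrite scale0r tcoord0.
  have st := trans_sm Ac' Ac xc' xc.
  apply: (@sm_ext _ _ _ (fun a => (rho \o chart_inv c) ((c \o chart_inv c') a)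
   *: 'D_(delta_mx 0 j) (c' \o chart_inv c) ((c \o chart_inv c') a))).
    have H1 := chart_inv_near xc' (chart_dom_near xc).
    have H2 := chart_inv_near xc' (chart_dom_near xc').
    apply: filterS2 H1 H2 => a d d' /=.
    rewrite (tcoordZ _ _ Ac' d') (chart_mapK d); congr (_ *: _).
    by rewrite (tcoord_change _ Ac Ac' d d') tcoord_frame.
  apply: smZ.
    by apply: (sm_comp (g := rho \o chart_inv c) st); rewrite trans_map.
  apply: (sm_comp (g := 'D_(delta_mx 0 j) (c' \o chart_inv c)) st).
  by rewrite trans_map//; apply: sm_derive; exact: trans_sm.
have : \forall x \near x0, rho x != 0.
  case: (Hr x0) => [[_ _ /sm_cont sr]|/nbhs_singleton r00]; last first.
    by rewrite r00 ltxx in r0.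
  have r1 : \forall a \near c x0, (rho \o chart_inv c) a != 0.
    by apply: cvgr_neq0 sr _; rewrite /= chart_mapK// gt_eqF.
  have := chart_map_near xc0 r1; have := chart_dom_near xc0.
  by apply: filterS2 => x d /=; rewrite chart_mapK.
have := chart_dom_near xc0; apply: filterS2 => x d rx; split=> //.
rewrite (_ : \matrix_(i, j) _ = (rho x)%:M); last first.
  apply/matrixP => i j; rewrite !mxE (tcoordZ _ _ Ac d) tcoord_frame//.
  by rewrite !mxE eqxx /= eq_sym; case: eqP; rewrite ?mulr1n ?mulr0n ?mulr1 ?mulr0.
by rewrite unitmxE det_scalar unitfE expf_neq0.
Qed.

End Cutoff.

(** * Parametrization of the indicatrices *)

(* The determinant does not vanish on the segment from the identity to [G]. *)
Lemma posdef_det_gt0 (R : realType) m (G : 'M[R]_m) :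
  (forall u : 'rV[R]_m, u != 0 -> 0 < (u *m G *m u^T) 0 0) -> 0 < \det G.
Proof.
move=> HG.
have id_pos (u : 'rV[R]_m) : u != 0 -> 0 < (u *m u^T) 0 0.
  move=> u0; have uE : (u *m u^T) 0 0 = \sum_j u 0 j ^+ 2.
    by rewrite mxE; apply: eq_bigr => j _; rewrite mxE expr2.
  rewrite uE lt_neqAle sumr_ge0 ?andbT => [|j _]; last exact: sqr_ge0.
  apply: contraNN u0 => /eqP/esym/eqP; rewrite psumr_eq0 => [/allP H|j _]; last exact: sqr_ge0.
  apply/eqP/rowP => j; rewrite mxE; have := H j (mem_index_enum j).
  by rewrite /= sqrf_eq0 => /eqP.
pose p (t : R) := \det ((1 - t) *: 1%:M + t *: G).
have cp : continuous p.
  move=> t; apply: sm_cont; apply: sm_det => i j.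
  apply: (@sm_eq _ _ _ (fun t : R => (1 - t) * (1%:M : 'M[R]_m) i j + t * G i j)).
    by move=> y; rewrite !mxE.
  apply: smD; apply: smM; try exact: sm_cst; last exact: sm_id.
  by apply: smB; [exact: sm_cst|exact: sm_id].
have pn0 t : 0 <= t <= 1 -> p t != 0.
  move=> /andP[t0 t1]; apply/negP => /det0P[u u0 uA].
  have : ((u *m ((1 - t) *: 1%:M + t *: G)) *m u^T) 0 0 = 0.
    by rewrite uA mul0mx mxE.
  rewrite mulmxDr mulmxDl -!scalemxAr -!scalemxAl mulmx1 !mxE.
  have := id_pos u u0; have := HG u u0; rewrite !mxE.
  set A := \sum_j _; set B := \sum_j _ => A0 B0.
  have [->|tn0] := eqVneq t 0; first by rewrite subr0 mul1r mul0r addr0; lra.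
  have : 0 < t * A by rewrite mulr_gt0// lt_neqAle eq_sym tn0.
  have : 0 <= (1 - t) * B by apply: mulr_ge0; [rewrite subr_ge0|exact: ltW].
  by lra.
have p0 : p 0 = 1 by rewrite /p subr0 scale1r scale0r addr0 det1.
have p1 : p 1 = \det G by rewrite /p subrr scale0r add0r scale1r.
rewrite ltNge -p1; apply/negP => p1le.
have [|t] := @IVT R p 0 1 0 ler01 (continuous_subspaceT cp).
  rewrite p0 ge_min p1le orbT /= le_max ler01 //.
by rewrite in_itv /= => /pn0/negP + pt; apply; rewrite pt.
Qed.

Lemma derive_slice {R : realType} {U V W : normedModType R} {fU : findim U}
    {fV : findim V} (f : U * V -> W) a y w : differentiable f (a, y) ->
  'D_w (fun y : V => f (a, y)) y = 'D_((0, w) : U * V) f (a, y).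
Proof.
move=> df; have dp : differentiable (fun y : V => (a, y)) y.
  by apply: sm_diff; apply: sm_pair; [exact: sm_cst|exact: sm_id].
rewrite (derive_comp w dp df); congr ('D_ _ _ _).
have H0 : nbhs (0 : R) setT by exact: filterT.
apply: derive_line_linear; apply: filterS H0 => h _.
apply: injective_projections => /=; first by rewrite scaler0 addr0.
by rewrite addrC.
Qed.

(** * Hessians in the fibre directions *)

Section SecondDerivative.
Context {R : realType} {U : normedModType R} {m : nat}.
Local Notation E := 'rV[R]_m.
Local Notation UE := (U * 'rV[R]_m)%type.

Lemma zero_pair_sum (v : E) :
  ((0, v) : UE) = \sum_i v 0 i *: ((0, delta_mx 0 i) : UE).
Proof.
rewrite {1}[v]row_sum_delta.
have fst_sum (H : 'I_m -> UE) : (\sum_i H i).1 = \sum_i (H i).1.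
  by apply: (big_morph (fun z : UE => z.1)).
have snd_sum (H : 'I_m -> UE) : (\sum_i H i).2 = \sum_i (H i).2.
  by apply: (big_morph (fun z : UE => z.2)).
apply: injective_projections; last by rewrite [RHS]snd_sum.
by rewrite [RHS]fst_sum [RHS]big1// => i _; rewrite /= scaler0.
Qed.

Lemma derive_zero_pair (W : normedModType R) (f : UE -> W) z v :
  differentiable f z ->
  'D_((0, v) : UE) f z = \sum_i v 0 i *: 'D_((0, delta_mx 0 i) : UE) f z.
Proof.
move=> df; rewrite zero_pair_sum deriveE// linear_sum; apply: eq_bigr => i _.
by rewrite linearZ /= deriveE.
Qed.

Lemma derive2_zero_pair (f : UE -> R) z (v w : E) : sm f z ->
  'D_((0, v) : UE) ('D_((0, w) : UE) f) z =
  (v *m (\matrix_(i, j) 'D_((0, delta_mx 0 i) : UE) ('D_((0, delta_mx 0 j) : UE) f) z)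
     *m w^T) 0 0.
Proof.
move=> sf; pose g j := 'D_((0, delta_mx 0 j) : UE) f.
have sg j : sm (g j) z by exact: sm_derive.
have D2 : 'D_((0, v) : UE) ('D_((0, w) : UE) f) z =
    'D_((0, v) : UE) (\sum_(j < m) (fun z => w 0 j *: g j z)) z.
  apply: near_eq_derive; apply: filterS (sm_near sf) => z' /sm_diff dz.
  by rewrite fct_sumE; exact: derive_zero_pair.
rewrite {}D2 derive_sum; last first.
  by move=> j; apply/diff_derivable/sm_diff; apply: smZ; [exact: sm_cst|exact: sg].
rewrite mxE; apply: eq_bigr => j _.
have dd : derivable (g j) z ((0, v) : UE) by exact/diff_derivable/sm_diff.
rewrite (deriveZ (w 0 j) dd) (derive_zero_pair v (sm_diff (sg j))).
rewrite -[_ *: _]/(_ * _) mulrC !mxE; congr (_ * _); apply: eq_bigr => i _.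
by rewrite mxE.
Qed.

End SecondDerivative.

(** * The faces of a cube and the cones over them *)

Section Faces.
Context {R : realType} {m : nat}.
Local Notation E := 'rV[R]_m.+1.
Local Notation P := 'rV[R]_m.

Definition sg (b : bool) : R := (-1) ^+ b.
Lemma sg_sq b : sg b * sg b = 1. Proof. by rewrite /sg; case: b; rewrite ?mulrNN mulr1. Qed.
Lemma sgF : sg false = 1. Proof. by rewrite /sg expr0. Qed.
Lemma sgT : sg true = -1. Proof. by rewrite /sg expr1. Qed.
Lemma sg_neq0 b : sg b != 0. Proof. by rewrite /sg signr_eq0. Qed.
Lemma sg_norm b : `|sg b| = 1. Proof. by rewrite /sg normr_sign. Qed.

Variables (i : 'I_m.+1) (b : bool).

(* [theta] parametrizes the face of the cube where coordinate [i] is [sg b]. *)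
Definition theta (s : P) : E :=
  \row_j (if unlift i j is Some k then s 0 k else sg b).

Lemma theta_i s : theta s 0 i = sg b.
Proof. by rewrite mxE unlift_none. Qed.

Lemma theta_lift s k : theta s 0 (lift i k) = s 0 k.
Proof. by rewrite mxE liftK. Qed.

Lemma theta_neq0 s : theta s != 0.
Proof.
apply/eqP => /rowP/(_ i); rewrite theta_i mxE => /eqP.
by rewrite (negbTE (sg_neq0 b)).
Qed.

Lemma theta_sm s : sm theta s.
Proof.
apply: sm_row => j; case: (unlift i j) => [k|]; last exact: sm_cst.
by apply: sm_entry; exact: sm_id.
Qed.

(** Central projection onto the face, in the parameters of [theta]; the quotient makes it
    insensitive to nonzero scaling. *)
Definition kap (y : E) : P := \row_k (y 0 (lift i k) / (sg b * y 0 i)).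

Lemma kap_theta l s : l != 0 -> kap (l *: theta s) = s.
Proof.
move=> l0; apply/rowP => k; rewrite !mxE liftK unlift_none.
by rewrite mulrCA sg_sq mulr1 mulrAC mulfV// mul1r.
Qed.

Lemma theta_kap (y : E) : y 0 i != 0 -> theta (kap y) = (sg b * y 0 i)^-1 *: y.
Proof.
move=> yi; apply/rowP => j; rewrite !mxE.
case: (unliftP i j) => [k ->|->]; first by rewrite mxE mulrC.
rewrite invfM -mulrA mulVf// mulr1; apply: (mulfI (sg_neq0 b)).
by rewrite sg_sq mulfV ?sg_neq0.
Qed.

Lemma kap_sm (y : E) : y 0 i != 0 -> sm kap y.
Proof.
move=> yi; apply: sm_row => k; apply: smM.
  by apply: sm_entry; exact: sm_id.
apply: sm_inv; last by rewrite mulf_neq0// sg_neq0.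
by apply: smM; [exact: sm_cst|apply: sm_entry; exact: sm_id].
Qed.

(* The cone over that face. A vector with several entries of maximal modulus
   belongs to the cone of the first of them, so that the cones form a partition
   of the nonzero vectors. *)
Definition cone : set E := [set y : E | 0 < sg b * y 0 i /\
  forall j : 'I_m.+1, if (j < i)%N then `|y 0 j| < `|y 0 i| else `|y 0 j| <= `|y 0 i| ].

(** The strict inequalities repeat the tie-breaking rule of [cone]. The set is in general neither
    open nor closed, so compactness is borrowed from the closed cube. *)
Definition face : set P := [set s : P | forall k : 'I_m,
  if (lift i k < i)%N then `|s 0 k| < 1 else `|s 0 k| <= 1].

Lemma cone_scale l (y : E) : 0 < l -> cone (l *: y) <-> cone y.
Proof.
move=> l0; rewrite /cone /= !mxE mulrCA pmulr_rgt0//.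
split=> -[y0 H]; split=> // j; have := H j; rewrite !mxE !normrM gtr0_norm//.
  by case: ifP => _; rewrite ?ltr_pM2l ?ler_pM2l.
by case: ifP => _; rewrite ?ltr_pM2l ?ler_pM2l.
Qed.

Lemma cone_theta s : cone (theta s) <-> face s.
Proof.
rewrite /cone /face /= theta_i sg_sq sg_norm; split=> [[_ H] k|H].
  by have := H (lift i k); rewrite theta_lift.
split=> // j; case: (unliftP i j) => [k ->|->]; first by rewrite theta_lift; exact: H.
by rewrite ltnn theta_i sg_norm.
Qed.

Lemma face_cube : face `<=` @cube R m.
Proof. by move=> s H k; have := H k; case: ifP => // _ /ltW. Qed.

Lemma ocube_face : @ocube R m `<=` face.
Proof. by move=> s H k; have := H k; case: ifP => // _ /ltW. Qed.

Lemma borel_lt0 k (f : 'rV[R]_k -> R) : continuous f ->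
  measurable ([set s | 0 < f s] : set (borel_rV R k)).
Proof.
move=> cf; apply: (@borel_open R k).
by apply: (@open_comp _ _ f [set x | 0 < x]); [move=> s _; exact: cf|exact: open_gt].
Qed.

Lemma borel_le0 k (f : 'rV[R]_k -> R) : continuous f ->
  measurable ([set s | 0 <= f s] : set (borel_rV R k)).
Proof.
move=> cf; apply: (@borel_closed R k).
by apply: (@closed_comp _ _ f [set x | 0 <= x]); [move=> s _; exact: cf|exact: closed_ge].
Qed.

Lemma coord_norm_cont k (j : 'I_k) : continuous (fun s : 'rV[R]_k => `|s 0 j|).
Proof.
move=> s; apply: continuous_comp; first exact: coord_continuous.
exact: norm_continuous.
Qed.

Lemma face_borel : measurable (face : set (borel_rV R m)).
Proof.
have -> : face = \bigcap_(k in [set: 'I_m])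
    [set s : P | if (lift i k < i)%N then `|s 0 k| < 1 else `|s 0 k| <= 1].
  by apply/seteqP; split=> s H k; [move=> _; exact: H|exact: H].
apply: fin_bigcap_measurable => [|k _]; first exact: finite_finset.
case: (lift i k < i)%N => /=.
  rewrite (_ : [set s : P | _] = [set s : P | 0 < 1 - `|s 0 k| ]); last first.
    by apply/seteqP; split=> s /=; rewrite subr_gt0.
  apply: (@borel_lt0 _ (fun s => 1 - `|s 0 k|)) => s.
  exact: (cvgB (cvg_cst (1 : R)) (@coord_norm_cont m k s)).
rewrite (_ : [set s : P | _] = [set s : P | 0 <= 1 - `|s 0 k| ]); last first.
  by apply/seteqP; split=> s /=; rewrite subr_ge0.
apply: (@borel_le0 _ (fun s => 1 - `|s 0 k|)) => s.
exact: (cvgB (cvg_cst (1 : R)) (@coord_norm_cont m k s)).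
Qed.

Lemma cone_borel : measurable (cone : set (borel_rV R m.+1)).
Proof.
have -> : cone = [set y : E | 0 < sg b * y 0 i] `&` \bigcap_(j in [set: 'I_m.+1])
    [set y : E | if (j < i)%N then `|y 0 j| < `|y 0 i| else `|y 0 j| <= `|y 0 i| ].
  by apply/seteqP; split=> y [y0 H]; split=> // j; [move=> _; exact: H|exact: H].
apply: measurableI.
  apply: (@borel_lt0 _ (fun y => sg b * y 0 i)) => y.
  exact: (cvgM (cvg_cst (sg b)) (@coord_continuous R 1 m.+1 0 i y)).
apply: fin_bigcap_measurable => [|j _]; first exact: finite_finset.
case: (j < i)%N => /=.
  rewrite (_ : [set y : E | _] = [set y : E | 0 < `|y 0 i| - `|y 0 j| ]); last first.
    by apply/seteqP; split=> s /=; rewrite subr_gt0.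
  apply: (@borel_lt0 _ (fun y => `|y 0 i| - `|y 0 j|)) => s.
  exact: (cvgB (@coord_norm_cont _ i s) (@coord_norm_cont _ j s)).
rewrite (_ : [set y : E | _] = [set y : E | 0 <= `|y 0 i| - `|y 0 j| ]); last first.
  by apply/seteqP; split=> s /=; rewrite subr_ge0.
apply: (@borel_le0 _ (fun y => `|y 0 i| - `|y 0 j|)) => s.
exact: (cvgB (@coord_norm_cont _ i s) (@coord_norm_cont _ j s)).
Qed.

End Faces.

Section ConePartition.
Context {R : realType} {m : nat}.
Local Notation E := 'rV[R]_m.+1.

Lemma cone_cover (y : E) : y != 0 -> exists ib : 'I_m.+1 * bool, cone ib.1 ib.2 y.
Proof.
move=> y0.
(* The least such [k] is the first index of maximal modulus, as the strict inequalities of [cone]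
   demand. *)
pose Q (k : nat) := [exists i : 'I_m.+1, (k == i :> nat) && [forall j, `|y 0 j| <= `|y 0 i| ] ].
have exQ : exists k, Q k.
  have [i _ Hi] := arg_maxP (fun i : 'I_m.+1 => `|y 0 i|) (erefl (xpredT ord0)).
  by exists (val i); apply/existsP; exists i; rewrite eqxx; apply/forallP => j; exact: Hi.
case: (ex_minnP exQ) => k /existsP[i /andP[/eqP ki /forallP Hi]] mink.
have yi0 : y 0 i != 0.
  apply: contraNneq y0 => yi; apply/eqP/rowP => j; rewrite mxE; apply/eqP.
  by rewrite -normr_le0; have := Hi j; rewrite yi normr0.
exists (i, y 0 i < 0); split.
  rewrite [X in sg X]/= [X in y _ X]/=.
  case: (ltgtP (y 0 i) 0) yi0 => // yi _; last by rewrite sgF mul1r.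
  by rewrite sgT mulN1r oppr_gt0.
move=> j /=; case: ifP => [ji|_]; last exact: Hi.
rewrite ltNge; apply/negP => yij.
suff : (k <= j)%N by rewrite ki leqNgt ji.
apply: mink; apply/existsP; exists j; rewrite eqxx; apply/forallP => l.
exact: le_trans (Hi l) yij.
Qed.

Lemma cone_uniq (y : E) (ib ib' : 'I_m.+1 * bool) :
  cone ib.1 ib.2 y -> cone ib'.1 ib'.2 y -> ib = ib'.
Proof.
case: ib ib' => i b [i' b'] /= [y1 H1] [y2 H2].
have ii' : i = i'.
  apply/val_inj/eqP; rewrite eqn_leq; apply/andP; split; rewrite leqNgt; apply/negP => lt.
    have := H1 i'; have := H2 i; rewrite lt ltnNge (ltnW lt) /=.
    by move=> /le_lt_trans h /h; rewrite ltxx.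
  by have := H2 i; have := H1 i'; rewrite lt ltnNge (ltnW lt) /= => /le_lt_trans h /h; rewrite ltxx.
move: y2; rewrite -ii' => y2; congr (_, _).
case: b b' y1 y2 {H1 H2} => -[] //; rewrite sgF sgT mul1r mulN1r oppr_gt0 => h1 h2.
  by have := lt_trans h1 h2; rewrite ltxx.
by have := lt_trans h1 h2; rewrite ltxx.
Qed.

End ConePartition.

(** * Radial parametrization of the indicatrices *)

Section FaceParam.
Context {R : realType} {m : nat} {M : manifold R m.+1} (F : finsler M).
Local Notation E := 'rV[R]_m.+1.
Local Notation P := 'rV[R]_m.
Local Notation E2 := ('rV[R]_m.+1 * 'rV[R]_m.+1)%type.
Variable c : chart R m.+1 M.
Hypothesis Ac : atlas c.

Definition G2 (z : E2) : R := tm_read F c z ^+ 2.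

(** The fundamental tensor in the chart of TM. Unlike [fund_tensor], it lives on a vector space in
    which base point and direction can vary together smoothly. *)
Definition gc (z : E2) (v w : E) : R :=
  2^-1 * 'D_((0, v) : E2) ('D_((0, w) : E2) G2) z.

Lemma G2_sm a (y : E) : chart_img c a -> y != 0 -> sm G2 (a, y).
Proof.
move=> ac y0; have H := finsler_sm F Ac ac y0.
by apply: sm_eq (smM H H) => z; rewrite /G2 expr2.
Qed.

Definition gmx (z : E2) : 'M[R]_m.+1 :=
  \matrix_(i, j) gc z (delta_mx 0 i) (delta_mx 0 j).

Lemma gcE a (y v w : E) : chart_img c a -> y != 0 ->
  gc (a, y) v w = (v *m gmx (a, y) *m w^T) 0 0.
Proof.
move=> ac y0; have sG := G2_sm ac y0.
rewrite /gc (derive2_zero_pair v w sG) mxE mulr_sumr [RHS]mxE.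
apply: eq_bigr => j _; rewrite mulrA; congr (_ * _).
rewrite !mxE mulr_sumr; apply: eq_bigr => i _.
by rewrite !mxE mulrCA.
Qed.

Lemma tvec_sm a (y : E) : chart_img c a -> sm (fun y : E => tvec c a y : E) y.
Proof. by move=> ac; apply: sm_lin; exact: tvec_linear. Qed.

Lemma derive_tvec a (y w : E) : chart_img c a ->
  'D_w (fun y : E => tvec c a y : E) y = tvec c a w.
Proof.
move=> ac; pose L : {linear E -> E} := HB.pack (fun y : E => tvec c a y : E)
  (GRing.isLinear.Build _ _ _ _ _ (tvec_linear Ac ac)).
have cL : continuous L by exact: findim_linear_cont.
by have [_ ->] := linear_cont_diff y w cL.
Qed.

Lemma tvec_neq0 a (y : E) : chart_img c a -> y != 0 -> (tvec c a y : E) != 0.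
Proof.
move=> ac; apply: contraNneq => ty0; have [xc _] := chart_invP ac.
by rewrite -(tcoord_tvec y Ac ac) ty0 tcoord0.
Qed.

(** For fixed [a] the map [tvec c a] is linear, so both fibre derivatives pass through it by the
    chain rule. *)
Lemma fund_tensor_tvec a (y v w : E) : chart_img c a -> y != 0 ->
  fund_tensor F (tvec c a y) (tvec c a v) (tvec c a w) = gc (a, y) v w.
Proof.
move=> ac y0.
pose x := chart_inv c a; pose f (z : E) : R := F x (z : Tan x) ^+ 2.
have sf (z : E) : z != 0 -> sm f z.
  move=> z0; have H := @finsler_sm_fiber _ _ _ F x z z0.
  by apply: sm_eq (smM H H) => z'; rewrite /f expr2.
have dL (z : E) : differentiable (fun y : E => tvec c a y : E) z.
  exact/sm_diff/tvec_sm.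
have ty0 := tvec_neq0 ac y0.
have yn : \near y, y != 0 :> E.
  have ci : {for y, continuous (fun z : E => z)} by exact: cvg_id.
  by apply: cvgr_neq0 ci y0.
have sG := G2_sm ac y0.
have dG : differentiable ('D_((0, w) : E2) G2) (a, y) by exact/sm_diff/sm_derive.
have df : differentiable ('D_(tvec c a w : E) f) (tvec c a y : E).
  exact/sm_diff/sm_derive/sf.
suff K : 'D_(tvec c a v : E) ('D_(tvec c a w : E) f) (tvec c a y : E)
    = 'D_((0, v) : E2) ('D_((0, w) : E2) G2) (a, y).
  by rewrite /fund_tensor /gc -K.
rewrite -(derive_slice v dG) -(derive_tvec y v ac).
rewrite -(derive_comp (f := fun y : E => tvec c a y : E) v (dL y) df).
(* The identity of first derivatives is about to be differentiated, so it is proved at all nonzero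
   [y'] near [y]. *)
apply: near_eq_derive; apply: filterS yn => y' y'0.
have dG' : differentiable G2 (a, y') by exact/sm_diff/G2_sm.
have df' : differentiable f (tvec c a y' : E) by exact/sm_diff/sf/tvec_neq0.
rewrite -(derive_slice w dG') -(derive_tvec y' w ac).
by rewrite -(derive_comp (f := fun y : E => tvec c a y : E) w (dL y') df').
Qed.

Variables (i : 'I_m.+1) (b : bool).
Local Notation theta := (theta i b).

(* The radial projection to the indicatrix of the point [theta s] of the cube. *)
Definition qf (z : E * P) : E := (tm_read F c (z.1, theta z.2))^-1 *: theta z.2.

Definition phi (a : E) (s : P) : E := tvec c a (qf (a, s)).

Lemma qf_sm a s : chart_img c a -> sm qf (a, s).
Proof.
move=> ac.
have st : sm (fun z : E * P => theta z.2) (a, s).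
  by apply: (sm_comp (f := snd) (g := theta)); [exact: sm_snd|exact: theta_sm].
apply: smZ => //; apply: sm_inv.
  apply: (sm_comp (f := fun z : E * P => (z.1, theta z.2)) (g := tm_read F c)).
    by apply: sm_pair => //; exact: sm_fst.
  by apply: finsler_sm => //; exact: theta_neq0.
by rewrite /= gt_eqF//; apply: tm_read_gt0 => //; exact: theta_neq0.
Qed.

Lemma qf_coef_gt0 a s : chart_img c a -> 0 < (tm_read F c (a, theta s))^-1.
Proof. by move=> ac; rewrite invr_gt0; apply: tm_read_gt0 => //; exact: theta_neq0. Qed.

Lemma qf_neq0 a s : chart_img c a -> qf (a, s) != 0.
Proof.
move=> ac; rewrite /qf scaler_eq0 negb_or gt_eqF ?qf_coef_gt0//=.
exact: theta_neq0.
Qed.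

Lemma qf_unit a s : chart_img c a -> tm_read F c (a, qf (a, s)) = 1.
Proof.
move=> ac; rewrite /qf tm_read_hom//; last exact: qf_coef_gt0.
by rewrite /= mulVf// gt_eqF//; apply: tm_read_gt0 => //; exact: theta_neq0.
Qed.

Lemma phi_unit a s : chart_img c a -> F (chart_inv c a) (phi a s) = 1.
Proof. exact: qf_unit. Qed.

Lemma qf_slice_sm a s : chart_img c a -> sm (fun s => qf (a, s)) s.
Proof.
move=> ac; apply: (sm_comp (f := fun s : P => (a, s)) (g := qf)).
  by apply: sm_pair; [exact: sm_cst|exact: sm_id].
exact: qf_sm.
Qed.

Lemma phi_sm a s : chart_img c a -> sm (phi a) s.
Proof.
move=> ac; apply: (sm_comp (f := fun s => qf (a, s)) (g := fun y : E => tvec c a y : E)).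
  exact: qf_slice_sm.
exact: tvec_sm.
Qed.

Lemma kap_qf a s : chart_img c a -> kap i b (qf (a, s)) = s.
Proof. by move=> ac; apply: kap_theta; rewrite gt_eqF// qf_coef_gt0. Qed.

Lemma qf_i a s : chart_img c a -> qf (a, s) 0 i != 0.
Proof.
by move=> ac; rewrite mxE theta_i mulf_neq0// ?sg_neq0// gt_eqF// qf_coef_gt0.
Qed.

Lemma phi_inj a : chart_img c a -> injective (phi a).
Proof.
move=> ac s s'; rewrite /phi => H.
have {}H : qf (a, s) = qf (a, s').
  by rewrite -(tcoord_tvec (qf (a, s)) Ac ac) H (tcoord_tvec _ Ac ac).
by rewrite -(kap_qf s ac) H kap_qf.
Qed.

(** The central projection [kap] is a smooth left inverse, so the differential has a left inverse as
    well. *)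
Lemma qf_immersion a s (w : P) : chart_img c a ->
  'D_w (fun s => qf (a, s)) s = 0 -> w = 0.
Proof.
move=> ac H.
have E1 : (fun s => kap i b (qf (a, s))) = id by apply/funext => s'; exact: kap_qf.
rewrite -(derive_id s w) -{}E1.
rewrite (derive_comp (f := fun s => qf (a, s)) (g := kap i b)).
- by rewrite H derive0.
- exact/sm_diff/qf_slice_sm.
- exact/sm_diff/kap_sm/qf_i.
Qed.

Lemma derive_phi a s (w : P) : chart_img c a ->
  'D_w (phi a) s = tvec c a ('D_w (fun s => qf (a, s)) s).
Proof.
move=> ac; rewrite /phi (derive_comp (f := fun s => qf (a, s)) (g := fun y : E => tvec c a y : E)).
- by rewrite derive_tvec.
- exact/sm_diff/qf_slice_sm.
- exact/sm_diff/tvec_sm.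
Qed.

(** The radial parametrization extends to the whole parameter space; this meets the openness
    requirement although integration will take place over a half-open face. *)
Lemma phi_param a : chart_img c a ->
  indicatrix_param F (chart_inv c a) setT (phi a).
Proof.
move=> ac; split.
- exact: openT.
- by apply/(smooth_sm _ openT) => s _; exact: phi_sm.
- by move=> s s' _ _; exact: phi_inj.
- move=> s _ w; rewrite derive_phi// => H; apply: (@qf_immersion a s w) => //.
  by apply/eqP/negPn/negP => /(tvec_neq0 ac); rewrite H eqxx.
- by move=> _ [s _ <-]; exact: phi_unit.
Qed.

Definition dq (k : 'I_m) (z : E * P) : E := 'D_((0, delta_mx 0 k) : E * P) qf z.

Definition dens (z : E * P) : R := Num.sqrt (\det (\matrix_(k < m, l < m)
  gc (z.1, qf z) (dq k z) (dq l z))).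

Lemma derive_qf_slice a s (w : P) : chart_img c a ->
  'D_w (fun s => qf (a, s)) s = 'D_((0, w) : E * P) qf (a, s).
Proof.
by move=> ac; apply: derive_slice; exact/sm_diff/qf_sm.
Qed.

Lemma vol_densityE a s : chart_img c a ->
  vol_density F (chart_inv c a) (phi a) s = dens (a, s).
Proof.
move=> ac.
suff K : \matrix_(k < m, l < m) fund_tensor F (phi a s : Tan (chart_inv c a))
      ('D_(delta_mx 0 k) (phi a) s) ('D_(delta_mx 0 l) (phi a) s) =
    \matrix_(k < m, l < m) gc (a, qf (a, s)) (dq k (a, s)) (dq l (a, s)).
  exact: (congr1 (fun A : 'M[R]_m => Num.sqrt (\det A)) K).
apply/matrixP => k l; rewrite [LHS]mxE [RHS]mxE !(derive_phi _ _ ac).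
rewrite /phi (fund_tensor_tvec _ _ ac (qf_neq0 s ac)).
by rewrite /dq -!(derive_qf_slice _ _ ac).
Qed.

(** The Gram matrix of an immersion for a positive definite metric is positive definite. Strict
    positivity is what keeps the square root smooth. *)
Lemma dens_det_gt0 a s : chart_img c a ->
  0 < \det (\matrix_(k < m, l < m) gc (a, qf (a, s)) (dq k (a, s)) (dq l (a, s))).
Proof.
move=> ac; apply: posdef_det_gt0 => u u0.
pose v := 'D_u (fun s => qf (a, s)) s.
have v0 : v != 0.
  by apply: contraNneq u0 => /(qf_immersion ac) ->.
have vE : v = u *m \matrix_k dq k (a, s).
  rewrite mulmx_sum_row /v
    [in LHS](derive_fcoord (fV := findim_rV m)); last exact/sm_diff/qf_slice_sm.
  by apply: eq_bigr => k _; rewrite rowK /= derive_qf_slice.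
have q0 := qf_neq0 s ac.
have -> : \matrix_(k < m, l < m) gc (a, qf (a, s)) (dq k (a, s)) (dq l (a, s))
    = (\matrix_k dq k (a, s)) *m gmx (a, qf (a, s)) *m (\matrix_k dq k (a, s))^T.
  apply/matrixP => k l; rewrite mxE (gcE _ _ ac q0).
  rewrite [LHS]mxE [RHS]mxE; apply: eq_bigr => j _; rewrite !mxE; congr (_ * _).
  by apply: eq_bigr => j' _; rewrite !mxE.
rewrite -!mulmxA -trmx_mul mulmxA -vE mulmxA -(gcE _ _ ac q0).
rewrite -(fund_tensor_tvec v v ac q0).
by apply: finsler_posdef; exact: tvec_neq0.
Qed.

Lemma dens_gt0 a s : chart_img c a -> 0 < dens (a, s).
Proof. by move=> ac; rewrite sqrtr_gt0; exact: dens_det_gt0. Qed.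

Lemma dens_sm a s : chart_img c a -> sm dens (a, s).
Proof.
move=> ac; have sq := qf_sm s ac.
apply: sm_sqrt; last exact: dens_det_gt0.
apply: sm_det => k l.
have sdq k' : sm (dq k') (a, s) by exact: sm_derive.
have sgc j j' : sm (fun z : E * P => gc (z.1, qf z) (delta_mx 0 j) (delta_mx 0 j')) (a, s).
  apply: (sm_comp (f := fun z : E * P => (z.1, qf z))
    (g := fun z => gc z (delta_mx 0 j) (delta_mx 0 j'))).
    by apply: sm_pair => //; exact: sm_fst.
  apply: smM; first exact: sm_cst.
  by apply/sm_derive/sm_derive/G2_sm => //; exact: qf_neq0.
(* The arguments [dq k z] and [dq l z] move with [z]; bilinearity reduces them to coordinate
   directions. *)
apply: (@sm_ext _ _ _ (fun z : E * P => \sum_j' (\sum_j dq k z 0 j *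
    gc (z.1, qf z) (delta_mx 0 j) (delta_mx 0 j')) * dq l z 0 j')).
  have c1 : {for (a, s), continuous (@fst E P)} by exact: cvg_fst.
  have H1 : \forall z \near (a, s), chart_img c z.1 by exact: (c1 _ (chart_img_near ac)).
  apply: filterS H1 => -[a' s'] /= a'c; rewrite mxE (gcE _ _ a'c (qf_neq0 s' a'c)).
  rewrite [RHS]mxE; apply: eq_bigr => j' _; rewrite !mxE; congr (_ * _).
  by apply: eq_bigr => j _; rewrite !mxE.
apply: sm_sum => j' _; apply: smM; last exact: sm_entry.
by apply: sm_sum => j _; apply: smM => //; exact: sm_entry.
Qed.

End FaceParam.

(** * Integration over the fibres *)

Section FibreIntegral.
Context {R : realType} {m : nat} {M : manifold R m.+1} (F : finsler M).
Local Notation E := 'rV[R]_m.+1.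
Local Notation P := 'rV[R]_m.
Local Notation E2 := ('rV[R]_m.+1 * 'rV[R]_m.+1)%type.
Local Notation I := (indicatrix_bundle F).
Local Notation Idx := ('I_m.+1 * bool)%type.
Variable mu : M -> {measure set (borel_rV R m.+1) -> \bar R}.
Hypothesis hmu : forall x : M, induced_volume F x (mu x).
Variable lam : {sigma_finite_measure set (borel_rV R m) -> \bar R}.
Hypothesis lamE : forall f : borel_rV R m -> \bar R, measurable_fun setT f ->
  (forall x, 0 <= f x)%E -> integral_rV f = (\int[lam]_x f x)%E.
Hypothesis lam_cube : (lam (@cube R m) < +oo)%E.
Hypothesis lam_ocube : (0 < lam (@ocube R m))%E.

Definition fibre_fun (x : M) (f : I -> R) (y : E) : R :=
  match pselect (F x (y : Tan x) = 1) with
  | left e => f (Ind e)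
  | right _ => 0
  end.

Lemma fibre_funE (f : I -> R) (u : I) : fibre_fun (ibase u) f (idir u) = f u.
Proof.
rewrite /fibre_fun; case: pselect => [e|]; last by case; exact: idir_unit.
by congr f; exact: ind_eq.
Qed.

Lemma fibre_fun_ind x (f : I -> R) (y : E) (e : F x (y : Tan x) = 1) :
  fibre_fun x f y = f (Ind e).
Proof. exact: (fibre_funE f (Ind e)). Qed.

Lemma face_lt_oo (i : 'I_m.+1) : (lam (@face R m i) < +oo)%E.
Proof.
apply: le_lt_trans lam_cube; apply: le_measure; rewrite ?inE.
- exact: face_borel.
- exact: cube_borel.
- exact: face_cube.
Qed.

Section AtPoint.
Variable c : chart R m.+1 M.
Hypothesis Ac : atlas c.
Variable a : E.
Hypothesis ac : chart_img c a.
Local Notation x := (chart_inv c a).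
Let xc : chart_dom c x := (chart_invP ac).1.

Definition sector (ib : Idx) : set (borel_rV R m.+1) :=
  [set y : E | F x (y : Tan x) = 1 /\ cone ib.1 ib.2 (tcoord c (y : Tan x))].

(** Homogeneity leaves one unit vector on each ray, so a unit vector in the cone is the radial
    projection of the face point [kap] of its coordinates. *)
Lemma sectorE ib : sector ib = phi F c ib.1 ib.2 a @` @face R m ib.1.
Proof.
apply/seteqP; split=> [y [Fy Cy]|y [s fs <-]].
  set z := tcoord c (y : Tan x) in Cy.
  have zy : tvec c a z = y :> E.
    rewrite -(tvec_tcoord (y : Tan x) Ac xc).
    by have [_ ->] := chart_invP ac.
  have zi : 0 < sg ib.2 * z 0 ib.1 := Cy.1.
  have zi0 : z 0 ib.1 != 0.
    by apply: contraTneq zi => ->; rewrite mulr0 ltxx.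
  have tk := theta_kap ib.2 zi0.
  exists (kap ib.1 ib.2 z).
    apply/(cone_theta ib.1 ib.2); rewrite tk; apply/cone_scale => //.
    by rewrite invr_gt0.
  rewrite -[RHS]zy /phi; congr (tvec c a _); rewrite /qf /= tk.
  rewrite tm_read_hom ?invr_gt0//.
  have -> : tm_read F c (a, z) = 1.
    by rewrite -Fy -zy.
  by rewrite mulr1 invrK scalerA mulfV ?scale1r// gt_eqF.
split; first exact: phi_unit.
rewrite /phi (tcoord_tvec _ Ac ac) /qf.
by apply/cone_scale; [exact: qf_coef_gt0|exact/cone_theta].
Qed.

Lemma indicatrix_neq0 (y : E) : F x (y : Tan x) = 1 -> y != 0.
Proof.
move=> Fy; apply/eqP => y0; move: Fy; rewrite y0 finsler_at0 => /eqP.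
by rewrite eq_sym oner_eq0.
Qed.

Lemma indicatrix_cover :
  indicatrix F x = \big[setU/set0]_(ib <- index_enum Idx) sector ib.
Proof.
rewrite -bigcup_seq; apply/seteqP; split=> [y Fy|y [ib _ []]//].
have ty : tcoord c (y : Tan x) != 0.
  apply: contraNneq (indicatrix_neq0 Fy) => ty0; apply/eqP.
  by apply: (tcoord_inj Ac xc); rewrite /= ty0 tcoord0.
have [ib Cib] := cone_cover ty.
by exists ib; [rewrite /= mem_index_enum|split].
Qed.

Lemma sector_triv : trivIset [set` index_enum Idx] sector.
Proof.
apply/trivIsetP => ib ib' _ _ /eqP neq; apply/seteqP; split=> // y [[_ C1] [_ C2]].
exact/neq/(cone_uniq C1 C2).
Qed.

Lemma phi_cont ib : continuous (phi F c ib.1 ib.2 a).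
Proof. by move=> s; exact/sm_cont/phi_sm. Qed.

Lemma phi_borel ib :
  measurable_fun setT (phi F c ib.1 ib.2 a : borel_rV R m -> borel_rV R m.+1).
Proof. by apply: continuous_borel_rV; exact: phi_cont. Qed.

(** The parametrizations remain in the indicatrix on the closed cube, which contains the faces:
    finitely many compact images cover it. *)
Lemma indicatrix_compact : compact (indicatrix F x : set E).
Proof.
have -> : indicatrix F x =
    \big[setU/set0]_(ib <- index_enum Idx) (phi F c ib.1 ib.2 a @` @cube R m).
  apply/seteqP; split=> y.
    rewrite indicatrix_cover -!bigcup_seq => -[ib Hib]; rewrite sectorE => -[s fs <-].
    by exists ib => //; exists s => //; exact: face_cube fs.
  by rewrite -bigcup_seq => -[ib _ [s _ <-]]; exact: phi_unit.
apply: bigsetU_compact => ib _; apply: continuous_compact.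
  by apply: continuous_subspaceT; exact: phi_cont.
exact: cube_rV_compact.
Qed.

Lemma indicatrix_borel : measurable (indicatrix F x : set (borel_rV R m.+1)).
Proof.
apply: (@borel_closed R m.+1); apply: compact_closed indicatrix_compact.
exact: norm_hausdorff.
Qed.

Lemma sector_borel ib : measurable (sector ib).
Proof.
have -> : sector ib = (indicatrix F x : set E) `&`
    (fun y : E => tcoord c (y : Tan x)) @^-1` cone ib.1 ib.2 by [].
apply: measurableI; first exact: indicatrix_borel.
have mt : measurable_fun setT
    ((fun y : E => tcoord c (y : Tan x)) : borel_rV R m.+1 -> borel_rV R m.+1).
  by apply: continuous_borel_rV => y; apply/sm_cont/sm_lin/tcoord_linear.
by rewrite -[X in measurable X]setTI; apply: mt => //; exact: cone_borel.
Qed.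

Lemma dens_slice_sm ib s : sm (fun s => dens F c ib.1 ib.2 (a, s)) s.
Proof.
apply: (sm_comp (f := fun s : P => (a, s)) (g := dens F c ib.1 ib.2)).
  by apply: sm_pair; [exact: sm_cst|exact: sm_id].
exact: dens_sm.
Qed.

Lemma dens_borel ib : measurable_fun setT
  ((fun s => dens F c ib.1 ib.2 (a, s)) : borel_rV R m -> R).
Proof. by apply: continuous_borel => s; exact/sm_cont/dens_slice_sm. Qed.

(** This restates [induced_volume] for one radial parametrization, with [lam] in place of the
    iterated integral and [dens] in place of [vol_density]. *)
Lemma mu_sector ib (A : set (borel_rV R m.+1)) : measurable A -> A `<=` sector ib ->
  mu x A = (\int[lam]_s
    (\1_(phi F c ib.1 ib.2 a @^-1` A) s * dens F c ib.1 ib.2 (a, s))%:E)%E.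
Proof.
move=> mA AD.
have -> : mu x A = mu x (A `&` phi F c ib.1 ib.2 a @` setT).
  congr (mu x _); apply/seteqP; split=> [y Ay|y []//]; split=> //.
  by have := AD _ Ay; rewrite sectorE => -[s _ <-]; exists s.
rewrite (hmu (phi_param F Ac ib.1 ib.2 ac) mA).
pose g : borel_rV R m -> \bar R := fun s =>
  (\1_(phi F c ib.1 ib.2 a @^-1` A) s * dens F c ib.1 ib.2 (a, s))%:E.
have E1 : (fun s : 'rV[R]_m => (\1_(setT `&` phi F c ib.1 ib.2 a @^-1` A) s *
    vol_density F (chart_inv c a) (phi F c ib.1 ib.2 a) s)%:E) = g.
  apply/funext => s.
  have := vol_densityE F Ac ib.1 ib.2 s ac.
  rewrite setTI => E; exact: (congr1 (fun r => (\1_(phi F c ib.1 ib.2 a @^-1` A) s * r)%:E) E).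
apply: (etrans (congr1 (@integral_rV R m) E1)).
have g0 s : (0 <= g s)%E.
  have d0 := ltW (dens_gt0 F Ac ib.1 ib.2 s ac).
  have i0 : 0 <= \1_(phi F c ib.1 ib.2 a @^-1` A) s :> R by rewrite indicE.
  by rewrite /g lee_fin; exact: (mulr_ge0 i0 d0).
suff mg : measurable_fun setT g by exact: (lamE mg g0).
apply/measurable_EFinP/measurable_funM; last exact: dens_borel.
apply: measurable_indic; rewrite -[X in measurable X]setTI.
exact: (phi_borel ib measurableT mA).
Qed.

Lemma phi_preimage ib : phi F c ib.1 ib.2 a @^-1` sector ib = @face R m ib.1.
Proof.
rewrite sectorE; apply/seteqP; split=> s /=; last by exists s.
by move=> [s' fs'] /(phi_inj Ac ac) <-.
Qed.

Lemma integral_sector_ge0 ib (f : borel_rV R m.+1 -> \bar R) :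
  measurable_fun (sector ib) f -> (forall y, sector ib y -> (0 <= f y)%E) ->
  (\int[mu x]_(y in sector ib) f y = \int[lam]_(s in @face R m ib.1)
    (f (phi F c ib.1 ib.2 a s) * (dens F c ib.1 ib.2 (a, s))%:E))%E.
Proof.
move=> mf f0; rewrite -phi_preimage.
apply: (@density_change_var _ _ (borel_rV R m) (borel_rV R m.+1) R
  (phi F c ib.1 ib.2 a) (phi_borel ib) lam (mu x) _ (sector_borel ib)
  (fun s => dens F c ib.1 ib.2 (a, s)) (dens_borel ib)) => //.
- by move=> s; rewrite ltW// dens_gt0.
- by move=> A mA AD; exact: mu_sector.
Qed.

Lemma mu_sector_lt_oo ib : (mu x (sector ib) < +oo)%E.
Proof.
have := integral_sector_ge0 (f := cst 1%E) (measurable_cst _) (fun _ _ => lee01) (ib := ib).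
rewrite integral_cst ?mul1e; last exact: sector_borel.
move=> ->; under eq_integral do rewrite mul1e.
have /integrableP[_] := compact_continuous_integrable (lam := lam)
  (@face_borel R m ib.1) (@face_cube R m ib.1) (@cube_rV_compact R m)
  (face_lt_oo ib.1) (fun s _ => sm_cont (dens_slice_sm ib s)).
apply: le_lt_trans; apply: ge0_le_integral => //.
- exact: face_borel.
- by move=> s _; rewrite lee_fin ltW// dens_gt0.
- by apply/measurable_EFinP; apply: measurable_funTS; exact: dens_borel.
- apply: measurable_funTS; apply: measurableT_comp => //.
  by apply/measurable_EFinP; exact: dens_borel.
- by move=> s _ /=; rewrite lee_fin ler_norm.
Qed.

Lemma mu_indicatrix_lt_oo : (mu x (indicatrix F x) < +oo)%E.
Proof.
rewrite indicatrix_cover.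
apply: (@le_lt_trans _ _ (\sum_(ib <- index_enum Idx) mu x (sector ib))%E).
  elim: (index_enum Idx) => [|ib r IH]; first by rewrite !big_nil measure0.
  rewrite !big_cons; apply: le_trans (measureU2 _ _ _) _.
  - exact: sector_borel.
  - by apply: bigsetU_measurable => ib' _; exact: sector_borel.
  - by rewrite leeD2l.
by apply: lte_sum_pinfty => ib _; exact: mu_sector_lt_oo.
Qed.

Lemma within_integrable (f : E -> R) : {within (indicatrix F x : set E), continuous f} ->
  (mu x).-integrable (indicatrix F x) (EFin \o (f : borel_rV R m.+1 -> R)).
Proof.
move=> cf; apply: measurable_bounded_integrable.
- exact: indicatrix_borel.
- exact: mu_indicatrix_lt_oo.
- by apply: within_continuous_borel => //; exact: indicatrix_borel.
have /compact_bounded := continuous_compact cf indicatrix_compact.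
move=> [K [Kr HK]]; exists K; split=> // k /HK bk y Iy.
by apply: bk; exists y.
Qed.

Lemma Rintegral_indicatrix (f : E -> R) :
  {within (indicatrix F x : set E), continuous f} ->
  \int[mu x]_(y in (indicatrix F x : set (borel_rV R m.+1))) f y =
  \sum_(ib : Idx) \int[lam]_(s in @face R m ib.1)
    (f (phi F c ib.1 ib.2 a s) * dens F c ib.1 ib.2 (a, s)).
Proof.
move=> cf; have intf := within_integrable cf.
have mf := measurable_int _ intf.
have mfs ib : measurable_fun (sector ib) (EFin \o f).
  apply: measurable_funS mf; first exact: indicatrix_borel.
  by move=> y [].
have E1 ib : (\int[mu x]_(y in sector ib) (f y)%:E = \int[lam]_(s in @face R m ib.1)
    (f (phi F c ib.1 ib.2 a s) * dens F c ib.1 ib.2 (a, s))%:E)%E.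
  (* The change of variables holds for nonnegative functions; since the density is nonnegative, it
     commutes with taking positive and negative parts. *)
  rewrite integralE [RHS]integralE.
  rewrite (integral_sector_ge0 (f := (fun y => (f y)%:E) ^\+%E))//; last first.
    exact: measurable_funepos.
  rewrite (integral_sector_ge0 (f := (fun y => (f y)%:E) ^\-%E))//; last first.
    exact: measurable_funeneg.
  have d0 s : 0 <= dens F c ib.1 ib.2 (a, s) by rewrite ltW// dens_gt0.
  congr (_ - _)%E; apply: eq_integral => s _.
    by rewrite !funeposE -!EFin_max -EFinM maxr_pMl// mul0r.
  by rewrite !funenegE -!EFinN -!EFin_max -EFinM maxr_pMl// mul0r mulNr.
rewrite {1}/Rintegral.
have := @integral_bigsetU_EFin _ (borel_rV R m.+1) R (mu x) Idx sector f
  (index_enum Idx) sector_borel (index_enum_uniq _) sector_triv.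
rewrite -indicatrix_cover => /(_ mf) ->.
under eq_bigr => ib _ do rewrite E1.
rewrite -sum_fine//.
move=> ib _; rewrite -E1.
apply: integrable_fin_num; first exact: sector_borel.
apply: integrableS intf; [exact: indicatrix_borel|exact: sector_borel|by move=> y []].
Qed.

End AtPoint.

Definition fibre_smooth (x : M) (f : I -> R) : Prop :=
  forall u : I, ibase u = x -> smooth_at f u.

(** Off the indicatrix [fibre_fun] takes its default value 0, hence continuity in the subspace
    sense. On it, a local smooth extension of [f] to TM restricts to the fibre. *)
Lemma fibre_fun_within x (f : I -> R) : fibre_smooth x f ->
  {within (indicatrix F x : set E), continuous (fibre_fun x f)}.
Proof.
move=> fs; apply/subspace_continuousP => y Iy.
pose u : I := Ind Iy.
have /smooth_atP[g sg Hg] := fs u erefl.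
pose T (y' : E) : E2 := (chart_at x x, y').
have Tu : icoord (chart_at x) u = T y by rewrite (icoord_at u).
have sT : sm T y by apply: sm_pair; [exact: sm_cst|exact: sm_id].
have sgT : sm (fun y' => g (T y')) y.
  by apply: (sm_comp sT); rewrite -Tu.
have n1 : \forall y' \near y, forall u', chart_dom (chart_at x) (ibase u') ->
    icoord (chart_at x) u' = T y' -> g (icoord (chart_at x) u') = f u'.
  have cT := sm_cont sT.
  apply: (cT [set z | forall u', chart_dom (chart_at x) (ibase u') ->
    icoord (chart_at x) u' = z -> g (icoord (chart_at x) u') = f u']).
  by rewrite -Tu; exact: Hg.
have E1 : fibre_fun x f y = g (T y).
  rewrite (fibre_fun_ind f Iy) -Tu; apply/esym; exact: (near_ind_self Hg).
suff K : fibre_fun x f @ within (indicatrix F x : set E) (nbhs y) --> g (T y).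
  by rewrite -E1 in K; exact: K.
apply: (@cvg_trans _ ((fun y' => g (T y')) @ within (indicatrix F x) (nbhs y))).
  apply: near_eq_cvg; rewrite near_withinE; apply: filterS n1 => y' H Iy'.
  rewrite (fibre_fun_ind f Iy').
  have Tu' : icoord (chart_at x) (Ind Iy' : I) = T y' by rewrite (icoord_at (Ind Iy' : I)).
  by rewrite -Tu'; apply: H => //; exact: atD.
by apply: cvg_within_filter; exact: (sm_cont sgT).
Qed.

Lemma indicatrix_integralE x (f : I -> R) : indicatrix_integral mu x f =
  \int[mu x]_(y in (indicatrix F x : set (borel_rV R m.+1))) fibre_fun x f y.
Proof. by []. Qed.

Lemma indicatrix_borel_at x : measurable (indicatrix F x : set (borel_rV R m.+1)).
Proof.
have := indicatrix_borel (atA x) (chart_img_map (atD x)).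
by rewrite (chart_mapK (atD x)).
Qed.

Lemma fibre_integrable x (f : I -> R) : fibre_smooth x f ->
  (mu x).-integrable (indicatrix F x) (EFin \o (fibre_fun x f : borel_rV R m.+1 -> R)).
Proof.
move=> /fibre_fun_within.
have := within_integrable (atA x) (chart_img_map (atD x)) (f := fibre_fun x f).
by rewrite (chart_mapK (atD x)).
Qed.

Lemma indicatrix_integral_ext x (f g : I -> R) :
  (forall u, ibase u = x -> f u = g u) ->
  indicatrix_integral mu x f = indicatrix_integral mu x g.
Proof.
move=> fg; rewrite !indicatrix_integralE; apply: eq_Rintegral => y.
by rewrite inE => Iy; rewrite !(fibre_fun_ind _ Iy); exact: fg.
Qed.

Lemma indicatrix_integral_linear x (k : R) (f g : I -> R) :
  fibre_smooth x f -> fibre_smooth x g ->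
  indicatrix_integral mu x (fun u => k * f u + g u) =
  k * indicatrix_integral mu x f + indicatrix_integral mu x g.
Proof.
move=> sf sg; have If := fibre_integrable sf; have Ig := fibre_integrable sg.
have mI := indicatrix_borel_at x.
rewrite !indicatrix_integralE -(RintegralZl k mI If) -RintegralD//; last first.
  exact: (integrableZl mI k If).
apply: eq_Rintegral => y.
by rewrite inE => Iy; rewrite !(fibre_fun_ind _ Iy).
Qed.

Lemma indicatrix_integral_cst x (k : R) :
  indicatrix_integral mu x (fun _ : I => k) = k * fine (mu x (indicatrix F x)).
Proof.
have mI := indicatrix_borel_at x.
rewrite indicatrix_integralE -(Rintegral_cst (mu x) mI k); apply: eq_Rintegral => y.
by rewrite inE => Iy; rewrite (fibre_fun_ind _ Iy).
Qed.

(** A single sector suffices: its density has a positive minimum on the compact cube, and its face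
    contains the open cube, which has positive measure. *)
Lemma indicatrix_vol_gt0 x : 0 < fine (mu x (indicatrix F x)).
Proof.
pose c := chart_at x; pose a := c x.
have Ac := atA x; have ac : chart_img c a := chart_img_map (atD x).
have := @Rintegral_indicatrix c Ac a ac (fun=> 1).
rewrite Rintegral_cst; last exact: indicatrix_borel.
rewrite mul1r /a (chart_mapK (atD x)) -/a => ->; last first.
  by apply: continuous_subspaceT => y; exact: cst_continuous.
have term0 (ib : Idx) : 0 <= \int[lam]_(s in @face R m ib.1)
    (1 * dens F c ib.1 ib.2 (a, s)).
  apply: Rintegral_ge0 => s _; rewrite mul1r; exact/ltW/dens_gt0.
pose ib0 : Idx := (ord0, false).
rewrite (bigD1 ib0)//= ltr_pwDl//; last by apply: sumr_ge0 => ib _; exact: term0.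
have [s0 _ s0min] : exists2 s0, (@cube R m) s0 &
    forall s, (@cube R m) s -> dens F c ord0 false (a, s0) <= dens F c ord0 false (a, s).
  have cd : continuous (fun s => dens F c ord0 false (a, s)).
    by move=> s; exact: (sm_cont (dens_slice_sm Ac ac ib0 s)).
  have [|s0 cs0 H] := @EVT_min_rV R m (fun s => dens F c ord0 false (a, s)) (@cube R m) _
    (@cube_rV_compact R m) (continuous_subspaceT cd).
    by exists 0 => j; rewrite mxE normr0.
  by exists s0; [rewrite inE in cs0|move=> s cs; apply: H; rewrite ?inE].
apply: (@lt_le_trans _ _ (\int[lam]_(s in @face R m ord0) dens F c ord0 false (a, s0))).
  rewrite Rintegral_cst; last exact: face_borel.
  rewrite mulr_gt0//; first exact: dens_gt0.
  rewrite fine_gt0//; apply/andP; split; last exact: face_lt_oo.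
  apply: lt_le_trans lam_ocube _; apply: le_measure; rewrite ?inE.
  - exact: ocube_borel.
  - exact: face_borel.
  - exact: ocube_face.
have ci (f : P -> R) : continuous f ->
    lam.-integrable (@face R m ord0) (EFin \o (f : borel_rV R m -> R)).
  move=> cf; apply: (compact_continuous_integrable (@face_borel R m ord0)
    (@face_cube R m ord0) (@cube_rV_compact R m) (face_lt_oo ord0)) => s _; exact: cf.
apply: le_Rintegral.
- exact: face_borel.
- by apply: ci => s; exact: cst_continuous.
- apply: ci => s; apply/sm_cont/smM; first exact: sm_cst.
  exact: (dens_slice_sm Ac ac ib0 s).
- by move=> s fs; rewrite mul1r; apply: s0min; exact: face_cube fs.
Qed.

(** Smoothness of the integrand at a parameter [s] comes from a local extension of [f] around the
    unit vector [u0] over [x0] given by [s], composed with the coordinates [T] of the moving unit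
    vector. Smoothness of [f] over nearby fibres justifies the sum formula there. *)
Lemma indicatrix_integral_sm x0 (f : I -> R) :
  (\forall x \near x0, fibre_smooth x f) ->
  sm (fun a => indicatrix_integral mu (chart_inv (chart_at x0) a) f) (chart_at x0 x0).
Proof.
move=> fs; set c := chart_at x0; set a0 := c x0.
have Ac : atlas c := atA x0; have xc0 : chart_dom c x0 := atD x0.
have ac0 : chart_img c a0 := chart_img_map xc0.
pose h (ib : Idx) (z : E * P) : R :=
  fibre_fun (chart_inv c z.1) f (tvec c z.1 (qf F c ib.1 ib.2 z)) * dens F c ib.1 ib.2 z.
apply: (@sm_ext _ _ _ (fun a => \sum_(ib : Idx) \int[lam]_(s in @face R m ib.1) h ib (a, s))).
  have n1 := chart_img_near ac0; have n2 := chart_inv_near xc0 fs.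
  apply: filterS2 n1 n2 => a ac fsa.
  rewrite indicatrix_integralE (Rintegral_indicatrix Ac ac (fibre_fun_within fsa)).
  by [].
apply: sm_sum => ib _.
apply: (Rintegral_param_sm (@face_borel R m ib.1) (@face_cube R m ib.1)
  (@cube_rV_compact R m) (face_lt_oo ib.1)) => s _.
apply: smM; last exact: dens_sm.
have x0E : chart_inv c a0 = x0 by exact: chart_mapK.
pose y0 : E := tvec c a0 (qf F c ib.1 ib.2 (a0, s)).
have Iy0 : F x0 (y0 : Tan x0) = 1.
  by have := phi_unit F Ac ib.1 ib.2 s ac0; rewrite /phi x0E.
pose u0 : I := Ind Iy0.
(* Over [x0] itself the chart [c] is the chosen one, so a vector equals its own coordinates. *)
have y0E : y0 = qf F c ib.1 ib.2 (a0, s).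
  have := tcoord_tvec (qf F c ib.1 ib.2 (a0, s)) Ac ac0.
  rewrite /tvec x0E -/c => <-.
  by rewrite (tcoord_at (_ : Tan x0)) /y0 /tvec x0E.
pose T (z : E * P) : E2 := (z.1, qf F c ib.1 ib.2 z).
have sT : sm T (a0, s) by apply: sm_pair; [exact: sm_fst|exact: qf_sm].
have Tu0 : icoord c u0 = T (a0, s) by rewrite (icoord_at u0) /T /= -y0E.
have /smooth_atP[g sg Hg] := nbhs_singleton fs u0 erefl.
apply: (@sm_ext _ _ _ (fun z => g (T z))); last by apply: (sm_comp sT); rewrite -Tu0.
have n1 : \forall z \near (a0, s), forall u', chart_dom c (ibase u') ->
    icoord c u' = T z -> g (icoord c u') = f u'.
  have cT := sm_cont sT.
  apply: (cT [set z | forall u', chart_dom c (ibase u') ->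
    icoord c u' = z -> g (icoord c u') = f u']).
  by rewrite -Tu0; exact: Hg.
have n2 : \forall z \near (a0, s), chart_img c z.1.
  have c1 : {for (a0, s), continuous (@fst E P)} by exact: cvg_fst.
  exact: (c1 _ (chart_img_near ac0)).
apply: filterS2 n1 n2 => -[a s'] H ac.
have e := phi_unit F Ac ib.1 ib.2 s' ac.
rewrite (fibre_fun_ind f e).
have [xac ca] := chart_invP ac.
have Tu' : icoord c (Ind e : I) = T (a, s').
  by rewrite /icoord /tm_coord /= ca /phi (tcoord_tvec _ Ac ac).
by rewrite -Tu'; apply: H.
Qed.

End FibreIntegral.

(** * The averaged connection *)

Section SmoothSections.
Context {R : realType} {n : nat} {M : manifold R n} {F : finsler M}.
Local Notation E := 'rV[R]_n.
Local Notation E2 := ('rV[R]_n * 'rV[R]_n)%type.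
Local Notation I := (indicatrix_bundle F).

(** [smooth_section] speaks of the chosen chart at each point; the differential of the change of
    charts, itself smooth, transfers it to every chart of the atlas. *)
Lemma smooth_section_tcoord (S : psection F) c (u : I) : smooth_section S ->
  atlas c -> chart_dom c (ibase u) -> smooth_at (fun u' => tcoord c (S u')) u.
Proof.
move=> sS Ac uc; pose c' := chart_at (ibase u).
have Ac' : atlas c' := atA (ibase u); have uc' : chart_dom c' (ibase u) := atD (ibase u).
have s1 := smooth_at_pair (smooth_at_icoord u) (sS u).
pose g (z : E2 * E) : E := 'D_(z.2) (c \o chart_inv c') z.1.1.
have sg : sm g (icoord c' u, tcoord c' (S u)).
  apply: (sm_derive_var (f := c \o chart_inv c') (p := fun z : E2 * E => z.1.1) (w := snd)).
  - exact: (trans_sm Ac' Ac uc' uc).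
  - by apply: (sm_comp (f := fst) (g := fst)); exact: sm_fst.
  - exact: sm_snd.
apply: smooth_at_ext (smooth_at_comp (s1 _ _) sg).
have n1 := near_ind_base (chart_dom_near uc).
apply: near_indS (near_indI (near_ind_dom u) n1) => u' [d' d].
by rewrite /g /= (tcoord_change _ Ac' Ac d' d).
Qed.

Lemma tcoord_fibre c (u : I) x (X : E) : ibase u = x ->
  tcoord c (X : Tan (ibase u)) = tcoord c (X : Tan x).
Proof. by move=> <-. Qed.

End SmoothSections.

(** * Fibre means of sections *)

Section FibreMean.
Context {R : realType} {m : nat} {M : manifold R m.+1} (F : finsler M).
Local Notation E := 'rV[R]_m.+1.
Local Notation I := (indicatrix_bundle F).
Variable mu : M -> {measure set (borel_rV R m.+1) -> \bar R}.
Hypothesis hmu : forall x : M, induced_volume F x (mu x).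

Lemma indicatrix_integralD x (k : R) (f g : I -> R) :
  fibre_smooth x f -> fibre_smooth x g ->
  indicatrix_integral mu x (fun u => k * f u + g u) =
  k * indicatrix_integral mu x f + indicatrix_integral mu x g.
Proof.
have [lam [lamE lc _]] := @integral_rV_measure R m.
exact: (indicatrix_integral_linear hmu lamE lc).
Qed.

Lemma indicatrix_volume_gt0 x : 0 < fine (mu x (indicatrix F x)).
Proof.
have [lam [lamE lc lo]] := @integral_rV_measure R m.
exact: (indicatrix_vol_gt0 hmu lamE lc lo).
Qed.

Lemma indicatrix_integral_smooth x0 (f : I -> R) :
  (\forall x \near x0, fibre_smooth x f) ->
  sm (fun a => indicatrix_integral mu (chart_inv (chart_at x0) a) f) (chart_at x0 x0).
Proof.
have [lam [lamE lc _]] := @integral_rV_measure R m.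
exact: (indicatrix_integral_sm hmu lamE lc).
Qed.

Lemma fibre_smooth_cst x (k : R) : fibre_smooth x (fun _ : I => k).
Proof. by move=> u _; exact: smooth_at_cst. Qed.

Lemma indicatrix_integral_sum x (J : Type) (r : seq J) (k : J -> R) (f : J -> I -> R) :
  (forall j, fibre_smooth x (f j)) ->
  indicatrix_integral mu x (fun u => \sum_(j <- r) k j * f j u) =
  \sum_(j <- r) k j * indicatrix_integral mu x (f j).
Proof.
move=> sf; elim: r => [|j r IH].
  rewrite big_nil (@indicatrix_integral_ext _ _ _ _ _ _ _ (fun _ : I => 0)).
    by rewrite indicatrix_integral_cst mul0r.
  by move=> u _; rewrite big_nil.
rewrite big_cons -IH -indicatrix_integralD//; last first.
  move=> u ux; apply: smooth_at_sum => j' _; apply: smooth_atM; first exact: smooth_at_cst.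
  exact: sf.
by apply: indicatrix_integral_ext => u _; rewrite big_cons.
Qed.

Definition fibre_mean (x : M) (S : psection F) : Tan x :=
  (fine (mu x (indicatrix F x)))^-1 *:
  \row_j indicatrix_integral mu x (fun u => (S u : E) 0 j).

Lemma fibre_mean_ext x (S S' : psection F) :
  (forall u, ibase u = x -> S u = S' u) -> fibre_mean x S = fibre_mean x S'.
Proof.
move=> SS'; rewrite /fibre_mean; congr (_ *: _); apply/rowP => j; rewrite !mxE.
by apply: indicatrix_integral_ext => u ux; rewrite SS'.
Qed.

Lemma fibre_smooth_tcoord x c (S : psection F) j : smooth_section S -> atlas c ->
  chart_dom c x -> fibre_smooth x (fun u => tcoord c (S u) 0 j).
Proof.
move=> sS Ac xc u ux; apply: (smooth_at_entry (f := fun u => tcoord c (S u))).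
by apply: smooth_section_tcoord => //; rewrite ux.
Qed.

Lemma fibre_mean_at x (S : psection F) :
  fibre_mean x S = (fine (mu x (indicatrix F x)))^-1 *:
    \row_j indicatrix_integral mu x (fun u => tcoord (chart_at x) (S u) 0 j) :> E.
Proof.
rewrite /fibre_mean; congr (_ *: _); apply/rowP => j; rewrite !mxE.
by apply: indicatrix_integral_ext => u ux; rewrite (tcoord_fibre _ _ ux) tcoord_at.
Qed.

Lemma fibre_mean_cst x (S : psection F) (X : E) :
  (forall u, ibase u = x -> S u = X :> E) -> fibre_mean x S = X :> E.
Proof.
move=> SX; have v0 := indicatrix_volume_gt0 x.
rewrite /fibre_mean (_ : \row_j _ = fine (mu x (indicatrix F x)) *: X).
  by rewrite scalerA mulVf ?scale1r// gt_eqF.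
apply/rowP => j; rewrite !mxE mulrC -(indicatrix_integral_cst F).
by apply: indicatrix_integral_ext => u ux; rewrite SX.
Qed.

Lemma fibre_mean_linear x (k : R) (S S' : psection F) :
  smooth_section S -> smooth_section S' ->
  fibre_mean x (fun u => k *: (S u : E) + (S' u : E)) =
  k *: (fibre_mean x S : E) + (fibre_mean x S' : E) :> E.
Proof.
move=> sS sS'; rewrite !fibre_mean_at scalerA mulrC -scalerA -scalerDr.
congr (_ *: _).
have Ac := atA x; have xc := atD x.
pose J (S : psection F) j := indicatrix_integral mu x (fun u => tcoord (chart_at x) (S u) 0 j).
rewrite -[LHS]/(\row_j J _ j) -[RHS]/(k *: \row_j J S j + \row_j J S' j).
apply/rowP => j.
have -> : (k *: \row_j J S j + \row_j J S' j) 0 j = k * J S j + J S' j.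
  by move: (J) => J'; rewrite !mxE.
rewrite [LHS]mxE /J -indicatrix_integralD; try exact: fibre_smooth_tcoord.
apply: indicatrix_integral_ext => u ux.
rewrite !(tcoord_fibre _ _ ux) !tcoord_at.
by move: (S u : E) (S' u : E) => a b; rewrite !mxE.
Qed.

(** The mean is defined by components in a chart that changes with [x]. A linear change of
    coordinates commutes with integration, so a fixed chart may be used, and only there can
    smoothness in [x] be expressed. *)
Lemma fibre_mean_tcoord x c (S : psection F) : smooth_section S -> atlas c ->
  chart_dom c x -> tcoord c (fibre_mean x S) = (fine (mu x (indicatrix F x)))^-1 *:
    \row_j indicatrix_integral mu x (fun u => tcoord c (S u) 0 j).
Proof.
move=> sS Ac xc; rewrite [fibre_mean x S]fibre_mean_at.
pose L : {linear E -> E} := HB.pack (fun X : E => tcoord c (X : Tan x))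
  (GRing.isLinear.Build _ _ _ _ _ (tcoord_linear Ac xc)).
have LE (X : E) j : L X 0 j = \sum_k L (delta_mx 0 k) 0 j * X 0 k.
  rewrite {1}[X]row_sum_delta linear_sum summxE; apply: eq_bigr => k _.
  by rewrite linearZ mxE mulrC.
rewrite -[LHS]/(L _) linearZ; congr (_ *: _); apply/rowP => j.
pose J j := indicatrix_integral mu x (fun u => tcoord (chart_at x) (S u) 0 j).
rewrite -[in LHS]/(\row_j J j) LE [RHS]mxE.
rewrite (eq_bigr (fun k => L (delta_mx 0 k) 0 j * J k)); last first.
  by move=> k _; move: (J) => J'; congr (_ * _); rewrite mxE.
rewrite /J.
rewrite -indicatrix_integral_sum; last first.
  by move=> k; apply: fibre_smooth_tcoord; [|exact: atA|exact: atD].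
apply: indicatrix_integral_ext => u ux.
rewrite (tcoord_fibre c _ ux) -[RHS]/(L (S u) 0 j) LE; apply: eq_bigr => k _.
by rewrite (tcoord_fibre _ _ ux) tcoord_at.
Qed.

Lemma fibre_mean_sm x0 (S : psection F) : smooth_section S ->
  sm (fun a => tcoord (chart_at x0) (fibre_mean (chart_inv (chart_at x0) a) S))
    (chart_at x0 x0).
Proof.
move=> sS; set c := chart_at x0; have Ac : atlas c := atA x0.
have xc : chart_dom c x0 := atD x0.
(* The volume is written as the integral of 1, so that the same smoothness result covers the
   normalization. *)
pose v (x : M) : R := indicatrix_integral mu x (fun _ : I => 1).
have vE x : v x = fine (mu x (indicatrix F x)).
  by rewrite /v indicatrix_integral_cst mul1r.
apply: (@sm_ext _ _ _ (fun a => (v (chart_inv c a))^-1 *: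
    \row_j indicatrix_integral mu (chart_inv c a) (fun u => tcoord c (S u) 0 j))).
  apply: filterS (chart_img_near (chart_img_map xc)) => a /chart_invP[d _].
  by rewrite vE fibre_mean_tcoord.
apply: smZ.
  apply: sm_inv; last by rewrite vE gt_eqF// indicatrix_volume_gt0.
  by apply: indicatrix_integral_smooth; apply: nearW => x; exact: fibre_smooth_cst.
apply: sm_row => j; apply: indicatrix_integral_smooth.
by apply: filterS (chart_dom_near xc) => x xc'; exact: fibre_smooth_tcoord.
Qed.

End FibreMean.

(** * Frames and vector fields on the base *)

Section SmoothFields.
Context {R : realType} {n : nat} {M : manifold R n}.
Local Notation E := 'rV[R]_n.

Lemma tcoord_sum c (x : M) (J : Type) (r : seq J) (X : J -> E) :
  atlas c -> chart_dom c x ->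
  tcoord c (\sum_(j <- r) X j : Tan x) = \sum_(j <- r) tcoord c (X j : Tan x).
Proof.
move=> Ac xc; pose L : {linear E -> E} := HB.pack (fun X : E => tcoord c (X : Tan x))
  (GRing.isLinear.Build _ _ _ _ _ (tcoord_linear Ac xc)).
by rewrite -[LHS]/(L _) linear_sum.
Qed.

Lemma smoothM_cst (k : R) : smoothM (fun _ : M => k).
Proof. by move=> c _ x _; exact: sm_cst. Qed.

Lemma smooth_vfield_sum (J : Type) (r : seq J) (Y : J -> forall x : M, Tan x) :
  (forall j, smooth_vfield (Y j)) ->
  smooth_vfield (fun x => \sum_(j <- r) (Y j x : E) : Tan x).
Proof.
move=> sY; apply/smooth_vfieldP => c Ac x xc.
apply: (@sm_ext _ _ _ (fun a => \sum_(j <- r) tcoord c (Y j (chart_inv c a)))).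
  apply: filterS (chart_img_near (chart_img_map xc)) => a /chart_invP[d _].
  by rewrite (tcoord_sum _ _ Ac d).
by apply: sm_sum => j _; have /smooth_vfieldP := sY j; exact.
Qed.

Lemma smooth_vfieldD (k : R) (Y Y' : forall x : M, Tan x) :
  smooth_vfield Y -> smooth_vfield Y' ->
  smooth_vfield (fun x => k *: (Y x : E) + (Y' x : E) : Tan x).
Proof.
move=> /smooth_vfieldP sY /smooth_vfieldP sY'; apply/smooth_vfieldP => c Ac x xc.
apply: (@sm_ext _ _ _ (fun a => k *: tcoord c (Y (chart_inv c a)) +
   tcoord c (Y' (chart_inv c a)))).
  apply: filterS (chart_img_near (chart_img_map xc)) => a /chart_invP[d _].
  by rewrite (tcoord_linear Ac d k (Y _) (Y' _)).
by apply: smD (sY' c Ac x xc); apply: smZ (sY c Ac x xc); exact: sm_cst.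
Qed.

Lemma frame_decomp c (x : M) (e : 'I_n -> E) (X : E) : atlas c -> chart_dom c x ->
  \matrix_(i, j) tcoord c (e i : Tan x) 0 j \in unitmx ->
  X = \sum_j (tcoord c (X : Tan x) *m
    invmx (\matrix_(i, j) tcoord c (e i : Tan x) 0 j)) 0 j *: e j.
Proof.
move=> Ac xc; set A := \matrix_(i, j) _ => uA.
apply: (tcoord_inj Ac xc); rewrite (tcoord_sum _ _ Ac xc).
rewrite -{1}[tcoord c (X : Tan x)](mulmxKV uA) mulmx_sum_row.
apply: eq_bigr => j _; rewrite (tcoordZ _ _ Ac xc); congr (_ *: _).
by apply/rowP => k; rewrite !mxE.
Qed.

Lemma extend_vector (x : M) (X : E) :
  exists2 Y : forall x : M, Tan x, smooth_vfield Y & Y x = X.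
Proof.
have [e [se /nbhs_singleton[xc uA]]] := global_frame x.
pose a j := (tcoord (chart_at x) (X : Tan x) *m
    invmx (\matrix_(i, j) tcoord (chart_at x) (e i x) 0 j)) 0 j.
exists (fun y => \sum_j a j *: (e j y : E)).
  apply: smooth_vfield_sum => j; apply: smooth_vfieldZ; last exact: se.
  exact: smoothM_cst.
by rewrite [RHS](frame_decomp X (atA x) xc uA).
Qed.

(* Hence an operator linear over the functions of M kills [Y] at [x]. *)
Lemma vanishing_decomp (x : M) (Y : forall x : M, Tan x) :
  smooth_vfield Y -> Y x = 0 :> E ->
  exists (rho : M -> R) (f : 'I_n -> M -> R) (e : 'I_n -> forall x : M, Tan x),
  [/\ smoothM rho, rho x != 0, forall j, smoothM (f j) /\ f j x = 0,
      forall j, smooth_vfield (e j) &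
      forall y, rho y *: (Y y : E) = \sum_j f j y *: (e j y : E)].
Proof.
move=> sY Yx0; have [e [se ne]] := global_frame x.
set c := chart_at x in ne; have Ac : atlas c := atA x; have xc : chart_dom c x := atD x.
pose A y : 'M[R]_n := \matrix_(i, j) tcoord c (e i y) 0 j.
(* The cutoff is supported where the frame is invertible, so the frame coefficients of [Y] extend
   smoothly by zero. *)
pose U : set E := interior [set a | chart_img c a /\ A (chart_inv c a) \in unitmx].
have Ux : U (c x).
  apply: filterS2 (chart_img_near (chart_img_map xc)) (chart_inv_near xc ne).
  by move=> a ? [].
have Ui : U `<=` chart_img c by move=> a /interior_subset[].
have oU : open U by exact: open_interior.
have [rho [r0 Hr]] := cutoff oU Ux Ui.
pose f j a : R := (tcoord c (Y (chart_inv c a)) *m invmx (A (chart_inv c a))) 0 j.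
have fE y j : chart_dom c y -> f j (c y) = (tcoord c (Y y) *m invmx (A y)) 0 j.
  by move=> yc; rewrite /f (chart_mapK yc).
(* The factor [1] puts [rho] in the form handled by [cutoff_smoothM]. *)
exists (fun y => rho y * 1), (fun j y => rho y * f j (c y)), e; split.
- apply: (cutoff_smoothM (x0 := x) (f := fun _ : E => 1)) => y.
  by case: (Hr y) => [[yc _ sr]|]; [left; do 2!split=> //; exact: sm_cst|right].
- by rewrite mulr1 gt_eqF.
- move=> j; split; last first.
    by rewrite (fE _ _ xc) Yx0 (tcoord0 Ac xc) mul0mx mxE mulr0.
  apply: (cutoff_smoothM (x0 := x)) => y.
  case: (Hr y) => [[yc Uy sr]|]; [left|by right].
  split=> //; split=> //.
  have [_ uy] := interior_subset Uy; rewrite chart_mapK// in uy.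
  have sV (Z : forall x : M, Tan x) k : smooth_vfield Z ->
      sm (fun a => tcoord c (Z (chart_inv c a)) 0 k) (c y).
    by move=> /smooth_vfieldP sZ; apply: sm_entry; exact: sZ.
  apply: (sm_mulmx (f := fun a => tcoord c (Y (chart_inv c a)))
    (g := fun a => invmx (A (chart_inv c a)))).
    by move=> i k; rewrite (ord1 i); exact: sV.
  apply: sm_invmx; first by rewrite chart_mapK.
  move=> i k; apply: (@sm_eq _ _ _ (fun a => tcoord c (e i (chart_inv c a)) 0 k)).
    by move=> a; rewrite mxE.
  exact/sV/se.
- exact: se.
move=> y; rewrite mulr1; case: (Hr y) => [[yc Uy _]|/nbhs_singleton ->]; last first.
  by rewrite scale0r big1// => j _; rewrite mul0r scale0r.
have [_ uy] := interior_subset Uy; rewrite chart_mapK// in uy.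
rewrite {1}(frame_decomp (Y y) Ac yc uy) scaler_sumr; apply: eq_bigr => j _.
by rewrite scalerA fE.
Qed.

End SmoothFields.

Section Leibniz.
Context {R : realType} {n : nat} {M : manifold R n} {F : finsler M}.
Local Notation E := 'rV[R]_n.
Local Notation E2 := ('rV[R]_n * 'rV[R]_n)%type.
Local Notation I := (indicatrix_bundle F).
Variable D : linear_connection F.

Definition dirder (f : M -> R) (x : M) (X : E) : R :=
  'D_X (f \o chart_inv (chart_at x)) (chart_at x x).

(** A function pulled back from M has an extension that ignores the fibre variable, so its
    derivative along [v] sees only the projection of [v]. *)
Lemma pullback_leibniz (f : M -> R) (Y : forall x : M, Tan x) (u : I) v :
  smoothM f -> smooth_vfield Y -> tangentI u v ->
  D (pullback_section (fun x => f x *: (Y x : E) : Tan x)) u v =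
  dirder f (ibase u) (dpi u v) *: (Y (ibase u) : E) +
    f (ibase u) *: (D (pullback_section Y) u v : E) :> E.
Proof.
move=> sf sY tv; set c := chart_at (ibase u).
have sfu (u' : I) : smooth_at (fun u => f (ibase u)) u'.
  by apply: smooth_at_base; apply: sf; [exact: atA|exact: atD].
pose h := f \o chart_inv c; pose g (z : E2) : R := h z.1.
have sh : sm h (c (ibase u)) by apply: sf; [exact: atA|exact: atD].
have s1 : sm fst (icoord c u) by exact: sm_fst.
have sg : sm g (icoord c u) by apply: (sm_comp s1); exact: sh.
have lg : local_ext (fun u : I => f (ibase u)) u g.
  have [A [oA Au sA]] := sg; exists A; split=> // u' d _.
  by rewrite /g /h /= chart_mapK.
rewrite (nabla_leibniz D sfu (pullback_smooth sY) tv lg).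
suff -> : tm_deriv u v g = dirder f (ibase u) (dpi u v) by [].
rewrite /tm_deriv /dirder -/c -/h /g.
rewrite (derive_comp (f := fst) v (sm_diff s1) (sm_diff sh)).
congr ('D_ _ _ _).
have H0 : nbhs (0 : R) setT by exact: filterT.
by apply: derive_line_linear; apply: filterS H0 => k _; rewrite /= addrC.
Qed.

(** Homogeneity over constants is the Leibniz rule for a constant function, whose derivative
    vanishes. *)
Lemma nablaD (k : R) (S S' : psection F) (u : I) v :
  smooth_section S -> smooth_section S' -> tangentI u v ->
  D (fun u => k *: (S u : E) + (S' u : E)) u v =
  k *: (D S u v : E) + (D S' u v : E) :> E.
Proof.
move=> sS sS' tv.
have sk : smooth_fun (fun _ : I => k) by move=> u'; exact: smooth_at_cst.
have skS : smooth_section ((fun u => k *: (S u : E)) : psection F).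
  move=> u'; have Ac := atA (ibase u').
  apply: (@smooth_at_ext _ _ _ _ _ (fun u => k *: tcoord (chart_at (ibase u')) (S u))).
    by apply: near_indS (near_ind_dom u') => u'' d; rewrite (tcoordZ _ _ Ac d).
  by apply: smooth_atZ (sS u'); exact: smooth_at_cst.
rewrite (nabla_add D skS sS' tv); congr (_ + _).
have lg : local_ext (fun _ : I => k) u (fun _ => k).
  have [A [oA Au sA]] := sm_cst k (icoord (chart_at (ibase u)) u).
  by exists A; split.
rewrite (nabla_leibniz D sk sS tv lg) /tm_deriv.
by rewrite [X in X *: _](_ : _ = 0) ?scale0r ?add0r// derive_cst.
Qed.

End Leibniz.

(** * The deviation of a connection from its average *)

Section Tensor.
Context {R : realType} {m : nat} {M : manifold R m.+1} (F : finsler M).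
Local Notation E := 'rV[R]_m.+1.
Local Notation E2 := ('rV[R]_m.+1 * 'rV[R]_m.+1)%type.
Local Notation I := (indicatrix_bundle F).
Variable mu : M -> {measure set (borel_rV R m.+1) -> \bar R}.
Hypothesis hmu : forall x : M, induced_volume F x (mu x).
Variables (H : nonlinear_connection F) (D : linear_connection F).
Local Notation field := (forall x : M, Tan x).
Implicit Types (Y Z : field) (u : I) (v : E2).

(** The direction is a field instead of a vector at one point, so that the integrand of the average
    becomes a global smooth section. *)
Definition lifted_derivative Y Z : psection F :=
  fun u => D (pullback_section Y) u (hlift H (u := u) (Z (ibase u))).

Lemma lifted_derivative_smooth Y Z : smooth_vfield Y -> smooth_vfield Z ->
  smooth_section (lifted_derivative Y Z).
Proof.
move=> sY sZ; apply: (nabla_smooth D (pullback_smooth sY)).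
exact: hlift_smooth.
Qed.

Lemma averaged_field Y Z x :
  averaged mu H D Y (Z x) = fibre_mean mu x (lifted_derivative Y Z).
Proof.
rewrite -[LHS]/(fibre_mean mu x
  (fun u => D (pullback_section Y) u (hlift H (u := u) (Z x)))).
by apply: fibre_mean_ext => u <-.
Qed.

Lemma averaged_linear_dir Y x (k : R) (X X' : E) : smooth_vfield Y ->
  averaged mu H D Y (k *: X + X' : Tan x) =
  k *: (averaged mu H D Y (X : Tan x) : E) + (averaged mu H D Y (X' : Tan x) : E) :> E.
Proof.
move=> sY; have [Z sZ <-] := extend_vector x X; have [Z' sZ' <-] := extend_vector x X'.
rewrite !averaged_field -(fibre_mean_linear hmu); try exact: lifted_derivative_smooth.
rewrite -[LHS]/(averaged mu H D Y ((fun x => k *: (Z x : E) + (Z' x : E) : Tan x) x)).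
rewrite averaged_field; apply: fibre_mean_ext => u _.
rewrite /lifted_derivative.
have := hlift_linear H u k (Z (ibase u)) (Z' (ibase u)) => ->.
by apply: (nabla_lin D (pullback_smooth sY)); exact: hlift_tangent.
Qed.

Lemma averagedD Y Y' x (k : R) (X : E) : smooth_vfield Y -> smooth_vfield Y' ->
  averaged mu H D (fun x => k *: (Y x : E) + (Y' x : E) : Tan x) (X : Tan x) =
  k *: (averaged mu H D Y (X : Tan x) : E) + (averaged mu H D Y' (X : Tan x) : E) :> E.
Proof.
move=> sY sY'; have [Z sZ <-] := extend_vector x X.
rewrite !averaged_field -(fibre_mean_linear hmu); try exact: lifted_derivative_smooth.
apply: fibre_mean_ext => u _.
exact: (nablaD D k (pullback_smooth sY) (pullback_smooth sY')
  (hlift_tangent H u (Z (ibase u)))).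
Qed.

(** Every lift of [X] projects to [X], so the term with the derivative of [f] is the same at all
    points of the fibre and equals its own normalized mean. *)
Lemma averaged_leibniz (f : M -> R) Y x (X : E) : smoothM f -> smooth_vfield Y ->
  averaged mu H D (fun x => f x *: (Y x : E) : Tan x) (X : Tan x) =
  dirder f x X *: (Y x : E) + f x *: (averaged mu H D Y (X : Tan x) : E) :> E.
Proof.
move=> sf sY; have [Z sZ <-] := extend_vector x X.
rewrite !averaged_field.
pose K : psection F := fun u => f x *: (lifted_derivative Y Z u : E) +
  dirder f x (Z x) *: (Y (ibase u) : E).
have sK : smooth_section ((fun u => dirder f x (Z x) *: (Y (ibase u) : E)) : psection F).
  exact: (pullback_smooth (smooth_vfieldZ (@smoothM_cst _ _ _ (dirder f x (Z x))) sY)).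
rewrite (@fibre_mean_ext _ _ _ _ _ _ _ K).
  rewrite (fibre_mean_linear hmu x (f x) (lifted_derivative_smooth sY sZ) sK) addrC.
  by congr (_ + _); apply: (fibre_mean_cst hmu) => u <-.
move=> u ux; rewrite /K /lifted_derivative.
rewrite (pullback_leibniz D sf sY (hlift_tangent H u (Z (ibase u)))).
by have [_ ->] := hliftP H u (Z (ibase u)); rewrite addrC -ux.
Qed.

Definition deviation Y u v : E :=
  (averaged mu H D Y (dpi u v) : E) - (D (pullback_section Y) u v : E).

Lemma deviationZ (f : M -> R) Y u v : smoothM f -> smooth_vfield Y -> tangentI u v ->
  deviation (fun x => f x *: (Y x : E) : Tan x) u v = f (ibase u) *: deviation Y u v.
Proof.
move=> sf sY tv; rewrite /deviation (averaged_leibniz _ _ sf sY).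
by rewrite (pullback_leibniz D sf sY tv) opprD addrACA subrr add0r scalerBr.
Qed.

Lemma deviationD (k : R) Y Y' u v : smooth_vfield Y -> smooth_vfield Y' -> tangentI u v ->
  deviation (fun x => k *: (Y x : E) + (Y' x : E) : Tan x) u v =
  k *: deviation Y u v + deviation Y' u v.
Proof.
move=> sY sY' tv; rewrite /deviation (averagedD _ _ _ sY sY').
rewrite (nablaD D k (pullback_smooth sY) (pullback_smooth sY') tv).
by rewrite opprD addrACA scalerBr.
Qed.

Lemma deviation_sum (J : Type) (r : seq J) (Y : J -> field) u v :
  (forall j, smooth_vfield (Y j)) -> tangentI u v ->
  deviation (fun x => \sum_(j <- r) (Y j x : E) : Tan x) u v =
  \sum_(j <- r) deviation (Y j) u v.
Proof.
move=> sY tv; elim: r => [|j r IH].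
  (* The empty sum equals 0 times itself, so [deviationZ] with the constant 0 gives its value. *)
  have s0 := smooth_vfield_sum [::] sY.
  have := deviationZ (@smoothM_cst _ _ _ 0) s0 tv.
  rewrite scale0r => E0; rewrite [RHS]big_nil -[RHS]E0; congr (deviation _ u v).
  by apply/functional_extensionality_dep => x; rewrite scale0r big_nil.
have sr := smooth_vfield_sum r sY.
rewrite big_cons -IH -[deviation (Y j) u v]scale1r -(deviationD 1 (sY j) sr tv).
congr (deviation _ u v); apply/functional_extensionality_dep => x.
by rewrite big_cons scale1r.
Qed.

Lemma deviation_vanish Y u v : smooth_vfield Y -> Y (ibase u) = 0 :> E ->
  tangentI u v -> deviation Y u v = 0.
Proof.
move=> sY Y0 tv; have [rho [f [e [sr r0 sf se E1]]]] := vanishing_decomp sY Y0.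
have E2 : (fun x => rho x *: (Y x : E) : Tan x) =
    (fun x => \sum_j (f j x *: (e j x : E)) : Tan x).
  by apply/functional_extensionality_dep.
apply: (scalerI r0); rewrite -(deviationZ sr sY tv) E2 scaler0.
have sfe j : smooth_vfield (fun x => f j x *: (e j x : E) : Tan x).
  by apply: smooth_vfieldZ (se j); have [] := sf j.
rewrite (deviation_sum _ sfe tv) big1// => j _; have [sfj fj0] := sf j.
by rewrite (deviationZ sfj (se j) tv) fj0 scale0r.
Qed.

Lemma deviation_linear_dir Y u (k : R) v v' : smooth_vfield Y -> tangentI u v ->
  tangentI u v' -> deviation Y u (k *: v + v') = k *: deviation Y u v + deviation Y u v'.
Proof.
move=> sY tv tv'; rewrite /deviation (nabla_lin D (pullback_smooth sY) k tv tv').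
rewrite -[dpi u (k *: v + v')]/(k *: (dpi u v : E) + (dpi u v' : E)).
by rewrite (averaged_linear_dir _ _ _ _ sY) opprD addrACA scalerBr.
Qed.

(** An arbitrary choice, with no regularity in [x]; [deviation_atE] shows that [deviation_at] does
    not depend on it. *)
Definition extension (x : M) (X : E) : field := sval (cid2 (extend_vector x X)).

Lemma extension_smooth x X : smooth_vfield (extension x X).
Proof. by rewrite /extension; case: cid2. Qed.

Lemma extension_at x X : extension x X x = X.
Proof. by rewrite /extension; case: cid2. Qed.

Definition deviation_at u v (X : E) : E := deviation (extension (ibase u) X) u v.

Lemma deviation_atE Y u v : smooth_vfield Y -> tangentI u v ->
  deviation_at u v (Y (ibase u)) = deviation Y u v.
Proof.
move=> sY tv; apply/eqP; rewrite -subr_eq0 -[X in _ - X]scale1r -scaleNr addrC.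
rewrite -(deviationD _ sY (extension_smooth _ _) tv); apply/eqP.
apply: deviation_vanish tv; last by rewrite extension_at scaleN1r addNr.
exact: (smooth_vfieldD (-1) sY (extension_smooth _ _)).
Qed.

Lemma deviation_at_linear u v : tangentI u v -> linear (deviation_at u v).
Proof.
move=> tv k X X'; have sX := extension_smooth (ibase u) X.
have sX' := extension_smooth (ibase u) X'.
rewrite {2 3}/deviation_at -(deviationD k sX sX' tv).
rewrite -(deviation_atE (smooth_vfieldD k sX sX') tv).
by rewrite !extension_at.
Qed.

Lemma deviation_at_linear_dir u k v v' X : tangentI u v -> tangentI u v' ->
  deviation_at u (k *: v + v') X = k *: deviation_at u v X + deviation_at u v' X.
Proof. exact/deviation_linear_dir/extension_smooth. Qed.

Lemma averaged_smooth Y Z u0 : smooth_vfield Y -> smooth_vfield Z ->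
  smooth_at (fun u => tcoord (chart_at (ibase u0)) (averaged mu H D Y (Z (ibase u)))) u0.
Proof.
move=> sY sZ; pose G x := tcoord (chart_at (ibase u0)) (averaged mu H D Y (Z x)).
apply: (smooth_at_base (f := G)).
apply: sm_eq (fibre_mean_sm hmu (ibase u0) (lifted_derivative_smooth sY sZ)) => a.
by rewrite /G /= averaged_field.
Qed.

Lemma frame_coef_smooth u0 (e : 'I_m.+1 -> field) (X : I -> E) :
  let c := chart_at (ibase u0) in
  let A u := \matrix_(i, j) tcoord c (e i (ibase u)) 0 j in
  (forall i, smooth_vfield (e i)) -> A u0 \in unitmx ->
  smooth_at (fun u => tcoord c (X u : Tan (ibase u))) u0 -> forall j,
  smooth_at (fun u => (tcoord c (X u : Tan (ibase u)) *m invmx (A u)) 0 j) u0.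
Proof.
move=> c A se uA sX j.
have [si _] := smooth_at_invmx
  (fun i k => smooth_at_entry k (smooth_vfield_ind u0 (se i))) uA.
apply: (@smooth_at_eq _ _ _ _ _ (fun u => \sum_k tcoord c (X u : Tan (ibase u)) 0 k *
    invmx (A u) k j)).
  by move=> u; rewrite [RHS]mxE.
apply: smooth_at_sum => k _; apply: smooth_atM; last exact: si.
exact: (smooth_at_entry (f := fun u => tcoord c (X u : Tan (ibase u)))).
Qed.

(** The extensions inside [deviation_at] vary uncontrollably with [u]. Expanding both [S u] and the
    projection of [V u] in one frame with smooth coefficients replaces them by the finitely many
    fields [e j], for which the average and [D] are known to be smooth. *)
Lemma deviation_at_smooth (S : psection F) (V : I -> E2) u0 :
  smooth_section S -> smooth_ivfield V ->
  smooth_at (fun u => tcoord (chart_at (ibase u0)) (deviation_at u (V u) (S u) : Tan (ibase u))) u0.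
Proof.
move=> sS sV; set c := chart_at (ibase u0); have Ac : atlas c := atA (ibase u0).
have [e [se ne]] := global_frame (ibase u0).
pose A u := \matrix_(i, j) tcoord c (e i (ibase u)) 0 j.
have nA := near_ind_base ne; have [_ uA] := near_ind_self nA.
pose p u j := (tcoord c (S u) *m invmx (A u)) 0 j.
pose q u i := (tcoord c (dpi u (V u)) *m invmx (A u)) 0 i.
have sp j : smooth_at (fun u => p u j) u0 by exact: frame_coef_smooth (sS u0) j.
have sq i : smooth_at (fun u => q u i) u0.
  apply: (frame_coef_smooth (X := fun u => dpi u (V u))) => //.
  apply: (@smooth_at_ext _ _ _ _ _ (fun u => (ttcoord c u (V u)).1)).
    by apply: near_indS (near_ind_dom u0) => u d; exact: ttcoord_fst.
  by apply: (smooth_at_comp (g := fst) (sV u0).2); exact: sm_fst.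
pose B j u : E := \sum_i q u i *: tcoord c (averaged mu H D (e j) (e i (ibase u))) -
  tcoord c (D (pullback_section (e j)) u (V u)).
apply: (@smooth_at_ext _ _ _ _ _ (fun u => \sum_j p u j *: B j u)); last first.
  apply: smooth_at_sum => j _; apply: smooth_atZ (sp j) _; apply: smooth_atD.
    by apply: smooth_at_sum => i _; apply: smooth_atZ (sq i) _; exact: averaged_smooth.
  apply: smooth_atN.
  exact: (nabla_smooth D (pullback_smooth (se j)) sV).
apply: near_indS nA => u [d uAu]; have [tv _] := sV u.
pose L : {linear E -> E} := HB.pack (deviation_at u (V u))
  (GRing.isLinear.Build _ _ _ _ _ (deviation_at_linear tv)).
rewrite (congr1 (deviation_at u (V u)) (frame_decomp (S u) Ac d uAu)).
rewrite -[deviation_at u (V u) _]/(L _) linear_sum.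
rewrite (tcoord_sum _ _ Ac d); apply: eq_bigr => j _.
rewrite linearZ (tcoordZ _ _ Ac d); congr (_ *: _).
rewrite -[L _]/(deviation_at u (V u) (e j (ibase u))) (deviation_atE (se j) tv).
rewrite /deviation addrC -scaleN1r (tcoord_linear Ac d) scaleN1r addrC; congr (_ - _).
have la : linear (fun X : E => averaged mu H D (e j) (X : Tan (ibase u)) : E).
  by move=> k X X'; exact: averaged_linear_dir.
pose L' : {linear E -> E} := HB.pack (fun X : E => averaged mu H D (e j) (X : Tan (ibase u)) : E)
  (GRing.isLinear.Build _ _ _ _ _ la).
rewrite -[averaged mu H D (e j) (dpi u (V u))]/(L' _).
rewrite (congr1 L' (frame_decomp (dpi u (V u)) Ac d uAu)) linear_sum (tcoord_sum _ _ Ac d).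
apply: eq_bigr => i _; rewrite [L' _]linearZZ.
by rewrite (tcoordZ _ _ Ac d).
Qed.

End Tensor.

(** The difference splits into [p - p0], [t *: (q - q0)] and [(t - t0) *: q0], each of norm at most
    [eps / 4]; the summand 1 in the bound on [t - t0] avoids dividing by zero when [q0 = 0]. *)
Lemma affine_path_lt (R : realType) (W : normedModType R) (eps t t0 : R)
    (p q p0 q0 : W) : 0 <= t <= 1 -> `|t - t0| < eps / 4 / (`|q0| + 1) ->
  `|p - p0| < eps / 4 -> `|q - q0| < eps / 4 ->
  `|p + t *: q - (p0 + t0 *: q0)| < eps.
Proof.
move=> /andP[t_ge0 t1] tt0 pp0 qq0.
have -> : p + t *: q - (p0 + t0 *: q0) = (p - p0) + (t *: (q - q0) + (t - t0) *: q0).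
  rewrite scalerBr scalerBl opprD addrACA; congr (_ + _).
  by rewrite addrA subrK.
apply: (le_lt_trans (ler_normD _ _)).
apply: (le_lt_trans (lerD (lexx _) (ler_normD _ _))).
rewrite !normrZ (ger0_norm t_ge0).
have k1 : 0 < `|q0| + 1 by rewrite ltr_wpDl.
have h1 : t * `|q - q0| <= eps / 4.
  by rewrite -[leRHS]mul1r; apply: (ler_pM t_ge0 _ t1 (ltW qq0)).
have h2 : `|t - t0| * `|q0| <= eps / 4.
  rewrite -[leRHS](@divfK _ (`|q0| + 1)) ?gt_eqF//.
  by apply: (ler_pM _ _ (ltW tt0)); rewrite ?lerDl.
have e0 := le_lt_trans (normr_ge0 _) pp0.
lra.
Qed.

(** * The segment of connections *)

Section Deformation.
Context {R : realType} {m : nat} {M : manifold R m.+1} (F : finsler M).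
Local Notation E := 'rV[R]_m.+1.
Local Notation E2 := ('rV[R]_m.+1 * 'rV[R]_m.+1)%type.
Local Notation I := (indicatrix_bundle F).
Variable mu : M -> {measure set (borel_rV R m.+1) -> \bar R}.
Hypothesis hmu : forall x : M, induced_volume F x (mu x).
Variables (H : nonlinear_connection F) (D : linear_connection F).
Local Notation dev := (deviation_at mu H D).

Definition deform_fun (t : R) (S : psection F) (u : I) (v : E2) : Tan (ibase u) :=
  (D S u v : E) + t *: dev u v (S u).

Lemma deviation_at_linearE u v (k : R) (X X' : E) : tangentI u v ->
  dev u v (k *: X + X') = k *: dev u v X + dev u v X'.
Proof. by move=> tv; exact: deviation_at_linear. Qed.

Lemma deviation_atZ u v (k : R) (X : E) : tangentI u v ->
  dev u v (k *: X) = k *: dev u v X.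
Proof.
move=> tv; have d0 : dev u v 0 = 0.
  have := deviation_at_linearE (-1) 0 0 tv.
  by rewrite scaler0 addr0 scaleN1r addNr.
by have := deviation_at_linearE k X 0 tv; rewrite d0 !addr0.
Qed.

Lemma deform_lin t S : smooth_section S -> forall u (a : R) v w,
  tangentI u v -> tangentI u w ->
  deform_fun t S u (a *: v + w) =
  a *: (deform_fun t S u v : E) + (deform_fun t S u w : E).
Proof.
move=> sS u a v w tv tw; rewrite /deform_fun (nabla_lin D sS a tv tw).
rewrite (deviation_at_linear_dir hmu _ _ a _ tv tw) !scalerDr addrACA.
by rewrite !scalerA (mulrC t).
Qed.

Lemma deform_add t S S' : smooth_section S -> smooth_section S' ->
  forall u v, tangentI u v ->
  deform_fun t (fun u' => (S u' : E) + (S' u' : E)) u v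
  = (deform_fun t S u v : E) + (deform_fun t S' u v : E).
Proof.
move=> sS sS' u v tv; rewrite /deform_fun (nabla_add D sS sS' tv).
have := deviation_at_linearE 1 (S u) (S' u) tv; rewrite !scale1r => ->.
by rewrite scalerDr addrACA.
Qed.

Lemma deform_leibniz t f S : smooth_fun f -> smooth_section S ->
  forall u v g, tangentI u v -> local_ext f u g ->
  deform_fun t (fun u' => f u' *: (S u' : E)) u v
  = tm_deriv u v g *: (S u : E) + f u *: (deform_fun t S u v : E).
Proof.
move=> sf sS u v g tv lg; rewrite /deform_fun (nabla_leibniz D sf sS tv lg).
rewrite (@deviation_atZ u v (f u) (S u) tv) [in RHS]scalerDr [RHS]addrA.
by rewrite !scalerA (mulrC t).
Qed.

Lemma tcoord_deform c t (S : psection F) (V : I -> E2) (u : I) : atlas c ->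
  chart_dom c (ibase u) -> tcoord c (deform_fun t S u (V u)) =
  tcoord c (D S u (V u)) + t *: tcoord c (dev u (V u) (S u) : Tan (ibase u)).
Proof.
move=> Ac d; rewrite /deform_fun addrC (tcoord_linear Ac d t (dev _ _ _) (D S _ _)).
by rewrite addrC.
Qed.

Lemma deform_smooth t S V : smooth_section S -> smooth_ivfield V ->
  smooth_section (fun u => deform_fun t S u (V u)).
Proof.
move=> sS sV u0; set c := chart_at (ibase u0); have Ac : atlas c := atA (ibase u0).
apply: (@smooth_at_ext _ _ _ _ _ (fun u => tcoord c (D S u (V u)) +
    t *: tcoord c (dev u (V u) (S u) : Tan (ibase u)))).
  by apply: near_indS (near_ind_dom u0) => u d; rewrite (tcoord_deform _ _ _ Ac d).
apply: smooth_atD; first exact: (nabla_smooth D sS sV).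
apply: smooth_atZ; first exact: smooth_at_cst.
exact: (deviation_at_smooth hmu).
Qed.

Definition deform (t : R) : linear_connection F :=
  LinearConnection (deform_lin t) (deform_add t) (deform_leibniz t) (deform_smooth t).

Lemma smooth_at_cont (W : normedModType R) (f : I -> W) (u0 : I) :
  smooth_at f u0 -> forall eps : R, 0 < eps ->
  near_ind u0 (fun u => `|f u - f u0| < eps).
Proof.
move=> /smooth_atP[g /sm_cont cg Hg] eps e0.
rewrite -(near_ind_self Hg).
have /cvgrPdist_lt/(_ _ e0) H1 := cg.
apply: near_indS (near_indI Hg (near_ind_coord H1)) => u [<-].
by rewrite distrC.
Qed.

Lemma deform_continuous : continuous_family deform.
Proof.
move=> S V sS sV t0 u0 t01 c eps e0; have Ac : atlas c := atA (ibase u0).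
pose p u := tcoord c (D S u (V u)).
pose q u := tcoord c (dev u (V u) (S u) : Tan (ibase u)).
have e4 : 0 < eps / 4 by rewrite divr_gt0.
have np := smooth_at_cont (nabla_smooth D sS sV u0) e4.
have nq := smooth_at_cont (deviation_at_smooth hmu H D u0 sS sV) e4.
have /nbhs_ballP[d d0 Hd] := near_indI np nq.
pose K := `|q u0| + 1.
have K0 : 0 < K by rewrite ltr_wpDl.
exists (Num.min d (eps / 4 / K)); first by rewrite lt_min d0 divr_gt0.
move=> t u /andP[t_ge0 t_le1] uc.
rewrite !lt_min => /andP[_ tt0] /andP[uu0 _].
have [p1 q1] : `|p u - p u0| < eps / 4 /\ `|q u - q u0| < eps / 4.
  apply: (Hd (icoord c u)) => //; rewrite -ball_normE /ball_ /=.
  by rewrite distrC.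
rewrite (tcoord_deform _ _ _ Ac uc) (tcoord_deform _ _ _ Ac (atD (ibase u0))).
rewrite -/(p u) -/(q u) -/(p u0) -/(q u0).
have t1 : 0 <= t <= 1 by rewrite t_ge0 t_le1.
exact: (affine_path_lt t1 tt0 p1 q1).
Qed.

Lemma deform0 : connection_eq (deform 0) D.
Proof. by move=> S _ u v _; rewrite /= /deform_fun scale0r addr0. Qed.

(** On a pulled-back field the derivative by [deform 1] and the averaged derivative agree as
    vectors, so their matrices coincide in every frame. *)
Lemma deform1 : is_pullback (averaged mu H D) (deform 1).
Proof.
move=> U e _ se _ u v _ tv; congr (conn_matrix _ _); apply/funext => j.
rewrite /= /deform_fun scale1r (deviation_atE hmu H D (se j) tv) /deviation.
by rewrite addrC subrK.
Qed.

End Deformation.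

(* In dimension 0 the only tangent vector is 0, so I is empty. *)
Lemma no_unit_vector (R : realType) (M : manifold R 0) (F : finsler M) :
  indicatrix_bundle F -> False.
Proof. by move=> u; have := idir_neq0 u; rewrite (thinmx0 (idir u)) eqxx. Qed.

Theorem theorem3 (R : realType) (n : nat) (M : manifold R n) (F : finsler M)
    (mu : M -> {measure set (borel_rV R n) -> \bar R})
    (hmu : forall x : M, induced_volume F x (mu x))
    (H : nonlinear_connection F) (D : linear_connection F) :
  exists N : R -> linear_connection F,
    [/\ continuous_family N,
        connection_eq (N 0) D &
        is_pullback (averaged mu H D) (N 1)].
Proof.
(* The faces of a cube need dimension [m.+1]; in dimension 0 there is no point [u] and the constant
   family will do. *)
case: n M F mu hmu H D => [|m] M F mu hmu H D.
  exists (fun _ => D); split=> //.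
    by move=> S V _ _ t0 u0; case: (no_unit_vector u0).
  by move=> U e _ _ _ u; case: (no_unit_vector u).
exists (deform hmu H D); split.
- exact: deform_continuous.
- exact: deform0.
- exact: deform1.
Qed.
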